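(* Let $G=(V,E,J)$ be a connected transitive weighted graph and let $\Gamma\subseteq\mathrm{Aut}(G)$ be a closed, transitive, unimodular subgroup. Let $\mu$ be a $\Gamma$-invariant probability measure on $[0,1]^E$. Then for every $h>0$, \[ \mathbb E_{\mu,h}\Bigl[\mathbb 1(\mathscr T_\eta)\sqrt{\tfrac{\mathbf p_\eta}{(1-\mathbf p_\eta)J_\eta}}\Bigr]\le 21\sqrt h, \] where the integrand is interpreted as $0$ when $\mathbf p_\eta=1$.
   Context: Weighted graph: countable graph with positive edge weights $J_e$, $\sum_{e\ni v}J_e<\infty$ for each $v$; automorphisms preserve $J$. $\Gamma$ acts on $[0,1]^E$ by $(\gamma\mathbf p)_e=\mathbf p_{\gamma^{-1}e}$. Percolation in random environment: $\mathbf p=(\mathbf p_e)$ has law $\mu$; independent i.i.d. Uniform$[0,1]$ variables $(U_e)$; $\omega(e)=\mathbb 1(U_e\le\mathbf p_e)$; edges with $\omega(e)=1$ are open. Ghost field: conditionally on $\mathbf p$, independently of $\omega$, each edge $e$ is declared green independently with probability $1-e^{-hJ_e}$. Fix a vertex $o$; $\eta$ is an oriented edge emanating from $o$, chosen independently of everything else with probability proportional to $J_e$. $\mathbb E_{\mu,h}$ is expectation for the joint law of $(\mathbf p,\omega,\text{ghost field},\eta)$. A cluster (connected component of the open subgraph) touches an edge if the edge has an endpoint in the cluster. $\mathscr T_e$ is the event that $e$ is closed and its endpoints lie in distinct clusters of $\omega$, each of which touches some green edge, and at least one of which is finite. *)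

(* Defs.v *)
From HB Require Import structures.
From mathcomp Require Import all_boot all_order all_algebra.
From mathcomp Require Import all_classical all_reals all_analysis.
From Stdlib Require Import Relations.
Set Implicit Arguments. Unset Strict Implicit. Unset Printing Implicit Defensive.
Import Order.TTheory GRing.Theory Num.Theory.
Local Open Scope classical_set_scope.
Local Open Scope ring_scope.

(* A (multi)graph: vertex set V, edge set E (both countable), and
   [ends e] the two endpoints of e (the order of the pair is an arbitrary
   reference orientation; the edge itself is unoriented). *)

Section Graph.
Variables (V E : countType) (ends : E -> V * V).

Definition incident (v : V) (e : E) : Prop := (ends e).1 = v \/ (ends e).2 = v.

Definition adj_in (ok : E -> bool) (x y : V) : Prop :=
  exists e, ok e /\ (ends e = (x, y) \/ ends e = (y, x)).

Definition connected_graph : Prop :=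
  forall x y : V, clos_refl_trans V (adj_in (fun _ => true)) x y.

Definition cluster (om : E -> bool) (x : V) : set V :=
  [set y | clos_refl_trans V (adj_in om) x y].

Definition touches_green (green : E -> bool) (C : set V) : Prop :=
  exists f, green f /\ (C (ends f).1 \/ C (ends f).2).

Definition Tevent (om green : E -> bool) : set E :=
  [set e | om e = false /\
     ~ cluster om (ends e).1 (ends e).2 /\
     touches_green green (cluster om (ends e).1) /\
     touches_green green (cluster om (ends e).2) /\
     (finite_set (cluster om (ends e).1) \/ finite_set (cluster om (ends e).2))].

Variables (R : realType) (J : E -> R).

Definition is_aut (g : (V -> V) * (E -> E)) : Prop :=
  bijective g.1 /\ bijective g.2 /\
  (forall e, ends (g.2 e) = (g.1 (ends e).1, g.1 (ends e).2) \/
             ends (g.2 e) = (g.1 (ends e).2, g.1 (ends e).1)) /\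
  (forall e, J (g.2 e) = J e).

Definition comp_aut (g k : (V -> V) * (E -> E)) : (V -> V) * (E -> E) :=
  (g.1 \o k.1, g.2 \o k.2).

Definition id_aut : (V -> V) * (E -> E) := (id, id).

Definition is_subgroup_Aut (Gam : set ((V -> V) * (E -> E))) : Prop :=
  (forall g, Gam g -> is_aut g) /\
  Gam id_aut /\
  (forall g k, Gam g -> Gam k -> Gam (comp_aut g k)) /\
  (forall g, Gam g -> exists k, Gam k /\
     comp_aut g k = id_aut /\ comp_aut k g = id_aut).

(* closed in Aut(G) for the topology of pointwise convergence *)
Definition is_closed_subgroup (Gam : set ((V -> V) * (E -> E))) : Prop :=
  forall g, is_aut g ->
    (forall (sv : seq V) (se : seq E), exists k, Gam k /\
        (forall v, v \in sv -> k.1 v = g.1 v) /\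
        (forall e, e \in se -> k.2 e = g.2 e)) ->
    Gam g.

Definition is_transitive (Gam : set ((V -> V) * (E -> E))) : Prop :=
  forall x y : V, exists g, Gam g /\ g.1 x = y.

Definition stabilizer (Gam : set ((V -> V) * (E -> E))) (x : V) :=
  [set g | Gam g /\ g.1 x = x].

(* unimodularity (Trofimov / Lyons--Peres characterization):
   |Stab(x) y| = |Stab(y) x| for all x, y *)
Definition is_unimodular (Gam : set ((V -> V) * (E -> E))) : Prop :=
  forall x y : V,
    card_eq [set g.1 y | g in stabilizer Gam x] [set g.1 x | g in stabilizer Gam y].

Definition prod_measurable (A : set (E -> R)) : Prop :=
  <<s [set C | exists e (B : set R), measurable B /\
                 C = (fun f : E -> R => f e) @^-1` B] >> A.

(* oriented edges: (e, true) goes from (ends e).1 to (ends e).2,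
   (e, false) the other way *)
Definition tail (x : E * bool) : V :=
  if x.2 then (ends x.1).1 else (ends x.1).2.

End Graph.

(* Main.v *)
Require Import Defs.
From HB Require Import structures.
From mathcomp Require Import all_boot all_order all_algebra finmap.
From mathcomp Require Import all_classical all_reals all_analysis.
From mathcomp Require Import measurable_realfun.
From mathcomp Require Import ring lra.
From Stdlib Require Import Relations.
Set Implicit Arguments. Unset Strict Implicit. Unset Printing Implicit Defensive.
Import Order.TTheory GRing.Theory Num.Theory numFieldNormedType.Exports.
Local Open Scope classical_set_scope.
Local Open Scope ring_scope.

(** Give a closed edge [e] the weight [sqrt (J p / (1 - p))] and an open one the
    weight [- sqrt (J (1 - p) / p)]: given the environment this has mean [0] and
    variance [J]. Let [g K] indicate that the cluster [K] is finite and touches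
    green. Opening a closed edge between clusters [K1] and [K2] replaces
    [g K1 + g K2] by [g (K1 u K2)], and the loss is at least the indicator that
    both touch green and one is finite. Since the weights balance, resampling
    [e] bounds the weighted probability of the two-ghost event at [e] by the
    expected weight of [e] times the number of finite green clusters it touches.
    The mass-transport principle turns the sum of this over edges at [o] into
    [2 E (g K / |K|) H], where [K] is the cluster of [o] and [H] the total weight
    of the edges touching it. If [m] is the [J]-mass of these edges, then [K]
    touches green with probability at most [min 1 (h m)], and [m <= |K| J(o)], so
    everything reduces to [E h |H| / (1 + h m) <= sqrt h]. Exploring the cluster
    edge by edge, [h^2 H^2 / (1 + h m)^2 + h / (1 + h m)] is a supermartingale
    started from [h].

    The signed sums only make sense after restricting to edges with [J >= eps]
    and [eps <= p <= 1 - eps]; Fatou's lemma removes this restriction, and also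
    reduces the exploration to finite edge sets. The constant obtained is [4]. *)

(** * Countable sums *)

(** The weights are forced. Mean zero gives both sides of the resampled inequality a common factor.
    Variance [J] makes the variance accumulated by an exploration at most the mass it has revealed,
    and that same mass governs the chance of touching green. Together the two conditions leave no
    other choice up to sign. Divided by [J], the closed weight is exactly the integrand, and drawing
    [eta] proportionally to [J] cancels this division.

    The obstacle is a subtraction. Opening an edge leaves a nonnegative term on the smaller side of
    the inequality, which can be cancelled only if its integral is finite. The cut-offs on [p] and
    [J] bound each weight by a multiple of [J], so this term becomes bounded. The cut-off on [J] has
    a second use: only finitely many edges around a finite cluster keep a nonzero weight, so a
    finite exploration sees [H] exactly.

    The constant is [4 = 2 * 2]: an edge has two ends in the mass transport, and
    [min 1 t <= 2 t / (1 + t)] with [t = h m]. The rate [sqrt h] comes from a second moment of at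
    most [h]. *)

Section CountableSums.
Local Open Scope ereal_scope.
Context {R : realType}.

Lemma exchange_esum (S T : choiceType) (a : S -> T -> \bar R) :
  (forall i j, 0 <= a i j) ->
  \esum_(i in [set: S]) \esum_(j in [set: T]) a i j =
  \esum_(j in [set: T]) \esum_(i in [set: S]) a i j.
Proof.
move=> a0; rewrite !esum_esum//.
rewrite (reindex_esum ([set: T] `*`` (fun=> [set: S])) _ (fun z => (z.2, z.1)))//.
split => //; first by move=> [x y] [x' y'] _ _ /= [-> ->].
by move=> [x y] _; exists (y, x).
Qed.

Lemma esum_count (T : countType) (f : T -> \bar R) : (forall x, 0 <= f x) ->
  \esum_(x in [set: T]) f x = \sum_(n <oo) oapp f 0 (pickle_inv n).
Proof.
move=> f0.
rewrite nneseries_esumT; last by move=> n; case: (pickle_inv n) => //=.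
rewrite (esumID [set n | exists x : T, n = choice.pickle x]) ?setTI ?setTI; last first.
  by move=> n _; case: (pickle_inv n) => //=.
rewrite [X in _ + X]esum1 ?adde0; last first.
  move=> n /= nx; case E : (pickle_inv n) => [x|]//.
  exfalso; apply: nx; exists x; have := @choice.pickle_invK T n.
  by rewrite /ocancel E /= => ->.
rewrite (reindex_esum setT _ (@choice.pickle T)).
  by apply: eq_esum => x _; rewrite pickleK_inv.
split; first by move=> x _; exists x.
- by move=> x y _ _; exact: (pcan_inj choice.pickleK).
- by move=> _ [x ->]; exists x.
Qed.

Lemma esumZl (T : countType) (c : R) (f : T -> \bar R) : (0 <= c)%R ->
  (forall x, 0 <= f x) ->
  \esum_(x in [set: T]) (c%:E * f x) = c%:E * \esum_(x in [set: T]) f x.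
Proof.
move=> c0 f0; rewrite !esum_count//; last by move=> x; rewrite mule_ge0.
rewrite -nneseriesZl//; last by move=> n _; case: (pickle_inv n) => //=.
by apply: eq_eseriesr => n _; case: (pickle_inv n) => //=; rewrite mule0.
Qed.

Lemma esum_term_le (T : choiceType) (f : T -> \bar R) x :
  (forall x, 0 <= f x) -> f x <= \esum_(y in [set: T]) f y.
Proof.
move=> f0; rewrite (esumID [set x])// setTI esum_set1// leeDl// esum_ge0//.
Qed.

Section measure.
Context d (S : measurableType d) (mu : {measure set S -> \bar R}).

Lemma emeasurable_esum (T : countType) (f : T -> S -> \bar R) :
  (forall x s, 0 <= f x s) -> (forall x, measurable_fun setT (f x)) ->
  measurable_fun setT (fun s => \esum_(x in [set: T]) f x s).
Proof.
move=> f0 mf.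
rewrite (_ : (fun s => _) =
  fun s => \sum_(n <oo) oapp (fun x => f x s) 0 (pickle_inv n)); last first.
  by apply/funext => s; rewrite esum_count.
apply: ge0_emeasurable_sum => [k s _ _|k _]; case: (pickle_inv k) => //=.
Qed.

Lemma integral_esum (T : countType) (f : T -> S -> \bar R) :
  (forall x s, 0 <= f x s) -> (forall x, measurable_fun setT (f x)) ->
  \int[mu]_s (\esum_(x in [set: T]) f x s) =
  \esum_(x in [set: T]) \int[mu]_s f x s.
Proof.
move=> f0 mf.
under eq_integral do rewrite esum_count//.
rewrite integral_nneseries//; last 2 first.
- by move=> n; case: (pickle_inv n).
- by move=> n s _; case: (pickle_inv n) => /=.
rewrite esum_count => [|x]; last by apply: integral_ge0.
apply: eq_eseriesr => n _; case: (pickle_inv n) => //=.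
by rewrite integral0.
Qed.

(** Fatou's lemma in the form used for both limits: eventual domination gives [f <= limn_einf g], so
    no convergence of [g] has to be proved and the threshold [N] may depend on the point. *)
Lemma integral_le_eventually (f : S -> \bar R) (g : nat -> S -> \bar R) (c : \bar R) :
  measurable_fun setT f -> (forall n, measurable_fun setT (g n)) ->
  (forall s, 0 <= f s) -> (forall n s, 0 <= g n s) ->
  (forall s, exists N, forall n, (N <= n)%N -> f s <= g n s) ->
  (forall n, \int[mu]_s g n s <= c) -> \int[mu]_s f s <= c.
Proof.
move=> mf mg f0 g0 fg gc.
apply: (@le_trans _ _ (\int[mu]_s limn_einf (g^~ s))).
  apply: ge0_le_integral => //.
  - rewrite /limn_einf; apply: measurableT_comp => //.
    by apply: measurable_fun_limn_esup => n; exact: measurableT_comp.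
  - move=> s _; have [N fN] := fg s.
    rewrite limn_einf_lim; apply: lime_ge; first exact: is_cvg_einfs.
    exists N => //= n Nn; apply: le_ereal_inf_tmp => _ [m /= nm <-].
    by apply: fN; exact: leq_trans nm.
apply: le_trans (fatou _ _ _ _) _ => //.
apply: le_trans (limn_einf_sup _) _ => //.
rewrite limn_esup_lim; apply: lime_le; first exact: is_cvg_esups.
apply: nearW => n; apply: ge_ereal_sup => _ [m /= _ <-]; exact: gc.
Qed.

End measure.
End CountableSums.

(** * Product spaces and independence *)
(** The generators are those of [prod_measurable], so a set satisfying that predicate is by
    conversion a measurable set of [fspace E R]. The general value type also serves for Boolean
    configurations. *)
Definition coord_cylinder (E : Type) d (X : measurableType d) : set (set (E -> X)) :=
  [set C | exists e (B : set X), measurable B /\ C = (fun f : E -> X => f e) @^-1` B].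

Notation fspace E X := (g_sigma_algebraType (@coord_cylinder E _ X)).

Lemma measurable_coord (E : Type) d (X : measurableType d) (e : E) :
  measurable_fun setT (fun f : fspace E X => f e).
Proof.
by move=> _ B mB; rewrite setTI; apply: sub_sigma_algebra; exists e, B.
Qed.

Lemma measurable_fspace (E : Type) d (X : measurableType d) d' (S : measurableType d')
    (g : S -> fspace E X) :
  (forall e, measurable_fun setT (fun s => g s e)) -> measurable_fun setT g.
Proof.
move=> mg; apply: (@measurability _ _ S (fspace E X) setT g (@coord_cylinder E _ X)) => //.
by move=> _ [_ [e [B [mB ->]]] <-]; exact: mg.
Qed.

Section ImageMeasure.
Context {R : realType} d1 d2 (S : measurableType d1) (T : measurableType d2)
  (mu : {measure set S -> \bar R}) (f : S -> T) (mf : measurable_fun setT f).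

Definition image_measure : {measure set T -> \bar R}.
Proof. pose m : {measure set T -> \bar R} := pushforward mu f; exact: m. Defined.

Lemma image_measureE A : image_measure A = mu (f @^-1` A).
Proof. by []. Qed.

Lemma integral_image_measure (g : T -> \bar R) :
  measurable_fun setT g -> (forall z, 0 <= g z)%E ->
  (\int[image_measure]_z g z = \int[mu]_w g (f w))%E.
Proof. by move=> mg g0; rewrite (ge0_integral_pushforward mf mu). Qed.

End ImageMeasure.

Section Independence.
Local Open Scope ereal_scope.
Context {R : realType} d (Omega : measurableType d) (P : probability Omega R).

Lemma integral_mrestr (D : set Omega) (mD : measurable D) (f : Omega -> \bar R) :
  measurable_fun setT f -> (forall x, 0 <= f x) ->
  \int[mrestr P mD]_x f x = \int[P]_(x in D) f x.
Proof.
move=> mf f0; rewrite -(setUv D) ge0_integral_setU//=; last 3 first.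
- exact: measurableC.
- by rewrite setUv.
- by apply/disj_setPS; rewrite setICr.
rewrite [X in _ + X](_ : _ = 0) ?adde0; last first.
  apply: null_set_integral => //=; first exact: measurableC.
  - exact: measurable_funTS.
  - by rewrite /mrestr setICl measure0.
apply: eq_measure_integral => A mA AD; rewrite /= /mrestr setIidl//.
Qed.

(** Agreement on rectangles identifies the law of the pair with the product of the two laws; Tonelli
    then integrates [c] out with [X] frozen. *)
Lemma product_law_integral dS (S : measurableType dS) (X : {RV P >-> S})
    (c : {RV P >-> R}) (f : S * R -> \bar R) :
  (forall A B, measurable A -> measurable B ->
    P (X @^-1` A `&` c @^-1` B) = P (X @^-1` A) * P (c @^-1` B)) ->
  measurable_fun setT f -> (forall z, 0 <= f z) ->
  \int[P]_w f (X w, c w) = \int[P]_w \int[distribution P c]_u f (X w, u).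
Proof.
move=> ind mf f0.
have mXc : measurable_fun setT (fun w => (X w, c w)).
  by apply: measurable_fun_pair.
pose Xc_ : {RV P >-> (S * R)%type} := mfun_Sub (mem_set mXc).
rewrite -(@ge0_integral_distribution _ _ _ _ _ P Xc_ f)//.
rewrite -(@ge0_integral_distribution _ _ _ _ _ P X
  (fun s => \int[distribution P c]_u f (s, u)))//; last 2 first.
- exact: measurable_fun_fubini_tonelli_F.
- by move=> y; exact: integral_ge0.
rewrite -fubini_tonelli1//; apply: eq_measure_integral => A mA _.
apply/esym; apply: product_measure_unique => // B C mB mC; exact: ind.
Qed.

(** With [X] frozen, the event [c <= Y (X w)] has probability [Y (X w)]. Here [c] will be the
    uniform variable of one edge and [X] the data independent of it; the threshold is [p e] for
    percolation and the constant [gthr e] for the ghost field. *)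
Lemma uniform_threshold_integral dS (S : measurableType dS) (X : Omega -> S)
    (c : Omega -> R) (Y : S -> R) (H1 H2 : S -> \bar R) :
  measurable_fun setT X -> measurable_fun setT c ->
  (forall A B, measurable A -> measurable B ->
    P (X @^-1` A `&` c @^-1` B) = P (X @^-1` A) * P (c @^-1` B)) ->
  (forall y : R, (0 <= y <= 1)%R -> P [set w | (c w <= y)%R] = y%:E) ->
  measurable_fun setT Y ->
  measurable_fun setT H1 -> (forall z, 0 <= H1 z) ->
  measurable_fun setT H2 -> (forall z, 0 <= H2 z) ->
  (forall w, (0 <= Y (X w) <= 1)%R) ->
  \int[P]_w (if (c w <= Y (X w))%R then H1 (X w) else H2 (X w)) =
  \int[P]_w ((Y (X w))%:E * H1 (X w) + (1 - Y (X w))%:E * H2 (X w)).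
Proof.
move=> mX mc ind unif mY mH1 H10 mH2 H20 Y01.
pose X_ : {RV P >-> S} := mfun_Sub (mem_set mX).
pose c_ : {RV P >-> R} := mfun_Sub (mem_set mc).
pose f (z : S * R) := if (z.2 <= Y z.1)%R then H1 z.1 else H2 z.1.
rewrite (_ : (fun w => _) = fun w => f (X_ w, c_ w))//.
rewrite product_law_integral//; last 2 first.
- apply: measurable_fun_ifT => //.
  + by apply: measurable_fun_ler => //; exact: measurableT_comp.
  + exact: measurableT_comp.
  + exact: measurableT_comp.
- by move=> [s u]; rewrite /f /=; case: ifP.
apply: eq_integral => w _; rewrite /f /=.
pose D := [set u : R | (u <= Y (X w))%R].
have mD : measurable D by rewrite /D -set_itvNyc; exact: measurable_itv.
have PD : distribution P c_ D = (Y (X w))%:E by exact: unif.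
have PDC : distribution P c_ (~` D) = (1 - Y (X w))%:E.
  by rewrite EFinB -PD; exact: (probability_setC (distribution P c_)).
rewrite -PD -PDC muleC [X in _ + X]muleC.
transitivity (\int[distribution P c_]_u
    (H1 (X w) * (\1_D u)%:E + H2 (X w) * (\1_(~` D) u)%:E)).
  apply: eq_integral => u _; rewrite !indicE; case: ifPn => uY.
    rewrite mem_set//= memNset ?mule1 ?mule0 ?adde0//.
  rewrite memNset; last by move=> /= uY'; rewrite uY' in uY.
  by rewrite mem_set ?mule1 ?mule0 ?add0e//; exact/negP.
have mi A : measurable A ->
    measurable_fun setT (fun u : R => (\1_A u)%:E : \bar R).
  by move=> mA; apply/measurable_EFinP; exact: measurable_indic.
have mDC := measurableC mD.
rewrite ge0_integralD//; last 4 first.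
- by move=> u _; rewrite mule_ge0// lee_fin.
- by apply: emeasurable_funM => //; exact: mi.
- by move=> u _; rewrite mule_ge0// lee_fin.
- by apply: emeasurable_funM => //; exact: mi.
by rewrite !ge0_integralZl ?integral_indic ?setIT//; exact: mi.
Qed.

Lemma measure_esum_fibers (T : countType) (eta : Omega -> T) (D : set Omega) :
  (forall x, measurable (eta @^-1` [set x])) -> measurable D ->
  P D = \esum_(x in [set: T]) P (D `&` eta @^-1` [set x]).
Proof.
move=> meta mD; transitivity (P (D `&` setT)); first by rewrite setIT.
rewrite -integral_indic//.
have mDx x : measurable (D `&` eta @^-1` [set x]) by exact: measurableI.
transitivity (\int[P]_w \esum_(x in [set: T]) (\1_(D `&` eta @^-1` [set x]) w)%:E : \bar R).
  apply: eq_integral => w _.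
  rewrite (esumID [set eta w]); last by move=> x _; rewrite lee_fin.
  rewrite setTI esum_set1 ?lee_fin// [X in _ + X]esum1 ?adde0.
    by rewrite !indicE in_setI [X in _ && X]mem_set ?andbT.
  move=> x [_ /= xw]; rewrite !indicE in_setI [X in _ && X]memNset ?andbF//=.
  by move=> wx; exact: xw.
rewrite integral_esum; [|by move=> x s; rewrite lee_fin|
  by move=> x; apply/measurable_EFinP; exact: measurable_indic].
by apply: eq_esum => x _; rewrite integral_indic// setIT.
Qed.

End Independence.

Definition upd (E : eqType) (X : Type) (f : E -> X) (e : E) (b : X) : E -> X :=
  fun e' => if e' == e then b else f e'.

(** * Cylinder sets determine the joint law of the environment and the uniform variables *)

Section Cylinders.
Context {R : realType} (E : countType).
Notation space3 := (fspace E R * (fspace E R * fspace E R))%type.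

(** The environment is tested by an arbitrary event, since its law need not be a product, while the
    uniform families are tested on finitely many coordinates. The lists are later required to be
    duplicate-free because a repeated coordinate would enter a product of probabilities twice. *)
Definition cylinder3 (A : set (E -> R)) (s : seq E) (B : E -> set R)
    (t : seq E) (C : E -> set R) : set space3 :=
  [set z | A z.1 /\ (forall e, e \in s -> B e (z.2.1 e)) /\
           (forall e, e \in t -> C e (z.2.2 e))].

Definition cylinders3 : set (set space3) :=
  [set X | exists A s B t C, prod_measurable A /\ uniq s /\ uniq t /\
     (forall e, measurable (B e)) /\ (forall e, measurable (C e)) /\
     X = cylinder3 A s B t C].

Lemma prod_measurableT : prod_measurable [set: E -> R].
Proof. exact: (@measurableT _ (fspace E R)). Qed.

Lemma cylinders3_measurable : cylinders3 `<=` measurable.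
Proof.
move=> _ [A [s [B [t [C [mA [us [ut [mB [mC ->]]]]]]]]]].
rewrite (_ : cylinder3 _ _ _ _ _ =
  fst @^-1` A `&` ((\bigcap_(e in [set` s]) (fun z : space3 => z.2.1 e) @^-1` B e)
  `&` (\bigcap_(e in [set` t]) (fun z : space3 => z.2.2 e) @^-1` C e))); last first.
  by apply/seteqP; split => z.
have mc1 e : measurable_fun setT (fun z : space3 => z.2.1 e).
  exact: (measurableT_comp (@measurable_coord E _ R e) (measurableT_comp (@measurable_fst _ _ (fspace E R) (fspace E R)) (@measurable_snd _ _ (fspace E R) _))).
have mc2 e : measurable_fun setT (fun z : space3 => z.2.2 e).
  exact: (measurableT_comp (@measurable_coord E _ R e) (measurableT_comp (@measurable_snd _ _ (fspace E R) (fspace E R)) (@measurable_snd _ _ (fspace E R) _))).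
apply: measurableI; last apply: measurableI.
- rewrite -(setTI (_ @^-1` _)); apply: (@measurable_fst _ _ (fspace E R)); [exact: measurableT|exact: mA].
- apply: fin_bigcap_measurable => // e _.
  by rewrite -(setTI (_ @^-1` _)); apply: mc1.
- apply: fin_bigcap_measurable => // e _.
  by rewrite -(setTI (_ @^-1` _)); apply: mc2.
Qed.

Lemma measurable_cylinders3 : measurable `<=` <<s cylinders3 >>.
Proof.
pose S := g_sigma_algebraType cylinders3.
suff mid : measurable_fun setT (fun z : S => (z : space3)).
  by move=> A mA; have := mid measurableT _ mA; rewrite setTI.
have u1 (e : E) : uniq [:: e] by [].
apply/(@measurable_fun_pairP _ _ _ S (fspace E R) (fspace E R * fspace E R)%type); split.
  move=> _ A mA; rewrite setTI; apply: sub_sigma_algebra.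
  exists A, [::], (fun=> setT), [::], (fun=> setT); do 5!split => //.
  by apply/seteqP; split => z //= -[].
apply/(@measurable_fun_pairP _ _ _ S (fspace E R) (fspace E R)); split.
  apply: (@measurable_fspace E _ R _ S) => e _ B mB; rewrite setTI.
  apply: sub_sigma_algebra.
  exists setT, [:: e], (fun=> B), [::], (fun=> setT).
  split; first exact: prod_measurableT.
  do 4!split => //.
  apply/seteqP; split => z /=.
    by move=> Bz; split => //; split => // e'; rewrite inE => /eqP ->.
  by move=> [_ [Bz _]]; apply: Bz; rewrite inE.
apply: (@measurable_fspace E _ R _ S) => e _ B mB; rewrite setTI.
apply: sub_sigma_algebra.
exists setT, [::], (fun=> setT), [:: e], (fun=> B).
split; first exact: prod_measurableT.
do 4!split => //.
apply/seteqP; split => z /=.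
  by move=> Bz; split => //; split => // e'; rewrite inE => /eqP ->.
by move=> [_ [_ Bz]]; apply: Bz; rewrite inE.
Qed.

Lemma cylinders3_setI_closed : setI_closed cylinders3.
Proof.
move=> _ _ [A [s [B [t [C [mA [us [ut [mB [mC ->]]]]]]]]]]
  [A' [s' [B' [t' [C' [mA' [us' [ut' [mB' [mC' ->]]]]]]]]]].
(* A coordinate listed on one side only is constrained by [setT] on the other, so intersecting
   amounts to merging the lists without repetition. *)
pose I (s s' : seq E) (B B' : E -> set R) e :=
  (if e \in s then B e else setT) `&` (if e \in s' then B' e else setT).
have mI r r' D D' : (forall e, measurable (D e)) -> (forall e, measurable (D' e)) ->
    forall e, measurable (I r r' D D' e).
  by move=> mD mD' e; apply: measurableI; case: ifP.
have IP r r' D D' (x : E -> R) :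
    (forall e, e \in undup (r ++ r') -> I r r' D D' e (x e)) <->
    (forall e, e \in r -> D e (x e)) /\ (forall e, e \in r' -> D' e (x e)).
  split.
    move=> h; split => e er; have := h e; rewrite mem_undup mem_cat er ?orbT;
    by move=> /(_ isT) []; rewrite er.
  by move=> [h h'] e _; split; case: ifP => //; [exact: h|exact: h'].
exists (A `&` A'), (undup (s ++ s')), (I s s' B B'), (undup (t ++ t')), (I t t' C C').
split; first exact: (@measurableI _ (fspace E R)).
do 4!(split; first by rewrite ?undup_uniq//; exact: mI).
apply/seteqP; split => z /=.
  move=> [[Az [Bz Cz]] [Az' [Bz' Cz']]].
  by split => //; split; apply/IP.
by move=> [[Az Az'] [/IP [? ?] /IP [? ?]]].
Qed.

(** Uniqueness of a finite measure given on a generating family closed under intersection. The whole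
    space is itself a cylinder, so equality of total masses is among the assumptions. *)
Lemma measure_eq_cylinders3 (m1 m2 : {measure set space3 -> \bar R}) :
  (m1 setT < +oo)%E ->
  (forall A s B t C, prod_measurable A -> uniq s -> uniq t ->
     (forall e, measurable (B e)) -> (forall e, measurable (C e)) ->
     m1 (cylinder3 A s B t C) = m2 (cylinder3 A s B t C)) ->
  forall X, measurable X -> m1 X = m2 X.
Proof.
move=> m1oo m12 X mX.
have cT : cylinders3 setT.
  exists setT, [::], (fun=> setT), [::], (fun=> setT).
  split; first exact: prod_measurableT.
  by do 4!split => //; apply/seteqP; split.
apply: (@g_sigma_algebra_measure_unique _ R _ cylinders3 cylinders3_measurable
  (fun=> setT)) => //.
- by apply/seteqP; split => // z _; exists 0%N.
- exact: cylinders3_setI_closed.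
- by move=> _ [A [s [B [t [C [mA [us [ut [mB [mC ->]]]]]]]]]]; exact: m12.
- exact: measurable_cylinders3.
Qed.

End Cylinders.

(** * The joint law *)
Section Law.
Local Open Scope ereal_scope.
Context {R : realType} (E I : countType) d (Omega : measurableType d)
  (P : probability Omega R) (p U W : Omega -> E -> R) (eta : Omega -> I)
  (q : I -> \bar R).
Notation space3 := (fspace E R * (fspace E R * fspace E R))%type.
Let unif (B : set R) : \bar R := lebesgue_measure (B `&` `[0%R, 1%R]).
Hypotheses
  (mp : forall e, measurable_fun setT (fun w => p w e))
  (mU : forall e, measurable_fun setT (fun w => U w e))
  (mW : forall e, measurable_fun setT (fun w => W w e))
  (meta : forall x, measurable (eta @^-1` [set x]))
  (Hlaw : forall A (s t : seq E) (B C : E -> set R) (x0 : I),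
      prod_measurable A -> uniq s -> uniq t ->
      (forall e, measurable (B e)) -> (forall e, measurable (C e)) ->
      P [set w | A (p w) /\ (forall e, e \in s -> B e (U w e)) /\
                 (forall e, e \in t -> C e (W w e)) /\ eta w = x0]
      = P [set w | A (p w)] * \prod_(e <- s) unif (B e) *
        \prod_(e <- t) unif (C e) * q x0).

Let Z (w : Omega) : space3 := (p w, (U w, W w)).

Lemma measurable_environment : measurable_fun setT Z.
Proof.
apply/(@measurable_fun_pairP _ _ _ Omega (fspace E R) (fspace E R * fspace E R)%type).
split; first exact: (@measurable_fspace E _ R _ Omega).
apply/(@measurable_fun_pairP _ _ _ Omega (fspace E R) (fspace E R)).
by split; exact: (@measurable_fspace E _ R _ Omega).
Qed.
Let mZ := measurable_environment.

Lemma law_eta x : P (eta @^-1` [set x]) = q x.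
Proof.
have := @Hlaw setT [::] [::] (fun=> setT) (fun=> setT) x (@prod_measurableT R E)
  isT isT (fun=> measurableT) (fun=> measurableT).
rewrite !big_nil [X in P X * _ * _ * _](_ : _ = setT); last exact/seteqP.
rewrite probability_setT !mul1e => <-; congr (P _).
by apply/seteqP; split => w //= [_ [_ []]].
Qed.

Let q_ge0 x : 0 <= q x. Proof. by rewrite -law_eta. Qed.

Let unif_ge0 B : 0 <= unif B. Proof. exact: measure_ge0. Qed.

Let unif_fin B : measurable B -> unif B \is a fin_num.
Proof.
move=> mB; rewrite ge0_fin_numE ?measure_ge0//.
apply: (@le_lt_trans _ _ (lebesgue_measure `[0%R, 1%R]%classic)).
  by apply: le_measure; rewrite ?inE//; exact: measurableI.
by rewrite lebesgue_measure_itv/=; case: ifP => _; rewrite -?EFinB ltry.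
Qed.

Let unif_cut (y : R) : (0 <= y <= 1)%R -> unif [set u | (u <= y)%R] = y%:E.
Proof.
move=> /andP[y0 y1]; rewrite /unif (_ : _ `&` _ = `[0%R, y]%classic).
  by rewrite lebesgue_measure_itv/= lte_fin; case: ltgtP y0 => // [_|<-] _; rewrite ?oppr0 ?adde0.
apply/seteqP; split => u /=; rewrite !in_itv/=; first by move=> [-> /andP[->]].
by move=> /andP[-> uy]; rewrite uy (le_trans uy).
Qed.

(** The values of [eta] partition the space and their probabilities [q] add up to one, so summing
    [Hlaw] over them removes [eta]. *)
Lemma law_cylinder A s B t C :
  prod_measurable A -> uniq s -> uniq t ->
  (forall e, measurable (B e)) -> (forall e, measurable (C e)) ->
  P (Z @^-1` cylinder3 A s B t C) =
  P [set w | A (p w)] * \prod_(e <- s) unif (B e) * \prod_(e <- t) unif (C e).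
Proof.
move=> mA us ut mB mC.
have mcyl : measurable (Z @^-1` cylinder3 A s B t C).
  rewrite -(setTI (_ @^-1` _)); apply: mZ => //; apply: cylinders3_measurable.
  by exists A, s, B, t, C.
rewrite (measure_esum_fibers P meta)//.
set c := RHS.
have cfin : c \is a fin_num.
  have mAp : measurable [set w | A (p w)].
    have := @measurable_fspace E _ R _ Omega p mp measurableT A mA.
    by rewrite setTI.
  rewrite /c !fin_numM//; first exact: fin_num_measure.
  - apply: (big_ind (fun x => x \is a fin_num)) => // [? ? ? ?|e _];
      [exact: fin_numM|exact: unif_fin].
  - apply: (big_ind (fun x => x \is a fin_num)) => // [? ? ? ?|e _];
      [exact: fin_numM|exact: unif_fin].
have c0 : 0 <= c.
  by rewrite /c !mule_ge0//; apply: (big_ind (fun x => 0 <= x)) => // *; exact: mule_ge0.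
transitivity (\esum_(x in [set: I]) ((fine c)%:E * q x)).
  apply: eq_esum => x _; rewrite fineK// /c -Hlaw//; congr (P _).
  apply/seteqP; split => w /=; first by move=> [[? [? ?]] ?].
  by move=> [? [? [? ?]]].
rewrite esumZl ?fine_ge0// fineK//.
under eq_esum do rewrite -law_eta.
have := @measure_esum_fibers R d Omega P I eta setT meta measurableT.
under eq_esum do rewrite setTI.
by rewrite probability_setT => <-; rewrite mule1.
Qed.

(** Restricting [P] to one value of [eta], or scaling it by [q x], yields two finite laws of [Z]
    that agree on cylinders. This carries the independence of [eta] from cylinders to integrals. *)
Lemma law_eta_integral (Phi : space3 -> \bar R) x :
  measurable_fun setT Phi -> (forall z, 0 <= Phi z) ->
  \int[P]_(w in eta @^-1` [set x]) Phi (Z w) = q x * \int[P]_w Phi (Z w).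
Proof.
move=> mPhi Phi0.
pose D := eta @^-1` [set x].
have mD : measurable D by exact: meta.
rewrite -(integral_mrestr P mD)//; last exact: measurableT_comp.
have qfin : q x \is a fin_num by rewrite -law_eta fin_num_measure.
pose k : {nonneg R} := NngNum (fine_ge0 (q_ge0 x)).
pose m1 := image_measure (mrestr P mD) mZ.
pose m2 := image_measure P mZ.
rewrite (_ : q x = (k%:num)%:E); last by rewrite /= fineK.
rewrite -(integral_image_measure (mrestr P mD) mZ)//.
rewrite -(integral_image_measure P mZ)//.
rewrite -(@ge0_integral_mscale _ _ R m2 setT measurableT k Phi)//.
apply: eq_measure_integral => X mX _.
apply: (@measure_eq_cylinders3 _ _ m1 (mscale k m2) _ _ _ mX).
  rewrite image_measureE /pushforward /= /mrestr preimage_setT setTI.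
  by apply: le_lt_trans (probability_le1 _ _) _ => //; rewrite ltry.
move=> A s B t C mA us ut mB mC.
suff : P (Z @^-1` cylinder3 A s B t C `&` D) =
  (fine (q x))%:E * P (Z @^-1` cylinder3 A s B t C) by [].
rewrite law_cylinder// muleC fineK//.
rewrite -Hlaw//; congr (P _).
apply/seteqP; split => w /=; first by move=> [[? [? ?]] ?].
by move=> [? [? [? ?]]].
Qed.

Lemma law_independent (X : space3 -> space3) (c : Omega -> R) :
  measurable_fun setT (fun w => X (Z w)) -> measurable_fun setT c ->
  (forall A s B t C D, prod_measurable A -> uniq s -> uniq t ->
    (forall e, measurable (B e)) -> (forall e, measurable (C e)) -> measurable D ->
    P ((X \o Z) @^-1` cylinder3 A s B t C `&` c @^-1` D) =
    P ((X \o Z) @^-1` cylinder3 A s B t C) * P (c @^-1` D)) ->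
  forall A D, measurable A -> measurable D ->
  P ((X \o Z) @^-1` A `&` c @^-1` D) = P ((X \o Z) @^-1` A) * P (c @^-1` D).
Proof.
move=> mX mc ind A D mA mD.
have mcD : measurable (c @^-1` D).
  by rewrite -(setTI (_ @^-1` _)); exact: mc.
have Pfin : P (c @^-1` D) \is a fin_num by exact: fin_num_measure.
pose k : {nonneg R} := NngNum (fine_ge0 (measure_ge0 P (c @^-1` D))).
pose m1 := image_measure (mrestr P mcD) mX.
pose m2 : {measure set space3 -> \bar R} := mscale k (image_measure P mX).
transitivity (m2 A); last first.
  suff : (fine (P (c @^-1` D)))%:E * P ((X \o Z) @^-1` A) =
    P ((X \o Z) @^-1` A) * P (c @^-1` D) by [].
  by rewrite fineK// muleC.
apply: (@measure_eq_cylinders3 _ _ m1 m2 _ _ _ mA).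
  suff : P (setT `&` c @^-1` D) < +oo by [].
  by rewrite setTI; apply: le_lt_trans (probability_le1 _ mcD) _; rewrite ltry.
move=> A' s B t C mA' us ut mB mC.
suff : P ((X \o Z) @^-1` cylinder3 A' s B t C `&` c @^-1` D) =
  (fine (P (c @^-1` D)))%:E * P ((X \o Z) @^-1` cylinder3 A' s B t C) by [].
by rewrite fineK// muleC; exact: ind.
Qed.

Let law_cylinder_U e D : measurable D -> P ((fun w => U w e) @^-1` D) = unif D.
Proof.
move=> mD.
have := @law_cylinder setT [:: e] (fun=> D) [::] (fun=> setT)
  (@prod_measurableT R E) isT isT (fun=> mD) (fun=> measurableT).
rewrite big_seq1 big_nil mule1 [X in P X * _](_ : _ = setT); last exact/seteqP.
rewrite probability_setT mul1e => <-; congr (P _).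
apply/seteqP; split => w /=.
  by move=> De; split => //; split => // e'; rewrite inE => /eqP ->.
by move=> [_ [De _]]; apply: De; rewrite inE.
Qed.

Let law_cylinder_W e D : measurable D -> P ((fun w => W w e) @^-1` D) = unif D.
Proof.
move=> mD.
have := @law_cylinder setT [::] (fun=> setT) [:: e] (fun=> D)
  (@prod_measurableT R E) isT isT (fun=> measurableT) (fun=> mD).
rewrite big_seq1 big_nil mule1 [X in P X * _](_ : _ = setT); last exact/seteqP.
rewrite probability_setT mul1e => <-; congr (P _).
apply/seteqP; split => w /=.
  by move=> De; split => //; split => // e'; rewrite inE => /eqP ->.
by move=> [_ [_ De]]; apply: De; rewrite inE.
Qed.

(** All variables except [U e], kept inside the same space by a dummy value at [e]. The dummy
    becomes invisible once the state of [e] is overwritten. *)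
Let reset_U e (z : space3) : space3 := (z.1, (upd z.2.1 e 0%R, z.2.2)).

Let measurable_reset_U e : measurable_fun setT (fun w => reset_U e (Z w)).
Proof.
apply/(@measurable_fun_pairP _ _ _ Omega (fspace E R) (fspace E R * fspace E R)%type).
split; first exact: (@measurable_fspace E _ R _ Omega).
apply/(@measurable_fun_pairP _ _ _ Omega (fspace E R) (fspace E R)).
split; last exact: (@measurable_fspace E _ R _ Omega).
apply: (@measurable_fspace E _ R _ Omega) => e'; rewrite /= /upd.
by case: eqP => _; [exact: measurable_cst|exact: mU].
Qed.

Let reset_U_independent e A D : measurable A -> measurable D ->
  P ((reset_U e \o Z) @^-1` A `&` (fun w => U w e) @^-1` D) =
  P ((reset_U e \o Z) @^-1` A) * P ((fun w => U w e) @^-1` D).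
Proof.
apply: law_independent => //.
move=> {}A s B t C {}D mA us ut mB mC mD.
pose s' := [seq e' <- s | e' != e].
have us' : uniq s' by exact: filter_uniq.
have es' : e \notin s' by rewrite mem_filter eqxx.
case: (pselect (e \in s -> B e 0%R)) => [Be0|nBe0]; last first.
  have -> : (reset_U e \o Z) @^-1` cylinder3 A s B t C = set0.
    apply/seteqP; split => // w [_ [/= Bs _]]; apply: nBe0 => es.
    by have := Bs _ es; rewrite /upd eqxx.
  by rewrite set0I measure0 mul0e.
have -> : (reset_U e \o Z) @^-1` cylinder3 A s B t C = Z @^-1` cylinder3 A s' B t C.
  apply/seteqP; split => w [/= Aw [Bs Cs]]; split => //; split => //= e'.
    rewrite mem_filter => /andP[/negPf e'e es]; have := Bs _ es.
    by rewrite /upd e'e.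
  move=> es; rewrite /upd; case: eqP => [e'e|/eqP e'e].
    by rewrite e'e; apply: Be0; rewrite -e'e.
  by apply: Bs; rewrite mem_filter e'e.
pose B' e' := if e' == e then D else B e'.
have mB' e' : measurable (B' e') by rewrite /B'; case: ifP.
have -> : Z @^-1` cylinder3 A s' B t C `&` (fun w => U w e) @^-1` D =
    Z @^-1` cylinder3 A (e :: s') B' t C.
  apply/seteqP; split => w /=.
    move=> [[/= Aw [Bs Cs]] De]; split => //; split => //= e'; rewrite inE /B'.
    by case: eqP => [->//|_ /=]; exact: Bs.
  move=> [/= Aw [Bs Cs]]; split.
    split => //; split => // e' es; have := Bs e'; rewrite inE es orbT => /(_ isT).
    by rewrite /B'; case: eqP => // e'e; rewrite e'e (negPf es') in es.
  by have := Bs e; rewrite inE eqxx /B' => /(_ isT); rewrite eqxx.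
rewrite !law_cylinder//= ?es'// law_cylinder_U// big_cons {1}/B' eqxx.
rewrite (@eq_big_seq _ _ _ _ s' (fun e => unif (B' e)) (fun e => unif (B e))); last first.
  by move=> e' es; rewrite /B'; case: eqP => // e'e; rewrite e'e (negPf es') in es.
by rewrite -!muleA; congr (_ * _); rewrite muleCA; congr (_ * _); rewrite muleC.
Qed.

Let forget_W (z : space3) : space3 := (z.1, (z.2.1, fun=> 0%R)).

Let measurable_forget_W : measurable_fun setT (fun w => forget_W (Z w)).
Proof.
apply/(@measurable_fun_pairP _ _ _ Omega (fspace E R) (fspace E R * fspace E R)%type).
split; first exact: (@measurable_fspace E _ R _ Omega).
apply/(@measurable_fun_pairP _ _ _ Omega (fspace E R) (fspace E R)).
split; first exact: (@measurable_fspace E _ R _ Omega).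
by apply: (@measurable_fspace E _ R _ Omega) => e'; exact: measurable_cst.
Qed.

Let forget_W_independent e A D : measurable A -> measurable D ->
  P ((forget_W \o Z) @^-1` A `&` (fun w => W w e) @^-1` D) =
  P ((forget_W \o Z) @^-1` A) * P ((fun w => W w e) @^-1` D).
Proof.
apply: law_independent => //.
move=> {}A s B t C {}D mA us ut mB mC mD.
case: (pselect (forall e, e \in t -> C e 0%R)) => [C0|nC0]; last first.
  have -> : (forget_W \o Z) @^-1` cylinder3 A s B t C = set0.
    by apply/seteqP; split => // w [_ [_ /= Cs]].
  by rewrite set0I measure0 mul0e.
have -> : (forget_W \o Z) @^-1` cylinder3 A s B t C =
    Z @^-1` cylinder3 A s B [::] (fun=> setT).
  by apply/seteqP; split => w [/= Aw [Bs Cs]]; split.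
have -> : Z @^-1` cylinder3 A s B [::] (fun=> setT) `&` (fun w => W w e) @^-1` D =
    Z @^-1` cylinder3 A s B [:: e] (fun=> D).
  apply/seteqP; split => w /=.
    move=> [[/= Aw [Bs Cs]] De]; split => //; split => //= e'; rewrite inE.
    by move=> /eqP ->.
  move=> [/= Aw [Bs Cs]]; split; first by split.
  by apply: Cs; rewrite inE.
by rewrite !law_cylinder//= law_cylinder_W// big_seq1 big_nil mule1.
Qed.

Variable gthr : E -> R.
Hypotheses (Hp01 : forall w e, (0 <= p w e <= 1)%R)
  (gthr01 : forall e, (0 <= gthr e <= 1)%R).

Notation conf := (fspace E R * (fspace E bool * fspace E bool))%type.

Definition conf_of (z : space3) : conf :=
  (z.1, (fun e => (z.2.1 e <= z.1 e)%R, fun e => (z.2.2 e <= gthr e)%R)).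

Lemma measurable_conf_of : measurable_fun setT conf_of.
Proof.
have m1 : measurable_fun setT (fun z : space3 => z.1) by exact: measurable_fst.
have m21 e : measurable_fun setT (fun z : space3 => z.2.1 e).
  exact: (measurableT_comp (@measurable_coord E _ R e) (measurableT_comp (@measurable_fst _ _ (fspace E R) (fspace E R)) (@measurable_snd _ _ (fspace E R) _))).
have m22 e : measurable_fun setT (fun z : space3 => z.2.2 e).
  exact: (measurableT_comp (@measurable_coord E _ R e) (measurableT_comp (@measurable_snd _ _ (fspace E R) (fspace E R)) (@measurable_snd _ _ (fspace E R) _))).
have mz1 e : measurable_fun setT (fun z : space3 => z.1 e).
  exact: (measurableT_comp (@measurable_coord E _ R e) m1).
apply/(@measurable_fun_pairP _ _ _ space3 (fspace E R) (fspace E bool * fspace E bool)%type).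
split; first exact: m1.
apply/(@measurable_fun_pairP _ _ _ space3 (fspace E bool) (fspace E bool)).
split; apply: (@measurable_fspace E _ bool _ space3) => e.
  exact: measurable_fun_ler.
exact: measurable_fun_ler.
Qed.

Definition config (w : Omega) : conf :=
  (p w, (fun e => (U w e <= p w e)%R, fun e => (W w e <= gthr e)%R)).

Lemma measurable_config : measurable_fun setT config.
Proof. exact: (measurableT_comp measurable_conf_of mZ). Qed.

Lemma config_eta (Phi : conf -> \bar R) x :
  measurable_fun setT Phi -> (forall z, 0 <= Phi z) ->
  \int[P]_(w in eta @^-1` [set x]) Phi (config w) = q x * \int[P]_w Phi (config w).
Proof.
move=> mPhi Phi0; apply: (@law_eta_integral (fun z => Phi (conf_of z))) => //.
exact: measurableT_comp mPhi measurable_conf_of.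
Qed.

Definition set_edge (e : E) (b : bool) (z : conf) : conf := (z.1, (upd z.2.1 e b, z.2.2)).

Lemma measurable_set_edge e b : measurable_fun setT (set_edge e b).
Proof.
have m1 : measurable_fun setT (fun z : conf => z.1) by exact: measurable_fst.
have m2 : measurable_fun setT (fun z : conf => z.2) by exact: measurable_snd.
apply/(@measurable_fun_pairP _ _ _ conf (fspace E R) (fspace E bool * fspace E bool)%type).
split; first exact: m1.
apply/(@measurable_fun_pairP _ _ _ conf (fspace E bool) (fspace E bool)).
split; last exact: (measurableT_comp (@measurable_snd _ _ (fspace E bool) (fspace E bool)) m2).
apply: (@measurable_fspace E _ bool _ conf) => e'; rewrite /= /upd.
case: eqP => _; first exact: measurable_cst.
exact: (measurableT_comp (@measurable_coord E _ bool e')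
  (measurableT_comp (@measurable_fst _ _ (fspace E bool) (fspace E bool)) m2)).
Qed.

(** Given the environment and all other variables, [e] is open with probability [p e]. Both branches
    overwrite the state of [e], so they are functions of [reset_U e], which is independent of
    [U e]. *)
Lemma config_resample (Phi : conf -> \bar R) e :
  measurable_fun setT Phi -> (forall z, 0 <= Phi z) ->
  \int[P]_w Phi (config w) =
  \int[P]_w ((p w e)%:E * Phi (set_edge e true (config w)) +
             (1 - p w e)%:E * Phi (set_edge e false (config w))).
Proof.
move=> mPhi Phi0.
have upE b w : set_edge e b (conf_of (reset_U e (Z w))) = set_edge e b (config w).
  congr (_, (_, _)); apply/funext => e'; rewrite /upd.
  by case: eqP => // /eqP/negPf; rewrite /= /upd => ->.
have mH b : measurable_fun setT (fun z => Phi (set_edge e b (conf_of z))).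
  apply: measurableT_comp => //.
  by apply: measurableT_comp measurable_conf_of; exact: measurable_set_edge.
transitivity (\int[P]_w (if (U w e <= (reset_U e (Z w)).1 e)%R then
    Phi (set_edge e true (conf_of (reset_U e (Z w)))) else
    Phi (set_edge e false (conf_of (reset_U e (Z w)))))).
  apply: eq_integral => w _; rewrite !upE /=.
  case: ifP => Ue; congr (Phi _); congr (_, (_, _)); apply/funext => e';
  by rewrite /upd; case: eqP => // ->.
rewrite (@uniform_threshold_integral R _ _ P _ space3 (fun w => reset_U e (Z w))
  (fun w => U w e) (fun z => z.1 e)
  (fun z => Phi (set_edge e true (conf_of z)))
  (fun z => Phi (set_edge e false (conf_of z)))); first last.
- by move=> w; exact: Hp01.
- by [].
- exact: mH.
- by [].
- exact: mH.
- exact: (measurableT_comp (@measurable_coord E _ R e) (@measurable_fst _ _ (fspace E R) _)).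
- move=> y y01; rewrite -(unif_cut y01); apply: law_cylinder_U.
  by rewrite -set_itvNyc; exact: measurable_itv.
- by move=> A B mA mB; exact: reset_U_independent.
- exact: mU.
- exact: measurable_reset_U.
by apply: eq_integral => w _; rewrite !upE.
Qed.

Lemma config_green (Psi : (fspace E R * fspace E bool)%type -> \bar R) e :
  measurable_fun setT Psi -> (forall z, 0 <= Psi z) ->
  \int[P]_w (if (config w).2.2 e then Psi ((config w).1, (config w).2.1) else 0) =
  (gthr e)%:E * \int[P]_w Psi ((config w).1, (config w).2.1).
Proof.
move=> mPsi Psi0.
have m2 : measurable_fun setT (fun z : conf => (z.1, z.2.1) : (fspace E R * fspace E bool)%type).
  apply/(@measurable_fun_pairP _ _ _ conf (fspace E R) (fspace E bool)).
  split; first exact: measurable_fst.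
  exact: (measurableT_comp (@measurable_fst _ _ (fspace E bool) (fspace E bool)) (@measurable_snd _ _ (fspace E R) _)).
have mH : measurable_fun setT (fun z => Psi ((conf_of z).1, (conf_of z).2.1)).
  apply: measurableT_comp => //.
  exact: (measurableT_comp m2 measurable_conf_of).
rewrite (@uniform_threshold_integral R _ _ P _ space3 (fun w => forget_W (Z w))
  (fun w => W w e) (fun=> gthr e)
  (fun z => Psi ((conf_of z).1, (conf_of z).2.1)) (fun=> 0)); first last.
- by move=> w; exact: gthr01.
- by [].
- exact: measurable_cst.
- by [].
- exact: mH.
- exact: measurable_cst.
- move=> y y01; rewrite -(unif_cut y01); apply: law_cylinder_W.
  by rewrite -set_itvNyc; exact: measurable_itv.
- by move=> A B mA mB; exact: forget_W_independent.
- exact: mW.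
- exact: measurable_forget_W.
under eq_integral do rewrite mule0 adde0.
rewrite ge0_integralZl//.
- by apply: (measurableT_comp mPsi); exact: (measurableT_comp m2 measurable_config).
- by rewrite lee_fin; case/andP: (gthr01 e).
Qed.

(** Permuting the edges preserves the joint law: for [p] by assumption, for the uniform families
    because they are i.i.d., and the green thresholds are invariant. On cylinders this relabels the
    lists by [gE] and the tests by its inverse. *)
Lemma config_reindex (gE kE : E -> E) (Phi : conf -> \bar R) :
  cancel gE kE -> cancel kE gE -> (forall e, gthr (gE e) = gthr e) ->
  (forall A, prod_measurable A ->
    P [set w | A (p w)] = P [set w | A (fun e => p w (gE e))]) ->
  measurable_fun setT Phi -> (forall z, 0 <= Phi z) ->
  \int[P]_w Phi (config w) =
  \int[P]_w Phi ((config w).1 \o gE, ((config w).2.1 \o gE, (config w).2.2 \o gE)).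
Proof.
move=> gK kK gg pinv mPhi Phi0.
pose Zg w : space3 := (p w \o gE, (U w \o gE, W w \o gE)).
have mZg : measurable_fun setT Zg.
  apply/(@measurable_fun_pairP _ _ _ Omega (fspace E R) (fspace E R * fspace E R)%type).
  split; first by apply: (@measurable_fspace E _ R _ Omega) => e /=; exact: mp.
  apply/(@measurable_fun_pairP _ _ _ Omega (fspace E R) (fspace E R)).
  by split; apply: (@measurable_fspace E _ R _ Omega) => e /=; [exact: mU|exact: mW].
have mH : measurable_fun setT (fun z => Phi (conf_of z)).
  exact: measurableT_comp mPhi measurable_conf_of.
transitivity (\int[image_measure P mZ]_z Phi (conf_of z)).
  by rewrite (integral_image_measure P mZ).
transitivity (\int[image_measure P mZg]_z Phi (conf_of z)); last first.
  rewrite (integral_image_measure P mZg)//; apply: eq_integral => w _.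
  by congr (Phi (_, (_, _))); apply/funext => e /=; rewrite gg.
apply: eq_measure_integral => X mX _.
apply: (@measure_eq_cylinders3 _ _ (image_measure P mZ) (image_measure P mZg) _ _ _ mX).
  suff : P setT < +oo by [].
  by rewrite probability_setT ltry.
move=> A s B t C mA us ut mB mC.
suff : P (Z @^-1` cylinder3 A s B t C) = P (Zg @^-1` cylinder3 A s B t C) by [].
pose A' := [set f : E -> R | A (f \o gE)].
have mA' : prod_measurable A'.
  have mg : measurable_fun setT (fun f : fspace E R => (f \o gE : fspace E R)).
    by apply: (@measurable_fspace E _ R _ (fspace E R)) => e; exact: measurable_coord.
  by have := mg measurableT A mA; rewrite setTI.
have -> : Zg @^-1` cylinder3 A s B t C =
    Z @^-1` cylinder3 A' (map gE s) (B \o kE) (map gE t) (C \o kE).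
  apply/seteqP; split => w [/= Aw [Bs Cs]]; split => //; split => /=.
  - by move=> _ /mapP[e es ->]; rewrite gK; exact: Bs.
  - by move=> _ /mapP[e es ->]; rewrite gK; exact: Cs.
  - by move=> e es; have := Bs (gE e); rewrite gK; apply; exact: map_f.
  - by move=> e es; have := Cs (gE e); rewrite gK; apply; exact: map_f.
have gi : injective gE by exact: can_inj gK.
have us' : uniq (map gE s) by rewrite map_inj_uniq.
have ut' : uniq (map gE t) by rewrite map_inj_uniq.
rewrite (law_cylinder mA us ut mB mC).
rewrite (law_cylinder mA' us' ut' (fun e => mB (kE e)) (fun e => mC (kE e))).
rewrite !big_map (pinv A mA).
congr (_ * _ * _); apply: eq_bigr => e _ /=; by rewrite gK.
Qed.

End Law.

(** * Clusters *)
(* all_analysis has a [cluster] of its own (cluster points of a filter). *)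
Notation cluster := Defs.cluster.

Section MeasurablePredicates.
Context d (S : measurableType d).

Lemma measurable_exists (I : countType) (Q : I -> S -> Prop) :
  (forall i, measurable [set s | Q i s]) -> measurable [set s | exists i, Q i s].
Proof.
move=> mQ; rewrite (_ : [set s | _] = \bigcup_i [set s | Q i s]).
  exact: countable_bigcupT_measurable.
by apply/seteqP; split => s /= [i]; [exists i|move=> _ ?; exists i].
Qed.

Lemma measurable_predC (Q : S -> Prop) :
  measurable [set s | Q s] -> measurable [set s | ~ Q s].
Proof. by move=> mQ; exact: (measurableC mQ). Qed.

Lemma measurable_forall (I : countType) (Q : I -> S -> Prop) :
  (forall i, measurable [set s | Q i s]) -> measurable [set s | forall i, Q i s].
Proof.
move=> mQ; rewrite (_ : [set s | _] = [set s | ~ exists i, ~ Q i s]).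
  by apply/measurable_predC/measurable_exists => i; exact: measurable_predC.
apply/seteqP; split => s /=; first by move=> h [i]; apply.
by move=> h i; apply: contrapT => nQ; apply: h; exists i.
Qed.

Lemma measurable_predI (Q Q' : S -> Prop) : measurable [set s | Q s] ->
  measurable [set s | Q' s] -> measurable [set s | Q s /\ Q' s].
Proof. exact: measurableI. Qed.

Lemma measurable_predU (Q Q' : S -> Prop) : measurable [set s | Q s] ->
  measurable [set s | Q' s] -> measurable [set s | Q s \/ Q' s].
Proof. exact: measurableU. Qed.

Lemma measurable_pred_cst (Q : Prop) : measurable [set s : S | Q].
Proof.
have [q|nq] := pselect Q.
  by suff -> : [set s : S | Q] = setT by []; apply/seteqP; split.
by suff -> : [set s : S | Q] = set0 by []; apply/seteqP; split.
Qed.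

Lemma measurable_asbool (Q : S -> Prop) :
  measurable [set s | Q s] -> measurable_fun setT (fun s => `[< Q s >]).
Proof.
move=> mQ; apply: (measurable_fun_bool true); rewrite setTI.
suff -> : (fun s => `[< Q s >]) @^-1` [set true] = [set s | Q s] by [].
by apply/seteqP; split => s /=; [move=> /asboolP|move=> Qs; apply/asboolP].
Qed.

Lemma measurable_coord_true (E : Type) (e : E) :
  measurable [set om : fspace E bool | om e].
Proof. by have := @measurable_coord E _ bool e measurableT [set true]; rewrite setTI; apply. Qed.

End MeasurablePredicates.

Section Clusters.
Context (V E : countType) (ends : E -> V * V).
Implicit Types (om gr : E -> bool) (C : set V) (x y : V) (e : E).

Definition touches C e : Prop := C (ends e).1 \/ C (ends e).2.

(** The cluster of a set of vertices: the exploration continues from the part of a cluster found so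
    far, not from a single vertex. *)
Definition reach om C : set V := [set y | exists2 x, C x & cluster ends om x y].

Lemma cluster_refl om x : cluster ends om x x. Proof. exact: rt_refl. Qed.

Lemma cluster_trans om x y z :
  cluster ends om x y -> cluster ends om y z -> cluster ends om x z.
Proof. exact: rt_trans. Qed.

Lemma cluster_sym om x y : cluster ends om x y -> cluster ends om y x.
Proof.
elim=> {x y} [x y [e [oe xy]]|x|x y z _ xy _ yz]; last exact: cluster_trans xy.
  by apply: rt_step; exists e; split => //; case: xy; [right|left].
exact: cluster_refl.
Qed.

Lemma cluster_eq om x y : cluster ends om x y -> cluster ends om x = cluster ends om y.
Proof.
move=> xy; apply/seteqP; split => z; apply: cluster_trans => //.
exact: cluster_sym.
Qed.

Lemma cluster_edge om e : om e -> cluster ends om (ends e).1 (ends e).2.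
Proof. by move=> oe; apply: rt_step; exists e; split => //; left; case: (ends e). Qed.

Lemma cluster_ind_r om x (Q : V -> Prop) : Q x ->
  (forall e y z, cluster ends om x y -> Q y -> om e ->
     ends e = (y, z) \/ ends e = (z, y) -> Q z) ->
  forall y, cluster ends om x y -> Q y.
Proof.
move=> Qx step y xy; have := @clos_rt_rtn1 _ _ _ _ xy.
elim => {y xy} // y z [e [oe yz]] xy Qy.
exact: (step e y z (@clos_rtn1_rt _ _ _ _ xy) Qy oe).
Qed.

Lemma subset_cluster om om' x : (forall e, om e -> om' e) ->
  cluster ends om x `<=` cluster ends om' x.
Proof.
move=> sub; apply: (@cluster_ind_r om x (cluster ends om' x)); first exact: cluster_refl.
move=> e y z _ xy oe yz; apply: cluster_trans xy _.
by apply: rt_step; exists e; split => //; exact: sub.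
Qed.

Lemma reach1 om x : reach om [set x] = cluster ends om x.
Proof. by apply/seteqP; split => y; [move=> [_ ->]|move=> xy; exists x]. Qed.

Lemma reachU om C C' : reach om (C `|` C') = reach om C `|` reach om C'.
Proof.
apply/seteqP; split => y; first by move=> [x [Cx|Cx] xy]; [left|right]; exists x.
by move=> [[x Cx xy]|[x Cx xy]]; exists x => //; [left|right].
Qed.

Lemma reach_sub om C : C `<=` reach om C.
Proof. by move=> x Cx; exists x => //; exact: cluster_refl. Qed.

(** The only effect of an open edge touching [C] is to bring in its endpoints; once they are added,
    the edge may as well be closed. This is the recursion step of the exploration, and with [C] a
    single endpoint it also describes the merging of two clusters. *)
Lemma reach_open om C e : om e -> touches C e ->
  reach om C = reach (upd om e false) (C `|` [set (ends e).1; (ends e).2]).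
Proof.
move=> oe Ce; set om0 := upd om e false.
have sub f : om0 f -> om f by rewrite /om0 /upd; case: eqP.
apply/seteqP; split => y [x Cx].
  move: y; apply: (@cluster_ind_r om x (reach om0 (C `|` _))).
    by exists x; [left|exact: cluster_refl].
  move=> f y z _ [t Ct ty] of_ yz; have [fe|/eqP fe] := eqVneq f e.
    exists z; last exact: cluster_refl.
    by right; case: yz; rewrite fe => ->; [right|left].
  exists t => //; apply: cluster_trans ty _; apply: rt_step; exists f; split => //.
  by rewrite /om0 /upd; case: eqP.
have ends_reach v : [set (ends e).1; (ends e).2] v -> exists2 u, C u & cluster ends om u v.
  have e12 := cluster_edge oe.
  case: Ce => Ce [] ->.
  - by exists (ends e).1 => //; exact: cluster_refl.
  - by exists (ends e).1.
  - by exists (ends e).2 => //; exact: cluster_sym.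
  - by exists (ends e).2 => //; exact: cluster_refl.
move=> /(subset_cluster sub) xy; case: Cx => [Cx|/ends_reach [u Cu ux]].
  by exists x.
by exists u => //; exact: cluster_trans xy.
Qed.

Lemma reach_untouched om C : (forall e, om e -> ~ touches C e) -> reach om C = C.
Proof.
move=> ut; apply/seteqP; split; last exact: reach_sub.
move=> y [x Cx]; move: y; apply: (@cluster_ind_r om x C) => // e y z _ Cy oe yz.
exfalso; apply: (ut e) => //.
by rewrite /touches; case: yz => -> /=; [left|right].
Qed.

Lemma cluster_open om e :
  cluster ends (upd om e true) (ends e).1 =
  cluster ends (upd om e false) (ends e).1 `|` cluster ends (upd om e false) (ends e).2.
Proof.
rewrite -reach1 (@reach_open _ _ e); last by left.
  have -> : upd (upd om e true) e false = upd om e false.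
    by apply/funext => f; rewrite /upd; case: eqP.
  rewrite -!reach1 -reachU; congr reach.
  by apply/seteqP; split => v /=; [case=> // ->; left|right].
by rewrite /upd eqxx.
Qed.

Definition good om gr x : Prop :=
  finite_set (cluster ends om x) /\ touches_green ends gr (cluster ends om x).

Lemma touches_greenU gr C C' : touches_green ends gr (C `|` C') <->
  touches_green ends gr C \/ touches_green ends gr C'.
Proof.
split.
  by move=> [f [gf [[]|[]]]] ?; [left|right|left|right]; exists f; tauto.
by move=> [[f [gf []]]|[f [gf []]]] ?; exists f; split => //;
  [left; left|right; left|left; right|right; right].
Qed.

Section measurable_cluster.
Notation bT := (fspace E bool).

(** Grading connections by path length writes membership in a cluster as a countable combination of
    coordinate events, hence its measurability. *)
Fixpoint nreach (n : nat) om x y : Prop :=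
  if n is n'.+1 then exists z, nreach n' om x z /\
    exists e, om e /\ (ends e = (z, y) \/ ends e = (y, z))
  else x = y.

Lemma clusterE om x y : cluster ends om x y <-> exists n, nreach n om x y.
Proof.
split.
  move: y; apply: (@cluster_ind_r om x (fun y => exists n, nreach n om x y)).
    by exists 0%N.
  by move=> e y z _ [n xy] oe yz; exists n.+1, y; split => //; exists e.
move=> [n]; elim: n y => [y ->|n ih y [z [/ih xz [e [oe zy]]]]].
  exact: cluster_refl.
by apply: cluster_trans xz _; apply: rt_step; exists e.
Qed.

Lemma measurable_cluster x y : measurable [set om : bT | cluster ends om x y].
Proof.
rewrite (_ : [set _ | _] = [set om : bT | exists n, nreach n om x y]); last first.
  by apply/seteqP; split => om /clusterE.
apply: measurable_exists => n; elim: n y => [|n ih] y /=.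
  exact: measurable_pred_cst.
apply: measurable_exists => z; apply: measurable_predI => //.
apply: measurable_exists => e; apply: measurable_predI.
  exact: measurable_coord_true.
exact: measurable_pred_cst.
Qed.

Lemma measurable_finite_cluster x : measurable [set om : bT | finite_set (cluster ends om x)].
Proof.
rewrite (_ : [set _ | _] = [set om : bT | exists s : seq V,
  forall y, cluster ends om x y -> y \in s]); last first.
  apply/seteqP; split => om /=; first by move=> /finite_seqP[s ->]; exists s.
  by move=> [s xs]; apply: (@sub_finite_set _ _ [set` s]).
apply: measurable_exists => s; apply: measurable_forall => y.
case: (y \in s).
  by rewrite (_ : [set _ | _] = setT)//; apply/seteqP; split.
rewrite (_ : [set _ | _] = [set om : bT | ~ cluster ends om x y]).
  by apply: measurable_predC; exact: measurable_cluster.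
by apply/seteqP; split => om /= h xy; [have := h xy|case: (h xy)].
Qed.

Lemma measurable_touches x e : measurable [set om : bT | touches (cluster ends om x) e].
Proof. by apply: measurable_predU; exact: measurable_cluster. Qed.

End measurable_cluster.
End Clusters.

(** * Finite green clusters *)
Section ClusterSums.
Local Open Scope ereal_scope.
Context {R : realType} (V E : countType) (ends : E -> V * V).
Implicit Types (om gr : E -> bool) (C : set V) (x y : V) (e : E).

Lemma esum_indicator (A : set V) : finite_set A ->
  \esum_(z in [set: V]) (\1_A z)%:E = (#|` fset_set A|%:R)%:E :> \bar R.
Proof.
move=> fA; transitivity (\esum_(z in A) (1 : \bar R)).
  rewrite [RHS]esum_mkcond; apply: eq_esum => z _; rewrite indicE.
  by case: (z \in A).
rewrite esum_fset// fsbig_finite//= sumEFin; congr EFin.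
by rewrite big_const_seq count_predT iter_addr_0.
Qed.

(** The sum is the size of the cluster. For an infinite cluster it is [+oo], which [fine] sends to
    [0], and [0^-1 = 0]: the inverse size vanishes there without a case split. Writing the size as a
    sum of indicators makes it visibly measurable. *)
Definition inv_size om y : R := (fine (\esum_(z in [set: V]) (\1_(cluster ends om y) z)%:E))^-1.

Lemma inv_size_ge0 om y : (0 <= inv_size om y)%R.
Proof. by rewrite invr_ge0 fine_ge0// esum_ge0// => z _; rewrite lee_fin. Qed.

Lemma inv_size_eq om x y : cluster ends om x y -> inv_size om x = inv_size om y.
Proof. by rewrite /inv_size => /cluster_eq ->. Qed.

Lemma card_cluster_gt0 om x : finite_set (cluster ends om x) ->
  (0 < #|` fset_set (cluster ends om x)|%:R :> R)%R.
Proof.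
move=> fx; rewrite ltr0n cardfs_gt0; apply/fset0Pn; exists x.
by rewrite in_fset_set// mem_set//; exact: cluster_refl.
Qed.

(** The vertices of a finite cluster share a unit mass. This turns an indicator attached to the
    cluster of [x] into a sum over vertices, the form that mass transport needs. *)
Lemma inv_size_sum om x (b : bool) : (b -> finite_set (cluster ends om x)) ->
  \esum_(y in [set: V]) (if `[< cluster ends om x y >] && b then inv_size om y else 0)%:E
  = (b%:R)%:E.
Proof.
case: b => [/(_ isT) fx|_]; last by rewrite esum1// => y _; rewrite andbF.
transitivity (\esum_(y in [set: V]) ((inv_size om x)%:E * (\1_(cluster ends om x) y)%:E)).
  apply: eq_esum => y _; rewrite andbT indicE; case: asboolP => xy.
    by rewrite mem_set// mule1 (inv_size_eq xy).
  by rewrite memNset// mule0.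
rewrite esumZl; [|exact: inv_size_ge0|by move=> y; rewrite lee_fin].
rewrite /inv_size esum_indicator//= -EFinM mulVf// gt_eqF//.
exact: card_cluster_gt0.
Qed.

(** Counts the finite green clusters touching [e] through their vertices, each weighted by the
    inverse size, so that the count can be redistributed vertex by vertex. *)
Definition green_clusters om gr e : \bar R :=
  \esum_(y in [set: V])
    (if `[< good ends om gr y /\ touches ends (cluster ends om y) e >]
     then inv_size om y else 0)%:E.

Lemma good_eq om gr x y : cluster ends om x y -> good ends om gr x = good ends om gr y.
Proof. by rewrite /good => /cluster_eq ->. Qed.

Lemma green_clustersE om gr e : green_clusters om gr e =
  ((`[< good ends om gr (ends e).1 >] +
   (`[< good ends om gr (ends e).2 >] &&
    ~~ `[< cluster ends om (ends e).1 (ends e).2 >]))%N%:R)%:E.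
Proof.
rewrite natrD EFinD.
rewrite -(@inv_size_sum om (ends e).1); last by move=> /asboolP[].
rewrite -(@inv_size_sum om (ends e).2); last by move=> /andP[/asboolP[]].
have ge0 (b : bool) y : 0 <= (if b then inv_size om y else 0)%:E.
  by rewrite lee_fin; case: b => //; exact: inv_size_ge0.
rewrite -esumD//; apply: eq_esum => y _.
set a := (ends e).1; set b := (ends e).2; rewrite -EFinD; congr EFin.
have tch : touches ends (cluster ends om y) e <->
    cluster ends om a y \/ cluster ends om b y.
  by split=> -[] /cluster_sym; [left|right|left|right].
case: (pselect (cluster ends om a y)) => ay.
  rewrite (asboolT ay) (good_eq gr ay) /=.
  have -> : `[< cluster ends om b y >] && (`[< good ends om gr b >] &&
      ~~ `[< cluster ends om a b >]) = false.
    case: asboolP => //= bY; by rewrite (asboolT (cluster_trans ay (cluster_sym bY))) andbF.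
  rewrite addr0; congr (if _ then _ else _); apply/asboolP/asboolP; first by case.
  by move=> gy; split => //; apply/tch; left.
rewrite (asboolF ay) /= add0r.
case: (pselect (cluster ends om b y)) => bY; last first.
  rewrite (asboolF bY) /=; case: asboolP => // -[_ /tch []] //.
rewrite (asboolT bY) (good_eq gr bY) /=.
have nab : ~ cluster ends om a b by move=> ab; apply: ay; exact: cluster_trans ab bY.
rewrite (asboolF nab) andbT.
congr (if _ then _ else _); apply/asboolP/asboolP; first by case.
by move=> gy; split => //; apply/tch; right.
Qed.

(* Joining the two clusters at the ends of [e] replaces their two indicators by
   that of the union; inclusion-exclusion leaves the event that both are green. *)
Lemma two_ghost_pointwise om gr e :
  (\1_(Tevent ends (upd om e false) gr) e)%:E +
    green_clusters (upd om e true) gr e <= green_clusters (upd om e false) gr e.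
Proof.
rewrite !green_clustersE indicE -EFinD lee_fin -natrD ler_nat.
have e1 : upd om e true e by rewrite /upd eqxx.
rewrite (asboolT (cluster_edge ends e1)) andbF addn0.
have -> : `[< good ends (upd om e true) gr (ends e).1 >] =
  `[< finite_set (cluster ends (upd om e false) (ends e).1) >] &&
  `[< finite_set (cluster ends (upd om e false) (ends e).2) >] &&
  (`[< touches_green ends gr (cluster ends (upd om e false) (ends e).1) >] ||
   `[< touches_green ends gr (cluster ends (upd om e false) (ends e).2) >]).
  rewrite /good cluster_open -asbool_or -!asbool_and; apply: asbool_equiv_eq.
  by rewrite touches_greenU finite_setU.
have -> : (e \in Tevent ends (upd om e false) gr) =
  [&& ~~ `[< cluster ends (upd om e false) (ends e).1 (ends e).2 >],
   `[< touches_green ends gr (cluster ends (upd om e false) (ends e).1) >],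
   `[< touches_green ends gr (cluster ends (upd om e false) (ends e).2) >] &
   (`[< finite_set (cluster ends (upd om e false) (ends e).1) >] ||
    `[< finite_set (cluster ends (upd om e false) (ends e).2) >])].
  rewrite -asbool_neg -asbool_or -!asbool_and /in_mem /= /pred_of_set /=.
  apply: asbool_equiv_eq; rewrite /Tevent /= /upd eqxx; tauto.
rewrite /good !asbool_and.
have [ab|nab] := pselect (cluster ends (upd om e false) (ends e).1 (ends e).2).
  rewrite (asboolT ab) /= andbF addn0 (cluster_eq ab).
  by case: `[< _ >]; case: `[< _ >].
rewrite (asboolF nab) /= andbT.
by case: `[< finite_set (cluster _ _ (ends e).1) >];
   case: `[< finite_set (cluster _ _ (ends e).2) >];
   case: `[< touches_green _ _ (cluster _ _ (ends e).1) >];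
   case: `[< touches_green _ _ (cluster _ _ (ends e).2) >].
Qed.

(** A loop counts twice. With this convention the counts of an edge always add up to two, and sums
    over edges weighted by [endcount] at [x] are sums over oriented edges leaving [x]. *)
Definition endcount e x : R := (((ends e).1 == x) + ((ends e).2 == x))%N%:R.

Lemma endcount_ge0 e x : (0 <= endcount e x)%R.
Proof. exact: ler0n. Qed.

Lemma sum_endcount e : \esum_(x in [set: V]) (endcount e x)%:E = 2%:E.
Proof.
have one (v : V) : \esum_(x in [set: V]) ((v == x)%:R : R)%:E = 1.
  rewrite (esumID [set v]); last by move=> x _; rewrite lee_fin.
  rewrite setTI esum_set1 ?lee_fin// eqxx esum1 ?adde0// => x [_ /eqP].
  by rewrite eq_sym => /negPf ->.
under eq_esum do rewrite /endcount natrD EFinD.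
by rewrite esumD ?one -?EFinD// => x _; rewrite lee_fin.
Qed.

Lemma touching_sum_le C (c : E -> R) : (forall e, (0 <= c e)%R) ->
  \esum_(e in [set: E]) (if `[< touches ends C e >] then c e else 0)%:E <=
  \esum_(y in [set: V]) (if `[< C y >] then
     \esum_(e in [set: E]) (endcount e y * c e)%:E else 0).
Proof.
move=> c0.
have t0 e y : 0 <= (if `[< C y >] then (endcount e y * c e)%:E else 0).
  by case: ifP => // _; rewrite lee_fin mulr_ge0// endcount_ge0.
apply: (@le_trans _ _ (\esum_(y in [set: V]) \esum_(e in [set: E])
  (if `[< C y >] then (endcount e y * c e)%:E else 0))); last first.
  by apply: le_esum => y _; case: ifP => // _; rewrite esum1.
rewrite exchange_esum//; apply: le_esum => e _.
case: asboolP => [Ce|_]; last exact: esum_ge0.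
have [y Cy ye] : exists2 y, C y & (1 <= endcount e y)%R.
  case: Ce => Cy; [exists (ends e).1|exists (ends e).2] => //;
  by rewrite ler1n eqxx ?addnS.
apply: le_trans (esum_term_le y (t0 e)).
by rewrite (asboolT Cy) lee_fin ler_peMl.
Qed.

End ClusterSums.

(** * Mass transport *)
Section MassTransport.
Local Open Scope ereal_scope.
Context {R : realType} (V E : countType) (ends : E -> V * V) (J : E -> R)
  (Gam : set ((V -> V) * (E -> E))).
Hypotheses (HGsub : is_subgroup_Aut ends J Gam) (HGtr : is_transitive Gam)
  (HGunimod : is_unimodular Gam).

Lemma Gam_inv g : Gam g -> exists2 k, Gam k &
  [/\ cancel g.1 k.1, cancel k.1 g.1, cancel g.2 k.2 & cancel k.2 g.2].
Proof.
move=> /(HGsub.2.2.2 g) [k [Gk [gk kg]]]; exists k => //.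
have [k1 k2] : g.1 \o k.1 = id /\ g.2 \o k.2 = id by case: gk.
have [g1 g2] : k.1 \o g.1 = id /\ k.2 \o g.2 = id by case: kg.
by split => x; [exact: (congr1 (@^~ x) g1)|exact: (congr1 (@^~ x) k1)|
  exact: (congr1 (@^~ x) g2)|exact: (congr1 (@^~ x) k2)].
Qed.

Lemma esum_cst_card (o : V) (A B : set V) (a : \bar R) : (A #= B)%card ->
  \esum_(x in A) a = \esum_(x in B) a.
Proof.
pose Vp : pointedType := HB.pack V (isPointed.Build V o).
move=> /(@card_set_bijP V Vp)[f fb]; exact/esym/(reindex_esum A B f).
Qed.

Lemma esum_fibers (c : V -> V) (a : V -> \bar R) : (forall y, 0 <= a y) ->
  \esum_(y in [set: V]) a y =
  \esum_(k in [set: V]) \esum_(y in [set y | c y = k]) a y.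
Proof.
move=> a0.
transitivity (\esum_(k in [set: V]) \esum_(y in [set: V]) if c y == k then a y else 0).
  rewrite exchange_esum => [|i j]; last by case: ifP.
  apply: eq_esum => y _; rewrite (esumID [set c y]); last by move=> k _; case: ifP.
  rewrite setTI esum_set1 eqxx// esum1 ?adde0// => k [_ /eqP].
  by rewrite eq_sym => /negPf ->.
apply: eq_esum => k _; rewrite [RHS]esum_mkcond; apply: eq_esum => y _.
case: eqP => yk; first by rewrite mem_set.
by rewrite memNset.
Qed.

(* Sum along the orbits of the diagonal action: the pairs [(o, y)] and [(z, o)]
   in one orbit number |Stab(o) y| and |Stab(y) o|. *)
Lemma mass_transport (f : V -> V -> \bar R) (o : V) :
  (forall x y, 0 <= f x y) ->
  (forall g x y, Gam g -> f (g.1 x) (g.1 y) = f x y) ->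
  \esum_(y in [set: V]) f o y = \esum_(x in [set: V]) f x o.
Proof.
move=> f0 finv.
have Gcomp := HGsub.2.2.1; have Gid := HGsub.2.1.
pose O y : set V := [set g.1 y | g in stabilizer Gam o].
(* These are the [z] with [(z, o)] in the diagonal orbit of [(o, y)]; on them [f z o] is constantly
   [f o y]. *)
pose T y : set V := [set z | exists g, [/\ Gam g, g.1 o = z & g.1 y = o]].
have Orefl y : O y y by exists (id_aut V E).
have Oeq y y' : O y y' -> O y = O y'.
  move=> [g [Gg go] <-]; have [k Gk [gK kK _ _]] := Gam_inv Gg.
  apply/seteqP; split => _ [g' [Gg' go'] <-].
    exists (comp_aut g' k) => /=; last by rewrite gK.
    by split; [exact: Gcomp|rewrite /= -[X in k.1 X]go gK].
  exists (comp_aut g' g) => //.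
  by split; [exact: Gcomp|rewrite /= go].
have TO y y' z : T y z -> T y' z -> O y y'.
  move=> [g [Gg goz gyo]] [g' [Gg' goz' gyo']].
  have [k Gk [gK kK _ _]] := Gam_inv Gg'.
  exists (comp_aut k g) => /=; last by rewrite gyo -gyo' gK.
  by split; [exact: Gcomp|rewrite /= goz -goz' gK].
have Tex z : exists y, T y z.
  have [g [Gg goz]] := HGtr o z; have [k Gk [gK kK _ _]] := Gam_inv Gg.
  by exists (k.1 o), g; split.
have OT y y' : O y y' -> T y' `<=` T y.
  move=> [g [Gg go] gy] z [g' [Gg' goz gyo]].
  exists (comp_aut g' g); split => /=; first exact: Gcomp.
  - by rewrite go.
  - by rewrite gy.
(* Unimodularity compares the orbits [Stab(o) y] and [Stab(y) o]; an automorphism carrying [y] to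
   [o] maps the second one bijectively onto [T y]. *)
have cardOT y : (O y #= T y)%card.
  have [g [Gg gyo]] := HGtr y o; have [k Gk [gK kK _ _]] := Gam_inv Gg.
  apply: card_eq_trans (HGunimod o y) _.
  have -> : T y = g.1 @` [set g'.1 o | g' in stabilizer Gam y].
    apply/seteqP; split.
      move=> z [g' [Gg' goz gyo']]; exists (k.1 z); last by rewrite kK.
      exists (comp_aut k g') => /=; last by rewrite goz.
      by split; [exact: Gcomp|rewrite /= gyo' -gyo gK].
    move=> _ [_ [g' [Gg' gy] <-] <-]; exists (comp_aut g g'); split => //=.
      exact: Gcomp.
    by rewrite gy.
  rewrite card_eq_sym; apply: inj_card_eq => x y' _ _; exact: (can_inj gK).
(* [xget] depends only on the set [O y], so this selects one representative per stabilizer orbit.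
   Both sides of the identity are split along these representatives. *)
pose rep y := xget o (O y).
have Orep y : O y (rep y) by exact: (xgetPex o (ex_intro _ y (Orefl y))).
have rep_eq y y' : O y y' -> rep y = rep y' by rewrite /rep => /Oeq ->.
have rep_rep y : rep (rep y) = rep y by rewrite -(rep_eq _ _ (Orep y)).
pose K := [set y | rep y = y].
pose JO y := if `[< K y >] then O y else set0.
pose JT y := if `[< K y >] then T y else set0.
have [ty tyP] : {ty : V -> V | forall z, T (ty z) z}.
  by exists (fun z => xget o [set y | T y z]) => z; exact: (xgetPex o (Tex z)).
have repO k : [set y | rep y = k] = if `[< K k >] then O k else set0.
  apply/seteqP; split => y /=.
    move=> <-; rewrite asboolT; last exact: rep_rep.
    by rewrite -(Oeq _ _ (Orep y)).
  by case: asboolP => // Kk Oky; rewrite -(rep_eq _ _ Oky).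
have repT k : [set z | rep (ty z) = k] = if `[< K k >] then T k else set0.
  apply/seteqP; split => z /=.
    move=> <-; rewrite asboolT; last exact: rep_rep.
    by apply: (OT _ (ty z)) (tyP z); rewrite -(Oeq _ _ (Orep (ty z))).
  by case: asboolP => // Kk Tkz; rewrite -(rep_eq _ _ (TO _ _ _ Tkz (tyP z))).
rewrite (esum_fibers rep)// [RHS](esum_fibers (rep \o ty))//.
apply: eq_esum => k _.
transitivity (\esum_(y in (if `[< K k >] then O k else set0)) f o y).
  by rewrite -repO.
transitivity (\esum_(z in (if `[< K k >] then T k else set0)) f z o); last first.
  by rewrite -repT.
case: asboolP => Kk; last by rewrite !esum_set0.
transitivity (\esum_(y in O k) f o k).
  by apply: eq_esum => _ [g [Gg go] <-]; rewrite -{1}go finv.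
rewrite (esum_cst_card o _ (cardOT k)); apply: eq_esum => z [g [Gg goz gko]].
by rewrite -goz -{3}gko finv.
Qed.

Section equivariance.
Variable g : (V -> V) * (E -> E).
Hypothesis Gg : Gam g.
Implicit Types (om gr : E -> bool) (x y : V) (e : E).

Lemma ends_aut e : ends (g.2 e) = (g.1 (ends e).1, g.1 (ends e).2) \/
  ends (g.2 e) = (g.1 (ends e).2, g.1 (ends e).1).
Proof. by have [_ [_ []]] := HGsub.1 _ Gg. Qed.

End equivariance.

Lemma cluster_aut_sub g om x y : Gam g ->
  cluster ends (om \o g.2) x y -> cluster ends om (g.1 x) (g.1 y).
Proof.
move=> Gg; elim=> {x y} [x y [e [oe xy]]|x|x y z _ xy _ yz]; last exact: cluster_trans xy yz.
  apply: rt_step; exists (g.2 e); split => //.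
  by case: (ends_aut Gg e) => ->; case: xy => -> /=; [left|right|right|left].
exact: cluster_refl.
Qed.

Lemma cluster_aut g om x y : Gam g ->
  cluster ends om (g.1 x) (g.1 y) <-> cluster ends (om \o g.2) x y.
Proof.
move=> Gg; split; last exact: cluster_aut_sub.
have [k Gk [g1K k1K g2K k2K]] := Gam_inv Gg.
have -> : om = (om \o g.2) \o k.2 by apply/funext => e /=; rewrite k2K.
move=> /(cluster_aut_sub Gk); rewrite !g1K.
by rewrite [_ \o k.2](_ : _ = om)//; apply/funext => e /=; rewrite k2K.
Qed.

Lemma cluster_aut_image g om x : Gam g ->
  cluster ends om (g.1 x) = g.1 @` cluster ends (om \o g.2) x.
Proof.
move=> Gg; have [k Gk [g1K k1K g2K k2K]] := Gam_inv Gg.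
apply/seteqP; split => y.
  move=> xy; exists (k.1 y); last exact: k1K.
  by apply/cluster_aut => //; rewrite k1K.
by move=> [z /(cluster_aut _ _ _ Gg) xz <-].
Qed.

Lemma touches_aut g C e : Gam g ->
  touches ends (g.1 @` C) (g.2 e) <-> touches ends C e.
Proof.
move=> Gg; have [k Gk [g1K k1K g2K k2K]] := Gam_inv Gg.
have gC v : (g.1 @` C) (g.1 v) <-> C v.
  by split; [move=> [u Cu /(can_inj g1K) <-]|move=> Cv; exists v].
have [ga gb] := (gC (ends e).1, gC (ends e).2).
by rewrite /touches; case: (ends_aut Gg e) => ->; split => -[] /= h; tauto.
Qed.

Lemma good_aut g om gr x : Gam g ->
  good ends om gr (g.1 x) <-> good ends (om \o g.2) (gr \o g.2) x.
Proof.
move=> Gg; have [k Gk [g1K k1K g2K k2K]] := Gam_inv Gg.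
rewrite /good cluster_aut_image//; set C := cluster _ _ x; split.
  move=> [fC [f [gf tf]]]; split.
    suff -> : C = k.1 @` (g.1 @` C) by exact: finite_image.
    apply/seteqP; split => y; first by move=> Cy; exists (g.1 y); [exists y|exact: g1K].
    by move=> [_ [u Cu <-] <-]; rewrite g1K.
  exists (k.2 f); split; first by rewrite /= k2K.
  by apply/(touches_aut C _ Gg); rewrite k2K.
move=> [fC [f [gf tf]]]; split; first exact: finite_image.
by exists (g.2 f); split => //; exact/(touches_aut C _ Gg).
Qed.

Lemma inv_size_aut g om x : Gam g ->
  inv_size ends om (g.1 x) = inv_size ends (om \o g.2) x :> R.
Proof.
move=> Gg; have [k Gk [g1K k1K g2K k2K]] := Gam_inv Gg.
rewrite /inv_size; congr (GRing.inv (fine _)); rewrite (reindex_esum setT _ g.1).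
  apply: eq_esum => y _; rewrite !indicE; congr (((nat_of_bool _)%:R)%:E).
  by apply/idP/idP => /set_mem xy; apply/mem_set; move: xy => /(cluster_aut om x y Gg).
split => //; first by move=> y z _ _ /(can_inj g1K).
by move=> y _; exists (k.1 y).
Qed.

Lemma endcount_aut g e x : Gam g ->
  endcount ends (g.2 e) (g.1 x) = endcount ends e x :> R.
Proof.
move=> Gg; have [k Gk [g1K k1K g2K k2K]] := Gam_inv Gg.
rewrite /endcount; congr (_%:R).
case: (ends_aut Gg e) => -> /=; rewrite !(inj_eq (can_inj g1K))//.
by rewrite addnC.
Qed.

End MassTransport.

(** * The exploration supermartingale *)
Section Exploration.
Context {R : realType} (V E : countType) (ends : E -> V * V).
Implicit Types (om : E -> bool) (s : seq E) (C : set V) (e : E).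

(** Averages over independent states of the edges in [s], the other states being read from [om]. A
    finite recursion is enough because the exploration is run on finite edge sets only. *)
Fixpoint expect (p : E -> R) s (F : (E -> bool) -> R) om : R :=
  if s is e :: s' then p e * expect p s' F (upd om e true) +
                       (1 - p e) * expect p s' F (upd om e false)
  else F om.

Variable p : E -> R.
Hypothesis p01 : forall e, 0 <= p e <= 1.

Lemma expect_ext s F F' om :
  (forall om', (forall e, e \notin s -> om' e = om e) -> F om' = F' om') ->
  expect p s F om = expect p s F' om.
Proof.
elim: s om => [|e s ih] om FF' /=; first exact: FF'.
by congr (_ * _ + _ * _); apply: ih => om' h; apply: FF' => f;
  rewrite inE negb_or => /andP[/negPf fe fs]; rewrite (h f fs) /upd fe.
Qed.

Lemma expect_cst s k om : expect p s (fun=> k) om = k.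
Proof. by elim: s om => //= e s ih om; rewrite !ih -mulrDl addrC subrK mul1r. Qed.

Lemma upd_comm om e f b b' : e != f ->
  upd (upd om e b) f b' = upd (upd om f b') e b.
Proof.
move=> ef; apply/funext => x; rewrite /upd.
by case: (eqVneq x f) => // ->; rewrite eq_sym (negPf ef).
Qed.

(** Updates at distinct edges commute, so any edge can be averaged first. Applied afresh after each
    outcome, this lets the next edge depend on what has been revealed. *)
Lemma expect_rem s e F om : e \in s -> expect p s F om = expect p (e :: rem e s) F om.
Proof.
elim: s om => //= f s ih om; rewrite inE; case: (eqVneq f e) => [-> //|fe] /= es.
rewrite !ih//= !(upd_comm om _ _ fe); ring.
Qed.

Variables (J : E -> R) (c : E -> bool -> R).
Hypotheses (J0 : forall e, 0 <= J e)
  (c_mean : forall e, p e * c e true + (1 - p e) * c e false = 0)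
  (c_var : forall e, p e * c e true ^+ 2 + (1 - p e) * c e false ^+ 2 <= J e).

Definition restr s om : E -> bool := fun e => (e \in s) && om e.

Definition revealed s C om e : bool := `[< touches ends (reach ends (restr s om) C) e >].

Definition revealed_mass s C om : R := \sum_(e <- s) if revealed s C om e then J e else 0.

Definition revealed_sum s C om : R :=
  \sum_(e <- s) if revealed s C om e then c e (om e) else 0.

Variable h : R.
Hypothesis h0 : 0 < h.

(** The square of [h m / (1 + h q)]. Here [q] is the revealed mass and [m] the revealed signed
    weight, the quantities called [m] and [H] in the overview. *)
Definition penalized (q m : R) : R := h ^+ 2 * m ^+ 2 / (1 + h * q) ^+ 2.

Definition lyapunov (q m : R) : R := penalized q m + h / (1 + h * q).

(** Mean zero kills the cross term, so the new edge adds at most [h^2 j / b^2] to the square. The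
    drop [h / a - h / b = h^2 j / (a b)] of the second term pays for it because [a <= b]. Enlarging
    the denominator under the old square only helps. *)
Lemma lyapunov_step (q m pe j c1 c0 : R) : 0 <= q -> 0 <= j ->
  pe * c1 + (1 - pe) * c0 = 0 -> pe * c1 ^+ 2 + (1 - pe) * c0 ^+ 2 <= j ->
  pe * lyapunov (q + j) (m + c1) + (1 - pe) * lyapunov (q + j) (m + c0) <= lyapunov q m.
Proof.
move=> q0 j0 mean var; rewrite /lyapunov /penalized.
set a := 1 + h * q; set b := 1 + h * (q + j).
have a1 : 1 <= a by rewrite lerDl mulr_ge0// ltW.
have ba : b = a + h * j by rewrite /a /b; ring.
have ab : a <= b by rewrite ba lerDl mulr_ge0// ltW.
have a0 : 0 < a by rewrite (lt_le_trans _ a1).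
have b0 : 0 < b by rewrite (lt_le_trans a0).
have -> : pe * (h ^+ 2 * (m + c1) ^+ 2 / b ^+ 2 + h / b) +
    (1 - pe) * (h ^+ 2 * (m + c0) ^+ 2 / b ^+ 2 + h / b) =
    h ^+ 2 * m ^+ 2 / b ^+ 2 +
    2 * m * h ^+ 2 / b ^+ 2 * (pe * c1 + (1 - pe) * c0) +
    (h ^+ 2 * (pe * c1 ^+ 2 + (1 - pe) * c0 ^+ 2) / b ^+ 2 + h / b).
  by field; exact: lt0r_neq0.
rewrite mean mulr0 addr0; apply: lerD.
  apply: ler_wpM2l; first by rewrite mulr_ge0 ?sqr_ge0.
  rewrite lef_pV2 ?posrE ?exprn_gt0//.
  by rewrite ler_pXn2r// nnegrE ltW.
apply: (@le_trans _ _ (h ^+ 2 * j / b ^+ 2 + h / b)).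
  rewrite lerD2r; apply: ler_wpM2r; first by rewrite invr_ge0 sqr_ge0.
  by apply: ler_wpM2l => //; exact: sqr_ge0.
rewrite -subr_ge0.
have -> : h / a - (h ^+ 2 * j / b ^+ 2 + h / b) = h * (h * j) ^+ 2 / (a * b ^+ 2).
  have bn : a + h * j != 0 by rewrite -ba lt0r_neq0.
  by rewrite ba; field; rewrite bn lt0r_neq0.
by apply: divr_ge0; apply: mulr_ge0; rewrite ?sqr_ge0 ?(ltW h0) ?(ltW a0).
Qed.

Section reveal_edge.
Variables (s : seq E) (C : set V) (e : E).
Hypotheses (us : uniq s) (es : e \in s) (Ce : touches ends C e).
Let s' := rem e s.

Let C_after b := if b then C `|` [set (ends e).1; (ends e).2] else C.

(** A revealed edge can leave [s]: if it is open, its endpoints have joined [C]; if it is closed, it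
    was already absent from the restricted configuration. *)
Lemma revealed_after om f :
  revealed s C om f = revealed s' (C_after (om e)) om f.
Proof.
rewrite /revealed; congr (`[< touches ends _ f >]).
have r' : upd (restr s om) e false = restr s' om.
  apply/funext => x; rewrite /upd /restr mem_rem_uniq// inE.
  by case: eqP.
rewrite -r'; case: (boolP (om e)) => oe /=.
  by apply: reach_open => //; rewrite /restr es.
congr reach; apply/funext => x; rewrite /upd; case: eqP => // ->.
by rewrite /restr (negPf oe) andbF.
Qed.

Lemma revealed_head om : revealed s C om e.
Proof. by apply/asboolP; case: Ce => Cx; [left|right]; exact: reach_sub. Qed.

Lemma revealed_mass_after om :
  revealed_mass s C om = J e + revealed_mass s' (C_after (om e)) om.
Proof.
rewrite /revealed_mass (perm_big _ (perm_to_rem es)) big_cons revealed_head.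
by congr (_ + _); apply: eq_bigr => f _; rewrite revealed_after.
Qed.

Lemma revealed_sum_after om :
  revealed_sum s C om = c e (om e) + revealed_sum s' (C_after (om e)) om.
Proof.
rewrite /revealed_sum (perm_big _ (perm_to_rem es)) big_cons revealed_head.
by congr (_ + _); apply: eq_bigr => f _; rewrite revealed_after.
Qed.

End reveal_edge.

(* Edges are revealed one by one, always choosing an unrevealed edge that touches
   the part [C] of the cluster found so far. *)
Lemma exploration_bound s C q m om : uniq s -> 0 <= q ->
  expect p s (fun om => penalized (q + revealed_mass s C om) (m + revealed_sum s C om)) om
  <= lyapunov q m.
Proof.
have [n] := ubnP (size s); elim: n s C q m om => // n ih s C q m om sn us q0.
have [|noe] := pselect (exists2 e, e \in s & touches ends C e); last first.
  have rC om' : reach ends (restr s om') C = C.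
    by apply: reach_untouched => e /andP[es _] Ce; apply: noe; exists e.
  have rev0 om' f : f \in s -> revealed s C om' f = false.
    by move=> fs; rewrite /revealed rC; apply/asboolP => Cf; apply: noe; exists f.
  rewrite (@expect_ext _ _ (fun=> penalized q m)); last first.
    move=> om' _; congr penalized; rewrite /revealed_mass /revealed_sum big_seq_cond.
      by rewrite big1 ?addr0// => f; rewrite andbT => fs; rewrite rev0.
    by rewrite big1 ?addr0// => f; rewrite andbT => fs; rewrite rev0.
  (* Nothing is left to reveal: the two sides differ by [h / (1 + h q)], which is discarded. *)
  by rewrite expect_cst lerDl divr_ge0 ?addr_ge0 ?mulr_ge0// ?ltW.
move=> [e es Ce]; rewrite (expect_rem _ _ es) /=.
have us' : uniq (rem e s) by exact: rem_uniq.
have sn' : (size (rem e s) < n)%N.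
  by rewrite size_rem//; case: (s) es sn => //= x t _; rewrite ltnS.
have es' : e \notin rem e s by rewrite mem_rem_uniqF.
(* The state of [e] shifts the starting point to [(q + J e, m + c e b)] and leaves an exploration of
   the remaining edges, which is the induction hypothesis. *)
have after b : expect p (rem e s) (fun om => penalized (q + revealed_mass s C om)
      (m + revealed_sum s C om)) (upd om e b) <= lyapunov (q + J e) (m + c e b).
  rewrite (@expect_ext _ _ (fun om => penalized (q + J e + revealed_mass (rem e s)
    (if b then C `|` [set (ends e).1; (ends e).2] else C) om)
    (m + c e b + revealed_sum (rem e s)
    (if b then C `|` [set (ends e).1; (ends e).2] else C) om))); last first.
    move=> om' om'E; have oe : om' e = b by rewrite om'E// /upd eqxx.
    by rewrite (revealed_mass_after us es Ce) (revealed_sum_after us es Ce) oe !addrA.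
  by apply: ih => //; rewrite addr_ge0.
have /andP[pe0 pe1] := p01 e.
apply: le_trans (lyapunov_step m q0 (J0 e) (c_mean e) (c_var e)).
by apply: lerD; apply: ler_wpM2l; rewrite ?subr_ge0.
Qed.

End Exploration.

(** * Measurability of cluster functionals *)
Section MeasurableReal.
Context {R : realType}.

Lemma measurable_invr : measurable_fun setT (fun x : R => x^-1).
Proof.
(* The power [-1] inverts nonnegative numbers, [0] included by convention; oddness covers the
   others. *)
rewrite (_ : (fun x => _) = fun x : R => if 0 <= x then x `^ (-1) else - ((- x) `^ (-1))).
  apply: measurable_fun_ifT; first exact: measurable_fun_ler.
    exact: measurable_powR.
  exact: (measurableT_comp (@oppr_measurable R setT)
    (measurableT_comp (@measurable_powR R (-1)) (@oppr_measurable R setT))).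
apply/funext => x; case: ifPn => [x0|]; first by rewrite powR_inv1.
by rewrite -ltNge => x0; rewrite powR_inv1 ?oppr_ge0 ?ltW// invrN opprK.
Qed.

Lemma measurable_sqrtr : measurable_fun setT (fun x : R => Num.sqrt x).
Proof. by apply: continuous_measurable_fun => x; exact: sqrt_continuous. Qed.

Lemma measurable_fine_esum d (S : measurableType d) (T : countType) (f : T -> S -> R) :
  (forall x s, 0 <= f x s) -> (forall x, measurable_fun setT (f x)) ->
  measurable_fun setT (fun s => fine (\esum_(x in [set: T]) (f x s)%:E)).
Proof.
move=> f0 mf; apply: (measurableT_comp (@fine_measurable R setT measurableT)).
apply: (@emeasurable_esum _ _ S T (fun x s => (f x s)%:E)).
  by move=> x s; rewrite lee_fin.
by move=> x; apply/measurable_EFinP.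
Qed.

End MeasurableReal.

Section MeasurableConfig.
Context {R : realType} (V E : countType) (ends : E -> V * V).
Notation conf := (fspace E R * (fspace E bool * fspace E bool))%type.
Implicit Types (x y : V) (e : E).

Lemma measurable_env e : measurable_fun setT (fun z : conf => z.1 e).
Proof. exact: (measurableT_comp (@measurable_coord E _ R e) (@measurable_fst _ _ (fspace E R) _)). Qed.

Lemma measurable_opened : measurable_fun setT (fun z : conf => z.2.1).
Proof. exact: (measurableT_comp (@measurable_fst _ _ (fspace E bool) (fspace E bool)) (@measurable_snd _ _ (fspace E R) _)). Qed.

Lemma measurable_greens : measurable_fun setT (fun z : conf => z.2.2).
Proof. exact: (measurableT_comp (@measurable_snd _ _ (fspace E bool) (fspace E bool)) (@measurable_snd _ _ (fspace E R) _)). Qed.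

Lemma measurable_open_edge e : measurable_fun setT (fun z : conf => z.2.1 e).
Proof. exact: (measurableT_comp (@measurable_coord E _ bool e) measurable_opened). Qed.

Lemma measurable_green_edge e : measurable_fun setT (fun z : conf => z.2.2 e).
Proof. exact: (measurableT_comp (@measurable_coord E _ bool e) measurable_greens). Qed.

Lemma measurable_pred_opened (Q : (E -> bool) -> Prop) :
  measurable [set om : fspace E bool | Q om] -> measurable [set z : conf | Q z.2.1].
Proof. by move=> mQ; have := measurable_opened measurableT mQ; rewrite setTI. Qed.

Lemma measurable_conf_cluster x y : measurable [set z : conf | cluster ends z.2.1 x y].
Proof. exact: (measurable_pred_opened (measurable_cluster ends x y)). Qed.

Lemma measurable_conf_finite x : measurable [set z : conf | finite_set (cluster ends z.2.1 x)].
Proof. exact: (measurable_pred_opened (measurable_finite_cluster ends x)). Qed.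

Lemma measurable_conf_touches x e :
  measurable [set z : conf | touches ends (cluster ends z.2.1 x) e].
Proof. exact: (measurable_pred_opened (measurable_touches ends x e)). Qed.

Lemma measurable_touches_green x :
  measurable [set z : conf | touches_green ends z.2.2 (cluster ends z.2.1 x)].
Proof.
apply: measurable_exists => f; apply: measurable_predI.
  by have := measurable_greens measurableT (@measurable_coord_true E f); rewrite setTI.
exact: measurable_conf_touches.
Qed.

Lemma measurable_good x : measurable [set z : conf | good ends z.2.1 z.2.2 x].
Proof.
apply: measurable_predI; last exact: measurable_touches_green.
exact: measurable_conf_finite.
Qed.

Lemma measurable_Tevent e : measurable [set z : conf | Tevent ends z.2.1 z.2.2 e].
Proof.
apply: measurable_predI.
  by have := measurable_open_edge e measurableT (_ : measurable [set false]); rewrite setTI; apply.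
apply: measurable_predI.
  by apply: measurable_predC; exact: measurable_conf_cluster.
apply: measurable_predI; first exact: measurable_touches_green.
apply: measurable_predI; first exact: measurable_touches_green.
by apply: measurable_predU; exact: measurable_conf_finite.
Qed.

Lemma measurable_if_pred (Q : conf -> Prop) (f g : conf -> R) :
  measurable [set z | Q z] -> measurable_fun setT f -> measurable_fun setT g ->
  measurable_fun setT (fun z => if `[< Q z >] then f z else g z).
Proof. by move=> mQ mf mg; apply: measurable_fun_ifT => //; exact: measurable_asbool. Qed.

Lemma measurable_inv_size y : measurable_fun setT (fun z : conf => inv_size ends z.2.1 y : R).
Proof.
apply: (measurableT_comp measurable_invr); apply: measurable_fine_esum.
  by move=> v z; rewrite indicE.
move=> v; rewrite (_ : (fun z => _) =
    fun z : conf => if `[< cluster ends z.2.1 y v >] then 1 else 0).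
  apply: measurable_if_pred => //.
  exact: measurable_conf_cluster.
apply/funext => z; rewrite indicE; case: asboolP => yv; first by rewrite mem_set.
by rewrite memNset.
Qed.

Lemma measurable_inv_size_touching e y : measurable_fun setT (fun z : conf =>
  if `[< good ends z.2.1 z.2.2 y /\ touches ends (cluster ends z.2.1 y) e >]
  then inv_size ends z.2.1 y else 0 : R).
Proof.
apply: measurable_if_pred => //; last exact: measurable_inv_size.
apply: measurable_predI; first exact: measurable_good.
exact: measurable_conf_touches.
Qed.

Lemma measurable_green_clusters e :
  measurable_fun setT (fun z : conf => green_clusters ends z.2.1 z.2.2 e : \bar R).
Proof.
apply: emeasurable_esum => [y z|y].
  by rewrite lee_fin; case: ifP => // _; exact: inv_size_ge0.
by apply/measurable_EFinP; exact: measurable_inv_size_touching.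
Qed.

Lemma measurable_touching_sum (c : E -> conf -> R) x :
  (forall e z, 0 <= c e z) -> (forall e, measurable_fun setT (c e)) ->
  measurable_fun setT (fun z : conf =>
    fine (\esum_(e in [set: E]) (if `[< touches ends (cluster ends z.2.1 x) e >]
       then c e z else 0)%:E)).
Proof.
move=> c0 mc; apply: measurable_fine_esum => [e z|e]; first by case: ifP.
apply: measurable_if_pred => //.
exact: measurable_conf_touches.
Qed.

End MeasurableConfig.

(** * Exhaustion by finite edge sets *)
Section SumsOverLists.
Local Open Scope ereal_scope.
Context {R : realType} (E : countType).

Lemma esum_seq (s : seq E) (a : E -> R) : uniq s -> (forall e, (0 <= a e)%R) ->
  (forall e, e \notin s -> a e = 0%R) ->
  \esum_(e in [set: E]) (a e)%:E = (\sum_(e <- s) a e)%:E.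
Proof.
move=> us a0 as0; rewrite (esumID [set` s]); last by move=> e _; rewrite lee_fin.
rewrite setTI [X in _ + X]esum1 ?adde0; last first.
  by move=> e [_ /= /negP es]; rewrite as0.
rewrite esum_fset; [|exact: finite_seq|by move=> e _; rewrite lee_fin].
by rewrite -fsbig_seq// sumEFin.
Qed.

Lemma sum_seq_le_esum (s : seq E) (a : E -> R) : uniq s -> (forall e, (0 <= a e)%R) ->
  (\sum_(e <- s) a e)%:E <= \esum_(e in [set: E]) (a e)%:E.
Proof.
move=> us a0; rewrite (esumID [set` s]); last by move=> e _; rewrite lee_fin.
rewrite setTI esum_fset; [|exact: finite_seq|by move=> e _; rewrite lee_fin].
rewrite -fsbig_seq// sumEFin leeDl// esum_ge0// => e _; by rewrite lee_fin.
Qed.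

(** Otherwise more than [T / eps] terms, each at least [eps], would add up to more than the total
    [T]. *)
Lemma finite_large_terms (a : E -> R) (eps : R) : (0 < eps)%R ->
  (forall e, (0 <= a e)%R) -> \esum_(e in [set: E]) (a e)%:E < +oo ->
  finite_set [set e | (eps <= a e)%R].
Proof.
move=> eps0 a0 afin; apply: contrapT => infS.
have T0 : 0 <= \esum_(e in [set: E]) (a e)%:E by apply: esum_ge0 => e _; rewrite lee_fin.
have Tfin : \esum_(e in [set: E]) (a e)%:E \is a fin_num by rewrite ge0_fin_numE.
set T := fine (\esum_(e in [set: E]) (a e)%:E).
pose n := (Num.truncn (T / eps)).+1.
have [B [Bn BS]] : exists B : {fset E}, (n <= #|` B|)%N /\ [set` B] `<=` [set e | (eps <= a e)%R].
  by have [B BS Bn] := infinite_set_fset n infS; exists B; split.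
have := sum_seq_le_esum (fset_uniq B) a0; rewrite -(fineK Tfin) lee_fin -/T leNgt => /negP; apply.
apply: (@lt_le_trans _ _ (n%:R * eps)%R).
  by rewrite -ltr_pdivrMr// /n truncnS_gt.
apply: (@le_trans _ _ (#|` B|%:R * eps)%R); first by rewrite ler_wpM2r ?ler_nat// ltW.
rewrite mulr_natl -(@iter_addr_0 R) -(count_predT B) -big_const_seq.
rewrite big_seq [leRHS]big_seq; apply: ler_sum => e eB; exact: BS.
Qed.

Definition first_edges (n : nat) : seq E := pmap (@choice.pickle_inv E) (iota 0 n).

Lemma mem_first_edges n e : (e \in first_edges n) = (choice.pickle e < n)%N.
Proof.
by rewrite /first_edges (can2_mem_pmap (@pickle_invK E) (@pickleK_inv E)) mem_iota.
Qed.

Lemma first_edges_uniq n : uniq (first_edges n).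
Proof. by apply: (pmap_uniq (@pickle_invK E)); exact: iota_uniq. Qed.

Lemma finite_in_first_edges (S : set E) : finite_set S ->
  exists N, forall n, (N <= n)%N -> forall e, S e -> e \in first_edges n.
Proof.
move=> /finite_seqP[s ->]; exists (\max_(e <- s) (choice.pickle e).+1)%N => n Nn e es.
rewrite mem_first_edges; apply: leq_trans Nn.
by rewrite (big_rem e)//= leq_max leqnn.
Qed.

End SumsOverLists.


Section ClusterExhaustion.
Context (V E : countType) (ends : E -> V * V).

Lemma cluster_restr_eventually om x y : cluster ends om x y ->
  exists N, forall n, (N <= n)%N -> cluster ends (restr (first_edges E n) om) x y.
Proof.
move: y; apply: (@cluster_ind_r _ _ ends om x (fun y => exists N, forall n, (N <= n)%N ->
  cluster ends (restr (first_edges E n) om) x y)).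
  by exists 0%N => n _; exact: cluster_refl.
move=> e y z _ [N xyN] oe yz; exists (maxn N (choice.pickle e).+1) => n.
rewrite geq_max => /andP[Nn en]; apply: cluster_trans (xyN n Nn) _.
by apply: rt_step; exists e; split => //; rewrite /restr mem_first_edges en.
Qed.

(** Each of the finitely many vertices is joined to [x] by a path with finitely many edges, so all
    these paths are present from some index on. Restriction never enlarges a cluster. *)
Lemma finite_cluster_restr om x : finite_set (cluster ends om x) ->
  exists N, forall n, (N <= n)%N ->
    cluster ends (restr (first_edges E n) om) x = cluster ends om x.
Proof.
move=> /finite_seqP[s xs].
have [N xN] : exists N, forall n, (N <= n)%N -> forall y, y \in s -> cluster ends om x y ->
    cluster ends (restr (first_edges E n) om) x y.
  elim: s {xs} => [|y s [N ih]]; first by exists 0%N.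
  have [xy|nxy] := pselect (cluster ends om x y); last first.
    by exists N => n Nn y'; rewrite inE => /orP[/eqP -> //|]; exact: ih.
  have [N' xyN] := cluster_restr_eventually xy.
  exists (maxn N N') => n; rewrite geq_max => /andP[Nn N'n] y'.
  by rewrite inE => /orP[/eqP -> _|]; [exact: xyN|exact: ih].
exists N => n Nn; apply/seteqP; split; first by apply: subset_cluster => e /andP[].
by move=> y xy; apply: xN => //; have : [set` s] y by rewrite -xs.
Qed.

End ClusterExhaustion.

(** * The two-ghost inequality for truncated weights *)
Section TwoGhost.
Local Open Scope ereal_scope.
Context {R : realType} (V E : countType) (ends : E -> V * V) (J : E -> R)
  (Gam : set ((V -> V) * (E -> E))).
Notation conf := (fspace E R * (fspace E bool * fspace E bool))%type.
Context d (Omega : measurableType d) (P : probability Omega R) (cf : Omega -> conf).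
Hypotheses (HJpos : forall e, (0 < J e)%R)
  (HGsub : is_subgroup_Aut ends J Gam) (HGtr : is_transitive Gam)
  (HGunimod : is_unimodular Gam).
Variables (h Jst : R) (o : V).
Hypotheses (h0 : (0 < h)%R)
  (JstE : forall x, \esum_(e in [set: E]) (endcount ends e x * J e)%:E = Jst%:E).
Hypotheses (mcf : measurable_fun setT cf)
  (cf01 : forall w e, (0 <= (cf w).1 e <= 1)%R)
  (resample : forall (Phi : conf -> \bar R) e,
    measurable_fun setT Phi -> (forall z, 0 <= Phi z) ->
    \int[P]_w Phi (cf w) =
    \int[P]_w (((cf w).1 e)%:E * Phi (set_edge e true (cf w)) +
               (1 - (cf w).1 e)%:E * Phi (set_edge e false (cf w))))
  (green_law : forall (Psi : (fspace E R * fspace E bool)%type -> \bar R) e,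
    measurable_fun setT Psi -> (forall z, 0 <= Psi z) ->
    \int[P]_w (if (cf w).2.2 e then Psi ((cf w).1, (cf w).2.1) else 0) =
    (1 - expR (- (h * J e)))%:E * \int[P]_w Psi ((cf w).1, (cf w).2.1))
  (reindex : forall g (Phi : conf -> \bar R), Gam g ->
    measurable_fun setT Phi -> (forall z, 0 <= Phi z) ->
    \int[P]_w Phi (cf w) =
    \int[P]_w Phi ((cf w).1 \o g.2, ((cf w).2.1 \o g.2, (cf w).2.2 \o g.2))).

(** Absolute values of the weight of a closed edge ([ap]) and of an open one ([am]). [balance] is
    mean zero once [am] gets a minus sign. [ap_le] and [am_le] make the sums around a finite cluster
    finite; [ap_supp] and [am_supp] leave finitely many nonzero terms in them. *)
Variables (ap am : E -> R -> R) (kap eps : R).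
Hypotheses (kap0 : (0 <= kap)%R) (eps0 : (0 < eps)%R)
  (ap_ge0 : forall e x, (0 <= ap e x)%R) (am_ge0 : forall e x, (0 <= am e x)%R)
  (m_ap : forall e, measurable_fun setT (ap e))
  (m_am : forall e, measurable_fun setT (am e))
  (ap_le : forall e x, (ap e x <= kap * J e)%R)
  (am_le : forall e x, (am e x <= kap * J e)%R)
  (ap_supp : forall e x, (J e < eps)%R -> ap e x = 0%R)
  (am_supp : forall e x, (J e < eps)%R -> am e x = 0%R)
  (balance : forall e x, (0 <= x <= 1)%R -> ((1 - x) * ap e x = x * am e x)%R)
  (variance : forall e x, (0 <= x <= 1)%R ->
    (x * am e x ^+ 2 + (1 - x) * ap e x ^+ 2 <= J e)%R)
  (ap_inv : forall g e x, Gam g -> ap (g.2 e) x = ap e x)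
  (am_inv : forall g e x, Gam g -> am (g.2 e) x = am e x).

Definition closed_weight e (z : conf) : R := if z.2.1 e then 0%R else ap e (z.1 e).
Definition open_weight e (z : conf) : R := if z.2.1 e then am e (z.1 e) else 0%R.

Lemma closed_weight_ge0 e z : (0 <= closed_weight e z)%R.
Proof. by rewrite /closed_weight; case: ifP. Qed.

Lemma open_weight_ge0 e z : (0 <= open_weight e z)%R.
Proof. by rewrite /open_weight; case: ifP. Qed.

Lemma measurable_closed_weight e : measurable_fun setT (closed_weight e).
Proof.
apply: measurable_fun_ifT; [exact: measurable_open_edge|exact: measurable_cst|].
exact: (measurableT_comp (m_ap e) (measurable_env e)).
Qed.

Lemma measurable_open_weight e : measurable_fun setT (open_weight e).
Proof.
apply: measurable_fun_ifT; [exact: measurable_open_edge| |exact: measurable_cst].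
exact: (measurableT_comp (m_am e) (measurable_env e)).
Qed.

Definition ghost_weight e (z : conf) : R :=
  (if `[< Tevent ends z.2.1 z.2.2 e >] then ap e (z.1 e) else 0)%R.

Lemma ghost_weight_ge0 e z : (0 <= ghost_weight e z)%R.
Proof. by rewrite /ghost_weight; case: ifP. Qed.

Lemma measurable_ghost_weight e : measurable_fun setT (ghost_weight e).
Proof.
apply: measurable_if_pred; [exact: measurable_Tevent| |exact: measurable_cst].
exact: (measurableT_comp (m_ap e) (measurable_env e)).
Qed.

Lemma green_clusters_ge0 om gr e : 0 <= green_clusters ends om gr e :> \bar R.
Proof. by rewrite green_clustersE lee_fin ler0n. Qed.

Lemma measurable_weighted_clusters (c : E -> conf -> R) e :
  measurable_fun setT (c e) ->
  measurable_fun setT (fun z => (c e z)%:E * green_clusters ends z.2.1 z.2.2 e).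
Proof.
move=> mc; apply: emeasurable_funM; last exact: measurable_green_clusters.
exact/measurable_EFinP.
Qed.

(** After resampling [e], the ghost event and the closed weight survive only in the closed state,
    the open weight only in the open one. By [balance] all terms carry the factor
    [(1 - p) * ap = p * am], and what remains is [two_ghost_pointwise]. *)
Lemma edge_inequality e :
  \int[P]_w (ghost_weight e (cf w))%:E +
  \int[P]_w ((open_weight e (cf w))%:E * green_clusters ends (cf w).2.1 (cf w).2.2 e) <=
  \int[P]_w ((closed_weight e (cf w))%:E * green_clusters ends (cf w).2.1 (cf w).2.2 e).
Proof.
have mG := measurable_ghost_weight e.
have mO := measurable_weighted_clusters (measurable_open_weight e).
have mC := measurable_weighted_clusters (measurable_closed_weight e).
have G0 z : 0 <= (ghost_weight e z)%:E by rewrite lee_fin ghost_weight_ge0.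
have O0 z : 0 <= (open_weight e z)%:E * green_clusters ends z.2.1 z.2.2 e.
  by rewrite mule_ge0 ?lee_fin ?open_weight_ge0 ?green_clusters_ge0.
have C0 z : 0 <= (closed_weight e z)%:E * green_clusters ends z.2.1 z.2.2 e.
  by rewrite mule_ge0 ?lee_fin ?closed_weight_ge0 ?green_clusters_ge0.
have mGE : measurable_fun setT (fun z => (ghost_weight e z)%:E : \bar R).
  exact/measurable_EFinP.
rewrite -ge0_integralD//; last 2 first.
- exact: (measurableT_comp mGE mcf).
- exact: (measurableT_comp mO mcf).
have mGO : measurable_fun setT (fun z => (ghost_weight e z)%:E +
    (open_weight e z)%:E * green_clusters ends z.2.1 z.2.2 e).
  exact: emeasurable_funD.
rewrite (@resample _ e mGO); last by move=> z; exact: (adde_ge0 (G0 z) (O0 z)).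
rewrite (@resample _ e mC)//.
have p01 w : 0 <= ((cf w).1 e)%:E /\ 0 <= (1 - (cf w).1 e)%:E.
  by have /andP[? ?] := cf01 w e; rewrite !lee_fin subr_ge0.
have mset b (F : conf -> \bar R) : measurable_fun setT F ->
    measurable_fun setT (fun w => F (set_edge e b (cf w))).
  move=> mF; apply: (measurableT_comp mF).
  exact: (measurableT_comp (measurable_set_edge e b) mcf).
have mpe : measurable_fun setT (fun w => ((cf w).1 e)%:E).
  by apply/measurable_EFinP; exact: (measurableT_comp (measurable_env e) mcf).
have m1pe : measurable_fun setT (fun w => (1 - (cf w).1 e)%:E).
  apply/measurable_EFinP; apply: measurable_funB => //.
  exact: (measurableT_comp (measurable_env e) mcf).
have mres (F : conf -> \bar R) : measurable_fun setT F ->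
    measurable_fun setT (fun w => ((cf w).1 e)%:E * F (set_edge e true (cf w)) +
      (1 - (cf w).1 e)%:E * F (set_edge e false (cf w))).
  by move=> mF; apply: emeasurable_funD; apply: emeasurable_funM => //; exact: mset.
apply: ge0_le_integral => //.
- move=> w _; have [p0 q0] := p01 w.
  exact: (adde_ge0 (mule_ge0 p0 (adde_ge0 (G0 _) (O0 _)))
    (mule_ge0 q0 (adde_ge0 (G0 _) (O0 _)))).
- exact: mres mGO.
- exact: mres mC.
move=> w _; have [p0 q0] := p01 w; have bal := balance e (cf01 w e).
have eT : upd (cf w).2.1 e true e = true by rewrite /upd eqxx.
have eF : upd (cf w).2.1 e false e = false by rewrite /upd eqxx.
rewrite /closed_weight /open_weight /ghost_weight /set_edge /= !eT !eF.
rewrite (asboolF (_ : ~ Tevent ends (upd (cf w).2.1 e true) (cf w).2.2 e)); last first.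
  by case; rewrite eT.
rewrite !mul0e !add0e adde0.
have -> : (1 - (cf w).1 e)%:E * (if `[< Tevent ends (upd (cf w).2.1 e false) (cf w).2.2 e >]
      then ap e ((cf w).1 e) else 0)%:E =
    ((1 - (cf w).1 e) * ap e ((cf w).1 e))%:E *
    (\1_(Tevent ends (upd (cf w).2.1 e false) (cf w).2.2) e)%:E.
  rewrite -!EFinM indicE; case: asboolP => T; first by rewrite mem_set// mulr1.
  by rewrite memNset// !mulr0.
rewrite (muleA _ _ (green_clusters _ (upd _ _ true) _ _)).
rewrite (muleA _ _ (green_clusters _ (upd _ _ false) _ _)).
rewrite -(EFinM _ (am e _)) -(EFinM _ (ap e _)) -bal.
rewrite -ge0_muleDr ?green_clusters_ge0 ?lee_fin//.
rewrite mule0 add0e; apply: lee_wpmul2l.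
  by rewrite EFinM; apply: mule_ge0 => //; rewrite lee_fin.
by rewrite addeC; exact: two_ghost_pointwise.
Qed.

(** Each edge at [x] sends its weight to every finite green cluster it touches, split evenly among
    the vertices of that cluster; this is the share of [y]. *)
Definition transport (c : E -> conf -> R) x y (z : conf) : \bar R :=
  \esum_(e in [set: E]) (endcount ends e x *
    (if `[< good ends z.2.1 z.2.2 y /\ touches ends (cluster ends z.2.1 y) e >]
     then inv_size ends z.2.1 y else 0) * c e z)%:E.

Definition cluster_transport (c : E -> conf -> R) (z : conf) : \bar R :=
  \esum_(e in [set: E]) (
    (if `[< good ends z.2.1 z.2.2 o /\ touches ends (cluster ends z.2.1 o) e >]
     then inv_size ends z.2.1 o else 0) * c e z)%:E.

Section transport_identity.
Variable c : E -> conf -> R.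
Hypotheses (c0 : forall e z, (0 <= c e z)%R)
  (mc : forall e, measurable_fun setT (c e))
  (cinv : forall g e z, Gam g ->
    c (g.2 e) z = c e (z.1 \o g.2, (z.2.1 \o g.2, z.2.2 \o g.2))).

Let I y e (z : conf) : R :=
  (if `[< good ends z.2.1 z.2.2 y /\ touches ends (cluster ends z.2.1 y) e >]
   then inv_size ends z.2.1 y else 0)%R.

Let I_ge0 y e z : (0 <= I y e z)%R.
Proof. by rewrite /I; case: ifP => // _; exact: inv_size_ge0. Qed.

Let t_ge0 x y e z : 0 <= (endcount ends e x * I y e z * c e z)%:E.
Proof. by rewrite lee_fin !mulr_ge0// endcount_ge0. Qed.

Let mt x y e : measurable_fun setT (fun z => (endcount ends e x * I y e z * c e z)%:E).
Proof.
apply/measurable_EFinP; apply: measurable_funM => //; apply: measurable_funM.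
  exact: measurable_cst.
exact: measurable_inv_size_touching.
Qed.

Lemma transport_ge0 x y z : 0 <= transport c x y z.
Proof. by apply: esum_ge0 => e _; exact: t_ge0. Qed.

Lemma measurable_transport x y : measurable_fun setT (transport c x y).
Proof. by apply: emeasurable_esum; [move=> e z; exact: t_ge0|move=> e; exact: mt]. Qed.

Lemma transport_aut g x y z : Gam g -> transport c (g.1 x) (g.1 y) z =
  transport c x y (z.1 \o g.2, (z.2.1 \o g.2, z.2.2 \o g.2)).
Proof.
move=> Gg; have [k Gk [g1K k1K g2K k2K]] := Gam_inv HGsub Gg.
rewrite /transport (reindex_esum setT _ g.2).
  apply: eq_esum => e _; rewrite (endcount_aut HGsub)// cinv//.
  rewrite (inv_size_aut HGsub)//; congr (_ * _ * _)%:E.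
  congr (if _ then _ else _); apply: asbool_equiv_eq => /=.
  rewrite (good_aut HGsub _ _ _ Gg) (cluster_aut_image HGsub _ _ Gg).
  by rewrite (touches_aut HGsub _ _ Gg).
split => //; first by move=> e f _ _ /(can_inj g2K).
by move=> e _; exists (k.2 e).
Qed.

(** Mass sent by [o] equals mass received. Summing what is sent over [y] recovers the number of
    clusters touched by each edge at [o]. In what is received, every edge touching the cluster of
    [o] is counted from both its ends, hence the factor [2]. *)
Lemma transport_identity :
  \esum_(e in [set: E]) ((endcount ends e o)%:E *
    \int[P]_w ((c e (cf w))%:E * green_clusters ends (cf w).2.1 (cf w).2.2 e)) =
  2%:E * \int[P]_w cluster_transport c (cf w).
Proof.
have mtw x y e : measurable_fun setT (fun w =>
    (endcount ends e x * I y e (cf w) * c e (cf w))%:E).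
  exact: (measurableT_comp (mt x y e) mcf).
have mtr x y : measurable_fun setT (fun w => transport c x y (cf w)).
  exact: (measurableT_comp (measurable_transport x y) mcf).
transitivity (\esum_(y in [set: V]) \int[P]_w transport c o y (cf w)).
  rewrite -integral_esum//; last by move=> y w; exact: transport_ge0.
  transitivity (\int[P]_w (\esum_(e in [set: E]) \esum_(y in [set: V])
      (endcount ends e o * I y e (cf w) * c e (cf w))%:E)); last first.
    by apply: eq_integral => w _; rewrite exchange_esum.
  rewrite integral_esum//; last 2 first.
  - by move=> e w; apply: esum_ge0.
  - by move=> e; apply: emeasurable_esum.
  apply: eq_esum => e _; rewrite -ge0_integralZl//; last 3 first.
  - exact: (measurableT_comp (measurable_weighted_clusters (mc e)) mcf).
  - by move=> w _; rewrite mule_ge0 ?green_clusters_ge0 ?lee_fin.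
  - by rewrite lee_fin endcount_ge0.
  apply: eq_integral => w _; rewrite muleA -EFinM /green_clusters -esumZl; last 2 first.
  - by rewrite mulr_ge0// endcount_ge0.
  - by move=> y; rewrite lee_fin; exact: I_ge0.
  by apply: eq_esum => y _; rewrite -EFinM mulrAC.
rewrite (mass_transport HGsub HGtr HGunimod (f := fun x y => \int[P]_w transport c x y (cf w))); last 2 first.
- by move=> x y; apply: integral_ge0 => w _; exact: transport_ge0.
- move=> g x y Gg.
  rewrite (reindex Gg (measurable_transport x y)); last exact: transport_ge0.
  by apply: eq_integral => w _; rewrite transport_aut.
rewrite -integral_esum//; last by move=> y w; exact: transport_ge0.
rewrite -ge0_integralZl//; last 2 first.
- apply: (@measurableT_comp _ _ _ _ _ _ (cluster_transport c)) => //.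
  apply: emeasurable_esum => [e z|e]; first by rewrite lee_fin mulr_ge0// I_ge0.
  apply/measurable_EFinP; apply: measurable_funM => //.
  exact: measurable_inv_size_touching.
- by move=> w _; apply: esum_ge0 => e _; rewrite lee_fin mulr_ge0// I_ge0.
apply: eq_integral => w _; rewrite /transport exchange_esum => [|x e]; last exact: t_ge0.
rewrite /cluster_transport -esumZl//; last by move=> e; rewrite lee_fin mulr_ge0// I_ge0.
apply: eq_esum => e _; rewrite -(sum_endcount ends e) muleC -esumZl; last 2 first.
- by rewrite mulr_ge0// I_ge0.
- by move=> x; rewrite lee_fin endcount_ge0.
by apply: eq_esum => x _; rewrite -EFinM -mulrA mulrC.
Qed.

End transport_identity.

Lemma card_touching_sum (C : set V) (c : E -> R) (B : R) : finite_set C ->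
  (forall e, (0 <= c e)%R) ->
  (forall y, \esum_(e in [set: E]) (endcount ends e y * c e)%:E = B%:E) ->
  \esum_(e in [set: E]) (if `[< touches ends C e >] then c e else 0)%:E <=
  (B * #|` fset_set C|%:R)%:E.
Proof.
move=> fC c0 cB; apply: le_trans (touching_sum_le ends C c0) _.
under eq_esum do rewrite cB.
have B0 (y : V) : (0 <= B)%R.
  by rewrite -lee_fin -(cB y); apply: esum_ge0 => e _; rewrite lee_fin mulr_ge0// endcount_ge0.
rewrite EFinM -esum_indicator// -esumZl; [|exact: B0 o|by move=> z; rewrite lee_fin].
apply: le_esum => y _; rewrite indicE; case: asboolP => Cy.
  by rewrite mem_set// mule1.
by rewrite memNset// mule0.
Qed.

Lemma inv_size_card om : finite_set (cluster ends om o) ->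
  inv_size ends om o = (#|` fset_set (cluster ends om o)|%:R)^-1%R :> R.
Proof. by move=> fo; rewrite /inv_size esum_indicator. Qed.

Definition touching_sum (c : E -> conf -> R) (z : conf) : \bar R :=
  \esum_(e in [set: E]) (if `[< touches ends (cluster ends z.2.1 o) e >]
    then c e z else 0)%:E.

Lemma touching_sum_ge0 c z : (forall e, (0 <= c e z)%R) -> 0 <= touching_sum c z.
Proof. by move=> c0; apply: esum_ge0 => e _; rewrite lee_fin; case: ifP. Qed.

Lemma kapJE y : \esum_(e in [set: E]) (endcount ends e y * (kap * J e))%:E = (kap * Jst)%:E.
Proof.
rewrite EFinM -(JstE y) -esumZl//; last first.
  by move=> e; rewrite lee_fin mulr_ge0 ?endcount_ge0// ltW.
by apply: eq_esum => e _; rewrite -EFinM mulrCA.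
Qed.

Lemma touching_sum_kap_le c z : finite_set (cluster ends z.2.1 o) ->
  (forall e, (0 <= c e z)%R) -> (forall e, (c e z <= kap * J e)%R) ->
  touching_sum c z <= (kap * Jst * #|` fset_set (cluster ends z.2.1 o)|%:R)%:E.
Proof.
move=> fo c0 cle.
have k0 e : (0 <= kap * J e)%R by rewrite mulr_ge0// ltW.
apply: le_trans (card_touching_sum fo k0 kapJE).
by apply: le_esum => e _; rewrite lee_fin; case: ifP.
Qed.

Lemma cluster_transportE c z : (forall e, (0 <= c e z)%R) ->
  cluster_transport c z = (if `[< good ends z.2.1 z.2.2 o >]
    then inv_size ends z.2.1 o else 0)%:E * touching_sum c z.
Proof.
move=> c0; rewrite /cluster_transport /touching_sum -esumZl; last 2 first.
- by case: ifP => // _; exact: inv_size_ge0.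
- by move=> e; rewrite lee_fin; case: ifP.
apply: eq_esum => e _; rewrite -EFinM asbool_and.
by case: asboolP => _ /=; [case: ifP; rewrite ?mul0r ?mulr0|rewrite !mul0r].
Qed.

Lemma closed_weight_le e z : (closed_weight e z <= kap * J e)%R.
Proof. by rewrite /closed_weight; case: ifP => // _; rewrite mulr_ge0// ltW. Qed.

Lemma open_weight_le e z : (open_weight e z <= kap * J e)%R.
Proof. by rewrite /open_weight; case: ifP => // _; rewrite mulr_ge0// ltW. Qed.

(** The signed weight [H], split into two nonnegative sums. The values given by [fine] are
    meaningful when both sums are finite, as for a finite cluster; the quantities built from it
    below are set to [0] otherwise or carry the factor [inv_size]. *)
Definition fluctuation (z : conf) : R :=
  (fine (touching_sum closed_weight z) - fine (touching_sum open_weight z))%R.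

Definition mass (z : conf) : R := fine (touching_sum (fun e _ => J e) z).

Lemma touching_sum_fin c z : finite_set (cluster ends z.2.1 o) ->
  (forall e, (0 <= c e z)%R) -> (forall e, (c e z <= kap * J e)%R) ->
  touching_sum c z \is a fin_num.
Proof.
move=> fo c0 cle; rewrite ge0_fin_numE ?touching_sum_ge0//.
by apply: le_lt_trans (touching_sum_kap_le fo c0 cle) _; rewrite ltry.
Qed.

Lemma touching_mass_le z : finite_set (cluster ends z.2.1 o) ->
  touching_sum (fun e _ => J e) z <= (Jst * #|` fset_set (cluster ends z.2.1 o)|%:R)%:E.
Proof. by move=> fo; apply: card_touching_sum => // e; rewrite ltW. Qed.

Lemma touching_mass_fin z : finite_set (cluster ends z.2.1 o) ->
  touching_sum (fun e _ => J e) z \is a fin_num.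
Proof.
move=> fo; rewrite ge0_fin_numE ?touching_sum_ge0// => [|e]; last by rewrite ltW.
by apply: le_lt_trans (touching_mass_le fo) _; rewrite ltry.
Qed.

Lemma mass_ge0 z : (0 <= mass z)%R.
Proof. by rewrite fine_ge0// touching_sum_ge0// => e; rewrite ltW. Qed.

Lemma inv_size_mass_le z : finite_set (cluster ends z.2.1 o) ->
  (inv_size ends z.2.1 o * mass z <= Jst)%R.
Proof.
move=> fo; rewrite inv_size_card// mulrC ler_pdivrMr; last exact: card_cluster_gt0.
by rewrite -lee_fin /mass fineK ?touching_mass_fin// touching_mass_le.
Qed.

Definition ghost_fluctuation (z : conf) : R :=
  if `[< good ends z.2.1 z.2.2 o >] then (inv_size ends z.2.1 o * `|fluctuation z|)%R else 0%R.

Lemma ghost_fluctuation_ge0 z : (0 <= ghost_fluctuation z)%R.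
Proof. by rewrite /ghost_fluctuation; case: ifP => // _; rewrite mulr_ge0// inv_size_ge0. Qed.

Lemma measurable_fluctuation : measurable_fun setT fluctuation.
Proof.
by apply: measurable_funB; apply: measurable_touching_sum;
  [exact: closed_weight_ge0|exact: measurable_closed_weight|
   exact: open_weight_ge0|exact: measurable_open_weight].
Qed.

Lemma measurable_mass : measurable_fun setT mass.
Proof.
by apply: (@measurable_touching_sum _ _ _ _ (fun e _ => J e)) => // e z; rewrite ltW.
Qed.

Lemma measurable_size_fluctuation :
  measurable_fun setT (fun z : conf => (inv_size ends z.2.1 o * `|fluctuation z|)%R).
Proof.
apply: measurable_funM; first exact: measurable_inv_size.
exact: (measurableT_comp (@normr_measurable R setT) measurable_fluctuation).
Qed.

Lemma measurable_ghost_fluctuation : measurable_fun setT ghost_fluctuation.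
Proof.
apply: measurable_if_pred => //; first exact: measurable_good.
exact: measurable_size_fluctuation.
Qed.

Lemma cluster_transport_le z : cluster_transport closed_weight z <=
  cluster_transport open_weight z + (ghost_fluctuation z)%:E.
Proof.
rewrite !cluster_transportE; [|by move=> e; exact: open_weight_ge0|
  by move=> e; exact: closed_weight_ge0].
rewrite /ghost_fluctuation; case: asboolP => [[fo _]|_]; last by rewrite !mul0e adde0.
rewrite EFinM -ge0_muleDr ?lee_fin ?normr_ge0 ?touching_sum_ge0//; last first.
  by move=> e; exact: open_weight_ge0.
apply: lee_wpmul2l; first by rewrite lee_fin inv_size_ge0.
rewrite -(fineK (touching_sum_fin fo (closed_weight_ge0^~ z) (closed_weight_le^~ z))).
rewrite -(fineK (touching_sum_fin fo (open_weight_ge0^~ z) (open_weight_le^~ z))).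
by rewrite -EFinD lee_fin -lerBlDl ler_norm.
Qed.

(** Each vertex of the cluster accounts for weight at most [kap * Jst], and the sum is divided by
    the size. This bound makes the open part integrable. *)
Lemma cluster_transport_open_le z : cluster_transport open_weight z <= (kap * Jst)%:E.
Proof.
have Jst0 : (0 <= kap * Jst)%R.
  rewrite -lee_fin -(kapJE o); apply: esum_ge0 => e _.
  by rewrite lee_fin !mulr_ge0 ?endcount_ge0// ltW.
rewrite cluster_transportE; last by move=> e; exact: open_weight_ge0.
case: asboolP => [[fo _]|_]; last by rewrite mul0e lee_fin.
apply: (@le_trans _ _ ((inv_size ends z.2.1 o)%:E *
    (kap * Jst * #|` fset_set (cluster ends z.2.1 o)|%:R)%:E)).
  apply: lee_wpmul2l; first by rewrite lee_fin inv_size_ge0.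
  exact: (touching_sum_kap_le fo (open_weight_ge0^~ z) (open_weight_le^~ z)).
rewrite -EFinM lee_fin inv_size_card// mulrC mulfK// gt_eqF//.
exact: card_cluster_gt0.
Qed.

Lemma ghost_weight_sum_le :
  \esum_(e in [set: E]) ((endcount ends e o)%:E * \int[P]_w (ghost_weight e (cf w))%:E) <=
  2%:E * \int[P]_w (ghost_fluctuation (cf w))%:E.
Proof.
have cwinv g e z : Gam g -> closed_weight (g.2 e) z =
    closed_weight e (z.1 \o g.2, (z.2.1 \o g.2, z.2.2 \o g.2)).
  by move=> Gg; rewrite /closed_weight /= ap_inv.
have owinv g e z : Gam g -> open_weight (g.2 e) z =
    open_weight e (z.1 \o g.2, (z.2.1 \o g.2, z.2.2 \o g.2)).
  by move=> Gg; rewrite /open_weight /= am_inv.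
have TC := transport_identity closed_weight_ge0 measurable_closed_weight cwinv.
have TO := transport_identity open_weight_ge0 measurable_open_weight owinv.
have mct (c : E -> conf -> R) : (forall e z, (0 <= c e z)%R) -> (forall e, measurable_fun setT (c e)) ->
    measurable_fun setT (fun w => cluster_transport c (cf w)).
  move=> c0 mc; apply: (@measurableT_comp _ _ _ _ _ _ (cluster_transport c)) => //.
  apply: emeasurable_esum => [e z|e].
    by rewrite lee_fin mulr_ge0//; case: ifP => // _; exact: inv_size_ge0.
  apply/measurable_EFinP; apply: measurable_funM => //.
  exact: measurable_inv_size_touching.
have ct0 (c : E -> conf -> R) z : (forall e z, (0 <= c e z)%R) -> 0 <= cluster_transport c z.
  move=> c0; apply: esum_ge0 => e _.
  by rewrite lee_fin mulr_ge0//; case: ifP => // _; exact: inv_size_ge0.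
have mO := mct _ open_weight_ge0 measurable_open_weight.
have mC := mct _ closed_weight_ge0 measurable_closed_weight.
have mF : measurable_fun setT (fun w => (ghost_fluctuation (cf w))%:E : \bar R).
  by apply/measurable_EFinP; exact: (measurableT_comp measurable_ghost_fluctuation mcf).
pose IO := \int[P]_w cluster_transport open_weight (cf w).
have IO0 : 0 <= IO by apply: integral_ge0 => w _; apply: ct0; exact: open_weight_ge0.
have IOfin : 2%:E * IO \is a fin_num.
  rewrite fin_numM// ge0_fin_numE//.
  apply: (@le_lt_trans _ _ (\int[P]_w (cst (kap * Jst)%:E w))); last first.
    rewrite integral_cst// [X in _ * X](_ : _ = 1) ?mule1 ?ltry//.
    exact: probability_setT.
  apply: ge0_le_integral => //.
  - by move=> w _; apply: ct0; exact: open_weight_ge0.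
  - by move=> w _; exact: cluster_transport_open_le.
(* The open part is added to both sides, where it completes the summed edge inequality; finiteness
   is what allows it to be removed again. *)
rewrite -(leeD2rE _ _ IOfin) -ge0_muleDr//; last first.
  by apply: integral_ge0 => w _; rewrite lee_fin ghost_fluctuation_ge0.
apply: (@le_trans _ _ (2%:E * \int[P]_w cluster_transport closed_weight (cf w))).
  rewrite -TC -TO -esumD; last 2 first.
  - move=> e _; rewrite mule_ge0 ?lee_fin ?endcount_ge0//.
    by apply: integral_ge0 => w _; rewrite lee_fin ghost_weight_ge0.
  - move=> e _; rewrite mule_ge0 ?lee_fin ?endcount_ge0//.
    by apply: integral_ge0 => w _; rewrite mule_ge0 ?lee_fin ?open_weight_ge0 ?green_clusters_ge0.
  apply: le_esum => e _; rewrite -ge0_muleDr; last 2 first.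
  - by apply: integral_ge0 => w _; rewrite lee_fin ghost_weight_ge0.
  - by apply: integral_ge0 => w _; rewrite mule_ge0 ?lee_fin ?open_weight_ge0 ?green_clusters_ge0.
  by apply: lee_wpmul2l; [rewrite lee_fin endcount_ge0|exact: edge_inequality].
apply: lee_wpmul2l => //; rewrite addeC /IO -ge0_integralD//; last 2 first.
- by move=> w _; apply: ct0; exact: open_weight_ge0.
- by move=> w _; rewrite lee_fin ghost_fluctuation_ge0.
apply: ge0_le_integral => //.
- by move=> w _; apply: ct0; exact: closed_weight_ge0.
- exact: emeasurable_funD.
- by move=> w _; exact: cluster_transport_le.
Qed.


(** * Integrating out the ghost field by a union bound over green edges *)

Definition finite_fluctuation (z : conf) : R :=
  if `[< finite_set (cluster ends z.2.1 o) >]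
  then (inv_size ends z.2.1 o * `|fluctuation z|)%R else 0%R.

Lemma finite_fluctuation_ge0 z : (0 <= finite_fluctuation z)%R.
Proof. by rewrite /finite_fluctuation; case: ifP => // _; rewrite mulr_ge0// inv_size_ge0. Qed.

Lemma measurable_finite_fluctuation : measurable_fun setT finite_fluctuation.
Proof.
apply: measurable_if_pred => //; first exact: measurable_conf_finite.
exact: measurable_size_fluctuation.
Qed.

Definition normalized_fluctuation (z : conf) : R :=
  if `[< finite_set (cluster ends z.2.1 o) >]
  then (h * `|fluctuation z| / (1 + h * mass z))%R else 0%R.

Lemma normalized_fluctuation_ge0 z : (0 <= normalized_fluctuation z)%R.
Proof.
rewrite /normalized_fluctuation; case: ifP => // _.
by rewrite divr_ge0 ?mulr_ge0 ?addr_ge0 ?mulr_ge0 ?mass_ge0// ltW.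
Qed.

Lemma measurable_normalized_fluctuation : measurable_fun setT normalized_fluctuation.
Proof.
apply: measurable_if_pred => //; first exact: measurable_conf_finite.
apply: measurable_funM.
  apply: measurable_funM => //.
  exact: (measurableT_comp (@normr_measurable R setT) measurable_fluctuation).
apply: (measurableT_comp measurable_invr).
apply: measurable_funD => //; apply: measurable_funM => //.
exact: measurable_mass.
Qed.

(** The union bound is useful only while [h m <= 1]; above this threshold the requirement to touch
    green is simply dropped. *)
Definition small_mass (z : conf) : bool := (h * mass z <= 1)%R.

Lemma measurable_small_mass : measurable_fun setT small_mass.
Proof.
apply: measurable_fun_ler; last exact: measurable_cst.
by apply: measurable_funM => //; exact: measurable_mass.
Qed.

Definition edge_fluctuation e (z : conf) : R :=
  if `[< touches ends (cluster ends z.2.1 o) e >]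
  then (if small_mass z then finite_fluctuation z else 0)%R else 0%R.

Definition large_fluctuation (z : conf) : R :=
  if small_mass z then 0%R else finite_fluctuation z.

Lemma edge_fluctuation_ge0 e z : (0 <= edge_fluctuation e z)%R.
Proof.
by rewrite /edge_fluctuation; do 2?case: ifP => // _; exact: finite_fluctuation_ge0.
Qed.

Lemma large_fluctuation_ge0 z : (0 <= large_fluctuation z)%R.
Proof. by rewrite /large_fluctuation; case: ifP => // _; exact: finite_fluctuation_ge0. Qed.

Lemma measurable_edge_fluctuation e : measurable_fun setT (edge_fluctuation e).
Proof.
apply: measurable_if_pred => //; first exact: measurable_conf_touches.
apply: measurable_fun_ifT => //; first exact: measurable_small_mass.
exact: measurable_finite_fluctuation.
Qed.

Lemma measurable_large_fluctuation : measurable_fun setT large_fluctuation.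
Proof.
apply: measurable_fun_ifT => //; first exact: measurable_small_mass.
exact: measurable_finite_fluctuation.
Qed.

Lemma ghost_fluctuation_union z : (ghost_fluctuation z)%:E <=
  (large_fluctuation z)%:E +
  \esum_(e in [set: E]) (if z.2.2 e then (edge_fluctuation e z)%:E else 0).
Proof.
have s0 e : 0 <= (if z.2.2 e then (edge_fluctuation e z)%:E else 0).
  by case: ifP => // _; rewrite lee_fin edge_fluctuation_ge0.
rewrite /ghost_fluctuation; case: asboolP => [[fo [e [ge te]]]|_]; last first.
  by apply: adde_ge0; [rewrite lee_fin large_fluctuation_ge0|exact: esum_ge0].
rewrite /large_fluctuation; case: ifPn => sm; last first.
  rewrite /finite_fluctuation asboolT//; apply: leeDl; exact: esum_ge0.
rewrite add0e; apply: le_trans (esum_term_le e s0).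
by rewrite ge /edge_fluctuation sm /finite_fluctuation !asboolT.
Qed.

(** With [t = h m], the small case uses [1 + t <= 2] and the large one [1 + t <= 2 t]: together,
    [min 1 t <= 2 t / (1 + t)]. The factor [m / |K| <= Jst] absorbs the inverse size. *)
Lemma union_normalized z :
  (large_fluctuation z)%:E +
  \esum_(e in [set: E]) ((h * J e)%:E * (edge_fluctuation e z)%:E) <=
  (2 * Jst * normalized_fluctuation z)%:E.
Proof.
have h_ge0 : (0 <= h)%R by exact: ltW.
have [fo|nfo] := pselect (finite_set (cluster ends z.2.1 o)); last first.
  rewrite /large_fluctuation /finite_fluctuation (asboolF nfo) if_same add0e.
  rewrite esum1; first by rewrite /normalized_fluctuation (asboolF nfo) mulr0.
  by move=> e _; rewrite /edge_fluctuation /finite_fluctuation (asboolF nfo) !if_same mule0.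
have X0 := finite_fluctuation_ge0 z.
have iJ := inv_size_mass_le fo.
have m0 := mass_ge0 z.
have n0 : (0 <= `|fluctuation z|)%R by exact: normr_ge0.
have hm0 : (0 < 1 + h * mass z)%R by rewrite ltr_pwDl// mulr_ge0.
have XE : finite_fluctuation z = (inv_size ends z.2.1 o * `|fluctuation z|)%R.
  by rewrite /finite_fluctuation asboolT.
have NE : normalized_fluctuation z = (h * `|fluctuation z| / (1 + h * mass z))%R.
  by rewrite /normalized_fluctuation asboolT.
have hN : (0 <= h * `|fluctuation z|)%R by rewrite mulr_ge0.
have Jst0 : (0 <= Jst)%R by apply: le_trans iJ; rewrite mulr_ge0// inv_size_ge0.
rewrite /large_fluctuation /edge_fluctuation; case: ifPn => sm.
  rewrite add0e.
  have -> : \esum_(e in [set: E]) ((h * J e)%:E *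
      (if `[< touches ends (cluster ends z.2.1 o) e >] then finite_fluctuation z else 0)%:E) =
      (h * finite_fluctuation z)%:E * (mass z)%:E.
    rewrite /mass fineK ?touching_mass_fin// /touching_sum -esumZl; last 2 first.
    - by rewrite mulr_ge0.
    - by move=> e; rewrite lee_fin; case: ifP => // _; rewrite ltW.
    by apply: eq_esum => e _; rewrite -!EFinM; case: ifP => _;
      rewrite ?mulr0// mulrAC.
  rewrite -EFinM lee_fin NE mulrA ler_pdivlMr// XE.
  rewrite (_ : h * (_ * _) * _ * _ = (inv_size ends z.2.1 o * mass z) *
    (h * `|fluctuation z|) * (1 + h * mass z))%R; last by ring.
  rewrite (_ : 2 * Jst * (h * _) = Jst * (h * `|fluctuation z|) * 2)%R; last by ring.
  apply: ler_pM => //.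
  - by rewrite !mulr_ge0// inv_size_ge0.
  - exact: ltW.
  - by apply: ler_wpM2r.
  - by have -> : (2 = 1 + 1 :> R)%R by []; rewrite lerD2l.
rewrite esum1 ?adde0; last by move=> e _; rewrite if_same mule0.
rewrite lee_fin NE mulrA ler_pdivlMr// XE.
rewrite (_ : 2 * Jst * (h * _) = Jst * `|fluctuation z| * (2 * h))%R; last by ring.
apply: (@le_trans _ _ (inv_size ends z.2.1 o * `|fluctuation z| * (2 * h * mass z)))%R.
  apply: ler_wpM2l; first by rewrite mulr_ge0// inv_size_ge0.
  rewrite -ltNge in sm.
  rewrite (_ : 2 * h * mass z = h * mass z + h * mass z)%R; last by ring.
  by rewrite lerD2r ltW.
rewrite (_ : _ * _ * (2 * h * _) =
  (inv_size ends z.2.1 o * mass z) * `|fluctuation z| * (2 * h))%R; last by ring.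
apply: ler_wpM2r; first by rewrite mulr_ge0.
exact: ler_wpM2r.
Qed.

(** [F] ignores the ghost field, so a constant field is substituted for it and the colour of [e]
    factors out, with probability [1 - exp (- h J) <= h J]. *)
Lemma green_edge_le e (F : conf -> R) : (forall z, (0 <= F z)%R) ->
  measurable_fun setT F ->
  (forall z gr, F (z.1, (z.2.1, gr)) = F z) ->
  \int[P]_w (if (cf w).2.2 e then (F (cf w))%:E else 0) <=
  (h * J e)%:E * \int[P]_w (F (cf w))%:E.
Proof.
move=> F0 mF Fgr.
pose emb (z : (fspace E R * fspace E bool)%type) : conf := (z.1, (z.2, fun=> false)).
have memb : measurable_fun setT emb.
  apply/(@measurable_fun_pairP _ _ _ _ (fspace E R) (fspace E bool * fspace E bool)%type).
  split; first exact: (@measurable_fst _ _ (fspace E R) (fspace E bool)).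
  apply/(@measurable_fun_pairP _ _ _ _ (fspace E bool) (fspace E bool)).
  split; first exact: (@measurable_snd _ _ (fspace E R) (fspace E bool)).
  by apply: measurable_fspace => f; exact: measurable_cst.
have mFe : measurable_fun setT (fun z => (F (emb z))%:E : \bar R).
  by apply/measurable_EFinP; exact: (measurableT_comp mF memb).
have FE w : F (emb ((cf w).1, (cf w).2.1)) = F (cf w) by exact: Fgr.
have -> : \int[P]_w (if (cf w).2.2 e then (F (cf w))%:E else 0) =
    (1 - expR (- (h * J e)))%:E * \int[P]_w (F (cf w))%:E.
  under eq_integral do rewrite -FE.
  rewrite (@green_law (fun z => (F (emb z))%:E) e mFe); last by move=> z; rewrite lee_fin.
  by congr (_ * _); apply: eq_integral => w _; rewrite FE.
apply: lee_wpmul2r; first by apply: integral_ge0 => w _; rewrite lee_fin.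
rewrite lee_fin lerBlDr -lerBlDl.
by have := @expR_ge1Dx R (- (h * J e)); rewrite addrC.
Qed.

Lemma ghost_fluctuation_bound :
  \int[P]_w (ghost_fluctuation (cf w))%:E <=
  (2 * Jst)%:E * \int[P]_w (normalized_fluctuation (cf w))%:E.
Proof.
have mL : measurable_fun setT (fun w => (large_fluctuation (cf w))%:E : \bar R).
  by apply/measurable_EFinP; exact: (measurableT_comp measurable_large_fluctuation mcf).
have mEf e : measurable_fun setT (fun w => (edge_fluctuation e (cf w))%:E : \bar R).
  by apply/measurable_EFinP; exact: (measurableT_comp (measurable_edge_fluctuation e) mcf).
have E0 e w : 0 <= (edge_fluctuation e (cf w))%:E by rewrite lee_fin edge_fluctuation_ge0.
have L0 w : 0 <= (large_fluctuation (cf w))%:E by rewrite lee_fin large_fluctuation_ge0.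
have gE0 e w : 0 <= (if (cf w).2.2 e then (edge_fluctuation e (cf w))%:E else 0).
  by case: ifP.
have mgE e : measurable_fun setT
    (fun w => if (cf w).2.2 e then (edge_fluctuation e (cf w))%:E else 0).
  apply: measurable_fun_ifT => //; first exact: (measurableT_comp (measurable_green_edge e) mcf).
have hJ0 e : (0 <= h * J e)%R by rewrite mulr_ge0// ltW.
have mN : measurable_fun setT (fun w => (normalized_fluctuation (cf w))%:E : \bar R).
  by apply/measurable_EFinP; exact: (measurableT_comp measurable_normalized_fluctuation mcf).
have N0 w : 0 <= (normalized_fluctuation (cf w))%:E.
  by rewrite lee_fin normalized_fluctuation_ge0.
have Jst0 : (0 <= 2 * Jst)%R.
  rewrite mulr_ge0// -lee_fin -(JstE o); apply: esum_ge0 => e _.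
  by rewrite lee_fin mulr_ge0 ?endcount_ge0// ltW.
have mhE e : measurable_fun setT (fun w => (h * J e)%:E * (edge_fluctuation e (cf w))%:E).
  by apply: emeasurable_funM => //; exact: measurable_cst.
have hE0 e w : 0 <= (h * J e)%:E * (edge_fluctuation e (cf w))%:E.
  by apply: mule_ge0 => //; rewrite lee_fin.
apply: (@le_trans _ _ (\int[P]_w ((large_fluctuation (cf w))%:E +
    \esum_(e in [set: E]) (if (cf w).2.2 e then (edge_fluctuation e (cf w))%:E else 0)))).
  apply: ge0_le_integral => //.
  - by move=> w _; rewrite lee_fin ghost_fluctuation_ge0.
  - by apply/measurable_EFinP; exact: (measurableT_comp measurable_ghost_fluctuation mcf).
  - by apply: emeasurable_funD => //; exact: emeasurable_esum.
  - by move=> w _; exact: ghost_fluctuation_union.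
rewrite ge0_integralD//; last 2 first.
- by move=> w _; apply: esum_ge0.
- exact: emeasurable_esum.
rewrite integral_esum//.
apply: (@le_trans _ _ (\int[P]_w (large_fluctuation (cf w))%:E +
    \esum_(e in [set: E]) \int[P]_w ((h * J e)%:E * (edge_fluctuation e (cf w))%:E))).
  apply: leeD2l; apply: le_esum => e _; rewrite ge0_integralZl//; last by rewrite lee_fin.
  apply: green_edge_le => //; first by move=> z; exact: edge_fluctuation_ge0.
  exact: measurable_edge_fluctuation.
rewrite -integral_esum// -ge0_integralD//; last 2 first.
- by move=> w _; apply: esum_ge0.
- exact: emeasurable_esum.
rewrite -ge0_integralZl//.
apply: ge0_le_integral => //.
- by move=> w _; apply: adde_ge0 => //; exact: esum_ge0.
- by apply: emeasurable_funD => //; exact: emeasurable_esum.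
- by apply: emeasurable_funM => //; exact: measurable_cst.
- by move=> w _; rewrite -EFinM; exact: union_normalized.
Qed.


(** * Averaging over finitely many edges, and the second moment of the normalized weight *)

Section expectation.
Variable phi : conf -> R.
Hypotheses (phi0 : forall z, (0 <= phi z)%R) (mphi : measurable_fun setT phi).

Definition expect_config (s : seq E) (z : conf) : R :=
  expect z.1 s (fun om => phi (z.1, (om, z.2.2))) z.2.1.

Lemma measurable_expect_config s : measurable_fun setT (expect_config s).
Proof.
elim: s => [|e s ih].
  rewrite (_ : expect_config [::] = phi)//.
  by apply/funext => -[p [om gr]].
have mset b : measurable_fun setT (fun z => expect_config s (set_edge e b z)).
  exact: (measurableT_comp ih (measurable_set_edge e b)).
rewrite (_ : expect_config (e :: s) = fun z =>
  (z.1 e * expect_config s (set_edge e true z) +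
   (1 - z.1 e) * expect_config s (set_edge e false z))%R)//.
apply: measurable_funD; apply: measurable_funM => //; first exact: measurable_env.
by apply: measurable_funB; [exact: measurable_cst|exact: measurable_env].
Qed.

Lemma expect_config_ge0 s (z : conf) : (forall e, 0 <= z.1 e <= 1)%R ->
  (0 <= expect_config s z)%R.
Proof.
elim: s z => [|e s ih] z z01; first by case: z {z01} => p [om gr]; exact: phi0.
have /andP[z0 z1] := z01 e.
have ih_ b : (0 <= expect_config s (set_edge e b z))%R by exact: ih.
by apply: addr_ge0; apply: mulr_ge0; rewrite ?subr_ge0//; exact: ih_.
Qed.

(** The tower property, obtained by resampling the edges of [s] one at a time. *)
Lemma integral_expect_config s :
  \int[P]_w (phi (cf w))%:E = \int[P]_w (expect_config s (cf w))%:E.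
Proof.
elim: s => [|e s ->].
  by apply: eq_integral => w _; rewrite /expect_config /=; case: (cf w) => p [om gr].
(* Nonnegativity is known where the environment lies in [[0, 1]], while resampling asks for a
   function nonnegative everywhere; the absolute value changes nothing along [cf]. *)
have absE z : (forall e, 0 <= z.1 e <= 1)%R ->
    (expect_config s z)%:E = `|expect_config s z|%:E.
  by move=> z01; rewrite ger0_norm// expect_config_ge0.
under eq_integral do rewrite (absE _ (cf01 _)).
rewrite (@resample (fun z => `|expect_config s z|%:E) e); last 2 first.
- apply/measurable_EFinP.
  exact: (measurableT_comp (@normr_measurable R setT) (measurable_expect_config s)).
- by move=> z; rewrite lee_fin.
apply: eq_integral => w _.
by rewrite !ger0_norm ?expect_config_ge0// => f; exact: cf01.
Qed.

End expectation.

Definition step_weight (z : conf) e (b : bool) : R :=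
  if b then (- am e (z.1 e))%R else ap e (z.1 e).

Definition explored (n : nat) (z : conf) : R :=
  penalized h (revealed_mass ends J (first_edges E n) [set o] z.2.1)
    (revealed_sum ends (step_weight z) (first_edges E n) [set o] z.2.1).

Lemma explored_ge0 n z : (0 <= explored n z)%R.
Proof. by apply: divr_ge0; [apply: mulr_ge0|]; exact: sqr_ge0. Qed.

Lemma measurable_restr (s : seq E) :
  measurable_fun setT (fun z : conf => (restr s z.2.1 : fspace E bool)).
Proof.
apply: measurable_fspace => e; rewrite /restr; case: (e \in s) => /=.
  exact: measurable_open_edge.
exact: measurable_cst.
Qed.

Lemma measurable_revealed s e (f g : conf -> R) :
  measurable_fun setT f -> measurable_fun setT g ->
  measurable_fun setT (fun z : conf => if revealed ends s [set o] z.2.1 e then f z else g z).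
Proof.
move=> mf mg; apply: measurable_if_pred => //; rewrite (_ : [set z | _] = [set z : conf | touches ends (cluster ends (restr s z.2.1) o) e]).
  have := measurable_restr s measurableT (measurable_touches ends o e).
  by rewrite setTI.
by apply/seteqP; split => z; rewrite /= reach1.
Qed.

Lemma measurable_explored n : measurable_fun setT (explored n).
Proof.
have mQ : measurable_fun setT (fun z : conf =>
    revealed_mass ends J (first_edges E n) [set o] z.2.1).
  apply: measurable_sum => e; exact: measurable_revealed.
have mM : measurable_fun setT (fun z : conf =>
    revealed_sum ends (step_weight z) (first_edges E n) [set o] z.2.1).
  apply: measurable_sum => e; apply: measurable_revealed => //.
  apply: (measurable_fun_ifT (measurable_open_edge e)).
    exact: (measurableT_comp (@oppr_measurable R setT)
      (measurableT_comp (m_am e) (measurable_env e))).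
  exact: (measurableT_comp (m_ap e) (measurable_env e)).
apply: measurable_funM.
  by apply: measurable_funM => //; exact: measurable_funX.
apply: (measurableT_comp measurable_invr); apply: measurable_funX.
by apply: measurable_funD => //; exact: measurable_funM.
Qed.

Lemma integral_explored_le n : \int[P]_w (explored n (cf w))%:E <= h%:E.
Proof.
rewrite (integral_expect_config (explored_ge0 n) (measurable_explored n) (first_edges E n)).
apply: (@le_trans _ _ (\int[P]_w (cst h%:E w))); last first.
  by rewrite integral_cst// [X in _ * X](_ : _ = 1) ?mule1//; exact: probability_setT.
apply: ge0_le_integral => //.
- by move=> w _; rewrite lee_fin expect_config_ge0//; exact: explored_ge0.
- apply/measurable_EFinP.
  exact: (measurableT_comp (measurable_expect_config (measurable_explored n) _) mcf).
move=> w _; rewrite lee_fin.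
have J0 e : (0 <= J e)%R by rewrite ltW.
have mean e : ((cf w).1 e * step_weight (cf w) e true +
    (1 - (cf w).1 e) * step_weight (cf w) e false = 0)%R.
  by rewrite /step_weight balance// mulrN addNr.
have var e : ((cf w).1 e * step_weight (cf w) e true ^+ 2 +
    (1 - (cf w).1 e) * step_weight (cf w) e false ^+ 2 <= J e)%R.
  by rewrite /step_weight sqrrN; exact: variance.
have := @exploration_bound _ _ _ ends _ (cf01 w) _ _ J0 mean var _ h0
  (first_edges E n) [set o] 0%R 0%R (cf w).2.1 (@first_edges_uniq E n) (lexx _).
have -> : (lyapunov h 0 0 = h)%R.
  by rewrite /lyapunov /penalized expr0n /= !mulr0 mul0r add0r addr0 divr1.
apply: le_trans; rewrite /expect_config /explored le_eqVlt; apply/orP; left; apply/eqP.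
by apply: expect_ext => om' _; rewrite !add0r.
Qed.

Lemma penalized_le q q' m : (0 <= q')%R -> (q' <= q)%R -> (penalized h q m <= penalized h q' m)%R.
Proof.
move=> q'0 q'q; have h_ge0 : (0 <= h)%R by exact: ltW.
have q'1 : (0 < 1 + h * q')%R by rewrite ltr_pwDl// mulr_ge0.
have q'q1 : (1 + h * q' <= 1 + h * q)%R by rewrite lerD2l ler_wpM2l.
apply: ler_wpM2l; first by rewrite mulr_ge0 ?sqr_ge0.
rewrite lef_pV2 ?posrE ?exprn_gt0// ?(lt_le_trans q'1)//.
by rewrite ler_pXn2r// nnegrE ltW// (lt_le_trans q'1).
Qed.

(** From some index on, the first edges determine the finite cluster and include all touching edges
    with [J >= eps], the only ones with nonzero weight, so the revealed sum is [H] exactly. The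
    revealed mass may still fall short of the full mass, which only increases [penalized]. *)
Lemma explored_eventually z : finite_set (cluster ends z.2.1 o) ->
  exists N, forall n, (N <= n)%N -> (normalized_fluctuation z ^+ 2 <= explored n z)%R.
Proof.
move=> fo; pose K := cluster ends z.2.1 o.
have [N1 KN1] := finite_cluster_restr fo.
have mfin : touching_sum (fun e _ => J e) z < +oo.
  by have := touching_mass_fin fo; rewrite ge0_fin_numE// touching_sum_ge0// => e; rewrite ltW.
have J0 e : (0 <= if `[< touches ends K e >] then J e else 0)%R by case: ifP => // _; rewrite ltW.
have [N2 SN2] := finite_in_first_edges (finite_large_terms eps0 J0 mfin).
exists (maxn N1 N2) => n; rewrite geq_max => /andP[N1n N2n].
have us := @first_edges_uniq E n.
have rev e : revealed ends (first_edges E n) [set o] z.2.1 e = `[< touches ends K e >].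
  by rewrite /revealed reach1 KN1.
have off e : e \notin first_edges E n -> touches ends K e -> (J e < eps)%R.
  move=> es Ke; rewrite ltNge; apply: contra es => epsJ.
  by apply: (SN2 n N2n); rewrite /= asboolT.
have HE : fluctuation z = revealed_sum ends (step_weight z) (first_edges E n) [set o] z.2.1.
  rewrite /fluctuation /touching_sum (@esum_seq _ _ (first_edges E n)); first last.
  - move=> e es; case: asboolP => // Ke; rewrite /closed_weight ap_supp ?if_same//.
    exact: off.
  - by move=> e; case: ifP => // _; exact: closed_weight_ge0.
  - exact: us.
  rewrite (@esum_seq _ _ (first_edges E n)); first last.
  - move=> e es; case: asboolP => // Ke; rewrite /open_weight am_supp ?if_same//.
    exact: off.
  - by move=> e; case: ifP => // _; exact: open_weight_ge0.
  - exact: us.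
  rewrite /= -sumrB; apply: eq_bigr => e _; rewrite rev /closed_weight /open_weight /step_weight.
  case: asboolP => _; last by rewrite subrr.
  by case: (z.2.1 e); rewrite ?subr0 ?sub0r.
have -> : (normalized_fluctuation z ^+ 2 = penalized h (mass z) (fluctuation z))%R.
  by rewrite /normalized_fluctuation asboolT// /penalized expr_div_n exprMn real_normK ?num_real.
rewrite /explored -HE; apply: penalized_le.
  by apply: sumr_ge0 => e _; case: ifP => // _; rewrite ltW.
rewrite /revealed_mass /mass -lee_fin fineK ?touching_mass_fin//.
under eq_bigr do rewrite rev.
exact: sum_seq_le_esum.
Qed.

Lemma integral_sqr_normalized_le :
  \int[P]_w (normalized_fluctuation (cf w) ^+ 2)%:E <= h%:E.
Proof.
apply: (@integral_le_eventually _ _ _ P _ (fun n w => (explored n (cf w))%:E)).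
- apply/measurable_EFinP; apply: measurable_funX.
  exact: (measurableT_comp measurable_normalized_fluctuation mcf).
- by move=> n; apply/measurable_EFinP; exact: (measurableT_comp (measurable_explored n) mcf).
- by move=> w; rewrite lee_fin sqr_ge0.
- by move=> n w; rewrite lee_fin explored_ge0.
- move=> w; have [fo|nfo] := pselect (finite_set (cluster ends (cf w).2.1 o)).
    have [N eN] := explored_eventually fo.
    by exists N => n Nn; rewrite lee_fin eN.
  exists 0%N => n _; rewrite /normalized_fluctuation (asboolF nfo) expr0n /=.
  by rewrite lee_fin explored_ge0.
- exact: integral_explored_le.
Qed.

(** A second moment of at most [h] gives a first moment of at most [sqrt h]. In place of
    Cauchy-Schwarz, [x <= x^2 / (2 s) + s / 2] is integrated at [s = sqrt h], where each term
    contributes at most [s / 2]. *)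
Lemma integral_normalized_le :
  \int[P]_w (normalized_fluctuation (cf w))%:E <= (Num.sqrt h)%:E.
Proof.
set s := Num.sqrt h.
have s0 : (0 < s)%R by rewrite sqrtr_gt0.
have sh : (s ^+ 2 = h)%R by rewrite sqr_sqrtr// ltW.
clearbody s.
have mN : measurable_fun setT (fun w => normalized_fluctuation (cf w)).
  exact: (measurableT_comp measurable_normalized_fluctuation mcf).
have mS : measurable_fun setT (fun w => (normalized_fluctuation (cf w) ^+ 2)%:E : \bar R).
  by apply/measurable_EFinP; exact: measurable_funX.
pose k : R := (2 * s)^-1%R.
have k0 : (0 <= k)%R by rewrite invr_ge0 mulr_ge0// ltW.
have am_gm (x : R) : (x <= k * x ^+ 2 + s / 2)%R.
  have E0 : (k * x ^+ 2 + s / 2 - x = k * (x - s) ^+ 2)%R.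
    by rewrite /k; field; exact: lt0r_neq0.
  by rewrite -subr_ge0 E0; apply: mulr_ge0 => //; exact: sqr_ge0.
apply: (@le_trans _ _ (\int[P]_w (k%:E * (normalized_fluctuation (cf w) ^+ 2)%:E +
    (s / 2)%:E))).
  apply: ge0_le_integral => //.
  - by move=> w _; rewrite lee_fin normalized_fluctuation_ge0.
  - exact/measurable_EFinP.
  - by apply: emeasurable_funD => //; apply: emeasurable_funM => //; exact: measurable_cst.
  - by move=> w _; rewrite -EFinM -EFinD lee_fin am_gm.
rewrite ge0_integralD//; last 3 first.
- by move=> w _; rewrite mule_ge0// lee_fin// sqr_ge0.
- by apply: emeasurable_funM => //; exact: measurable_cst.
- by move=> w _; rewrite lee_fin divr_ge0// ltW.
rewrite ge0_integralZl//; last first.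
  by move=> w _; rewrite lee_fin sqr_ge0.
rewrite integral_cst// [X in _ + _ * X](_ : _ = 1); last exact: probability_setT.
rewrite mule1; apply: (@le_trans _ _ (k%:E * h%:E + (s / 2)%:E)).
  by apply: leeD2r; apply: lee_wpmul2l => //; exact: integral_sqr_normalized_le.
rewrite -EFinM -EFinD lee_fin -sh /k le_eqVlt; apply/orP; left; apply/eqP.
by field; exact: lt0r_neq0.
Qed.

Lemma truncated_two_ghost :
  \esum_(e in [set: E]) ((endcount ends e o)%:E * \int[P]_w (ghost_weight e (cf w))%:E) <=
  (4 * Jst * Num.sqrt h)%:E.
Proof.
have Jst0 : (0 <= 2 * Jst)%R.
  rewrite mulr_ge0// -lee_fin -(JstE o); apply: esum_ge0 => e _.
  by rewrite lee_fin mulr_ge0 ?endcount_ge0// ltW.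
apply: le_trans ghost_weight_sum_le _.
apply: (@le_trans _ _ (2%:E * ((2 * Jst)%:E * (Num.sqrt h)%:E))); last first.
  by rewrite -!EFinM lee_fin le_eqVlt; apply/orP; left; apply/eqP; ring.
apply: lee_wpmul2l => //; apply: le_trans ghost_fluctuation_bound _.
by apply: lee_wpmul2l; [rewrite lee_fin|exact: integral_normalized_le].
Qed.

End TwoGhost.

(** * Truncation and disintegration *)
Section Truncation.
Context {R : realType}.
Implicit Types eps j x : R.

(** One condition governs both amplitudes and is symmetric under [x -> 1 - x], so truncating keeps
    the mean at zero and can only lower the variance. *)
Definition truncation eps j x : bool := [&& eps <= j, eps <= x & x <= 1 - eps].

Definition closed_amplitude eps j x : R :=
  if truncation eps j x then Num.sqrt (j * x / (1 - x)) else 0.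

Definition open_amplitude eps j x : R :=
  if truncation eps j x then Num.sqrt (j * (1 - x) / x) else 0.

Lemma closed_amplitude_ge0 eps j x : 0 <= closed_amplitude eps j x.
Proof. by rewrite /closed_amplitude; case: ifP => // _; exact: sqrtr_ge0. Qed.

Lemma open_amplitude_ge0 eps j x : 0 <= open_amplitude eps j x.
Proof. by rewrite /open_amplitude; case: ifP => // _; exact: sqrtr_ge0. Qed.

Lemma open_amplitudeE eps j x : open_amplitude eps j x = closed_amplitude eps j (1 - x).
Proof.
rewrite /open_amplitude /closed_amplitude /truncation.
have -> : 1 - (1 - x) = x by ring.
have -> : (eps <= 1 - x) = (x <= 1 - eps) by apply/idP/idP => ?; lra.
have -> : (1 - x <= 1 - eps) = (eps <= x) by apply/idP/idP => ?; lra.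
by rewrite [(x <= _) && _]andbC.
Qed.

Lemma measurable_truncation eps j : measurable_fun setT (truncation eps j).
Proof.
apply: measurable_and; first exact: measurable_cst.
by apply: measurable_and; apply: measurable_fun_ler.
Qed.

Lemma measurable_closed_amplitude eps j : measurable_fun setT (closed_amplitude eps j).
Proof.
apply: measurable_fun_ifT; [exact: measurable_truncation| |exact: measurable_cst].
apply: (measurableT_comp measurable_sqrtr); apply: measurable_funM.
  by apply: measurable_funM.
by apply: (measurableT_comp measurable_invr); exact: measurable_funB.
Qed.

Lemma measurable_open_amplitude eps j : measurable_fun setT (open_amplitude eps j).
Proof.
rewrite (_ : open_amplitude eps j = fun x => closed_amplitude eps j (1 - x)); last first.
  by apply/funext => x; exact: open_amplitudeE.
by apply: (measurableT_comp (@measurable_closed_amplitude eps j)); exact: measurable_funB.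
Qed.

(** The cut-off on [x] gives [x / (1 - x) <= eps^-1], and [j >= eps] gives [1 <= j / eps]; hence the
    radicand [j x / (1 - x)] is at most [(j / eps)^2]. The lower bound on [j] is what replaces
    [sqrt j] by a multiple of [j]. *)
Lemma closed_amplitude_le eps j x : 0 < eps -> 0 < j -> closed_amplitude eps j x <= eps^-1 * j.
Proof.
move=> eps0 j0; rewrite /closed_amplitude; case: ifP => [/and3P[ej ex xe]|_]; last first.
  by rewrite mulr_ge0// ?invr_ge0 ltW.
have x0 : 0 < x by exact: lt_le_trans ex.
have x1e : eps <= 1 - x by rewrite lerBrDl -lerBrDr.
have x1 : 0 < 1 - x by exact: lt_le_trans x1e.
have kj0 : 0 <= eps^-1 * j by rewrite mulr_ge0 ?invr_ge0// ltW.
rewrite -(ger0_norm kj0) -sqrtr_sqr ler_sqrt ?sqr_ge0//.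
have xx : x / (1 - x) <= eps^-1.
  rewrite -[leRHS]mul1r; apply: ler_pM; rewrite ?invr_ge0 ?(ltW x0) ?(ltW x1)//.
    by rewrite (le_trans xe)// gerBl ltW.
  by rewrite lef_pV2 ?posrE.
have jj : 1 <= eps^-1 * j by rewrite mulrC ler_pdivlMr// mul1r.
rewrite expr2 -mulrA -[leLHS]mul1r; apply: ler_pM => //.
  by rewrite mulr_ge0 ?divr_ge0// ltW.
by rewrite [leLHS]mulrC ler_wpM2r// ltW.
Qed.

Lemma amplitude_balance eps j x : 0 < eps -> 0 < j ->
  (1 - x) * closed_amplitude eps j x = x * open_amplitude eps j x.
Proof.
move=> eps0 j0; rewrite /closed_amplitude /open_amplitude.
case: ifP => [/and3P[ej ex xe]|_]; last by rewrite !mulr0.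
have x0 : 0 < x by exact: lt_le_trans ex.
have x1 : 0 < 1 - x by apply: lt_le_trans eps0 _; rewrite lerBrDl -lerBrDr.
have sq (y a : R) : 0 <= y -> y * Num.sqrt a = Num.sqrt (y ^+ 2 * a).
  by move=> y0; rewrite sqrtrM ?sqr_ge0// sqrtr_sqr ger0_norm.
rewrite !sq ?ltW//; congr Num.sqrt; field.
by rewrite !lt0r_neq0.
Qed.

Lemma amplitude_variance eps j x : 0 < eps -> 0 < j ->
  x * open_amplitude eps j x ^+ 2 + (1 - x) * closed_amplitude eps j x ^+ 2 <= j.
Proof.
move=> eps0 j0; rewrite /closed_amplitude /open_amplitude.
case: ifP => [/and3P[ej ex xe]|_]; last by rewrite expr0n /= !mulr0 addr0 ltW.
have x0 : 0 < x by exact: lt_le_trans ex.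
have x1 : 0 < 1 - x by apply: lt_le_trans eps0 _; rewrite lerBrDl -lerBrDr.
have a0 : 0 <= j * (1 - x) / x by apply: divr_ge0; [apply: mulr_ge0|]; exact: ltW.
have b0 : 0 <= j * x / (1 - x) by apply: divr_ge0; [apply: mulr_ge0|]; exact: ltW.
rewrite !sqr_sqrtr//.
rewrite le_eqVlt; apply/orP; left; apply/eqP; field.
by rewrite !lt0r_neq0.
Qed.

End Truncation.

(** * Sums over the oriented edges leaving a vertex *)

Section OrientedEdges.
Local Open Scope ereal_scope.
Context {R : realType} (V E : countType) (ends : E -> V * V).

Lemma sum_oriented (f : E -> \bar R) (x : V) : (forall e, 0 <= f e) ->
  \esum_(y in [set: E * bool]) (if tail ends y == x then f y.1 else 0) =
  \esum_(e in [set: E]) ((endcount ends e x)%:E * f e).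
Proof.
move=> f0.
have t0 y : 0 <= (if tail ends y == x then f y.1 else 0) by case: ifP.
have -> : [set: E * bool] = [set: E] `*`` (fun=> [set: bool]) by apply/seteqP; split.
rewrite -(@esum_esum R E bool setT (fun=> setT)
  (fun e b => if tail ends (e, b) == x then f e else 0)); last first.
  by move=> e b _ _; exact: (t0 (e, b)).
apply: eq_esum => e _; rewrite (esumID [set true]); last by move=> b _; exact: (t0 (e, b)).
have -> : [set: bool] `&` ~` [set true] = [set false].
  by apply/seteqP; split => [[] // [_ /(_ erefl)]|_ ->].
rewrite setTI !esum_set1 ?(t0 (e, true)) ?(t0 (e, false))// /tail /endcount /=.
by case: eqP => _; case: eqP => _; rewrite ?mul0e ?mul1e ?add0e ?adde0//;
  rewrite natrD EFinD ge0_muleDl ?lee_fin// mul1e.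
Qed.

Lemma endcount_mass_lty (J : E -> R) (x : V) : (forall e, (0 < J e)%R) ->
  \esum_(e in incident ends x) (J e)%:E < +oo ->
  \esum_(e in [set: E]) (endcount ends e x * J e)%:E < +oo.
Proof.
move=> J0; rewrite esum_mkcond => Jfin.
have t0 e : 0 <= (if e \in (incident ends x : set E) then (J e)%:E else 0).
  by case: ifP => // _; rewrite lee_fin ltW.
apply: (@le_lt_trans _ _ (2%:E *
    \esum_(e in [set: E]) (if e \in (incident ends x : set E) then (J e)%:E else 0))); last first.
  by apply: lte_mul_pinfty.
rewrite -esumZl//; apply: le_esum => e _; case: ifPn => [_|ex].
  rewrite -EFinM lee_fin; apply: ler_wpM2r; first exact: ltW.
  rewrite /endcount.
  by rewrite (ler_nat R _ 2); case: eqP => _; case: eqP => _.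
rewrite mule0 lee_fin /endcount.
case: eqP => [e1|_]; first by rewrite mem_set in ex => //; left.
case: eqP => [e2|_]; first by rewrite mem_set in ex => //; right.
by rewrite mul0r.
Qed.

Lemma endcount_mass_aut (J : E -> R) (Gam : set ((V -> V) * (E -> E))) g (x : V) :
  is_subgroup_Aut ends J Gam -> Gam g ->
  \esum_(e in [set: E]) (endcount ends e (g.1 x) * J e)%:E =
  \esum_(e in [set: E]) (endcount ends e x * J e)%:E.
Proof.
move=> Gs Gg; have [k Gk [g1K k1K g2K k2K]] := Gam_inv Gs Gg.
rewrite (reindex_esum setT _ g.2).
  apply: eq_esum => e _; rewrite (endcount_aut Gs)//.
  by have [_ [_ [_ ->]]] := Gs.1 _ Gg.
split => //; first by move=> e f _ _ /(can_inj g2K).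
by move=> e _; exists (k.2 e).
Qed.

Lemma endcount_mass_gt0 (J : E -> R) (Jst : R) (y : E * bool) (x : V) :
  (forall e, (0 < J e)%R) ->
  \esum_(e in [set: E]) (endcount ends e x * J e)%:E = Jst%:E ->
  tail ends y = x -> (0 < Jst)%R.
Proof.
move=> J0 JstE yx; rewrite -lte_fin -JstE.
apply: lt_le_trans (esum_term_le y.1 _); last first.
  by move=> e; rewrite lee_fin mulr_ge0 ?endcount_ge0// ltW.
rewrite lte_fin mulr_gt0// ltr0n; move: yx; rewrite /tail.
by case: y.2 => ->; rewrite eqxx ?addnS.
Qed.

End OrientedEdges.

(** * Averaging over an independent random index *)

Section Disintegration.
Local Open Scope ereal_scope.
Context {R : realType} (E I : countType) d (Omega : measurableType d)
  (P : probability Omega R).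
Notation conf := (fspace E R * (fspace E bool * fspace E bool))%type.
Variables (cf : Omega -> conf) (eta : Omega -> I) (q : I -> \bar R).
Hypotheses (mcf : measurable_fun setT cf)
  (meta : forall x, measurable (eta @^-1` [set x]))
  (law : forall (Phi : conf -> \bar R) x,
    measurable_fun setT Phi -> (forall z, 0 <= Phi z) ->
    \int[P]_(w in eta @^-1` [set x]) Phi (cf w) = q x * \int[P]_w Phi (cf w)).
Variable G : I -> conf -> R.
Hypotheses (G0 : forall x z, (0 <= G x z)%R) (mG : forall x, measurable_fun setT (G x)).

Let fibre x w : \bar R := if eta w == x then (G x (cf w))%:E else 0.

Let fibre_ge0 x w : 0 <= fibre x w.
Proof. by rewrite /fibre; case: ifP => // _; rewrite lee_fin. Qed.

Let mGcf x : measurable_fun setT (fun w => (G x (cf w))%:E : \bar R).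
Proof. by apply/measurable_EFinP; exact: (measurableT_comp (mG x) mcf). Qed.

Let measurable_fibre x : measurable_fun setT (fibre x).
Proof.
apply: measurable_fun_ifT => //; apply: (measurable_fun_bool true); rewrite setTI.
suff -> : (fun w => eta w == x) @^-1` [set true] = eta @^-1` [set x] by [].
by apply/seteqP; split => w /= /eqP.
Qed.

Let fibreE w : (G (eta w) (cf w))%:E = \esum_(x in [set: I]) fibre x w.
Proof.
rewrite (esumID [set eta w]) => [|x _]; last exact: fibre_ge0.
rewrite setTI esum_set1 ?fibre_ge0// {1}/fibre eqxx esum1 ?adde0// => x [_ /= xw].
by rewrite /fibre; case: eqP => // wx; exfalso; apply: xw.
Qed.

Lemma measurable_at_random_index : measurable_fun setT (fun w => (G (eta w) (cf w))%:E : \bar R).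
Proof.
rewrite (_ : (fun w => _) = fun w => \esum_(x in [set: I]) fibre x w).
  exact: emeasurable_esum.
by apply/funext => w; exact: fibreE.
Qed.

Lemma integral_at_random_index : \int[P]_w (G (eta w) (cf w))%:E =
  \esum_(x in [set: I]) (q x * \int[P]_w (G x (cf w))%:E).
Proof.
under eq_integral do rewrite fibreE.
rewrite integral_esum//; apply: eq_esum => x _.
rewrite -(law x (Phi := fun z => (G x z)%:E)); last 2 first.
- exact/measurable_EFinP.
- by move=> z; rewrite lee_fin.
rewrite [RHS]integral_mkcond; apply: eq_integral => w _; rewrite /fibre patchE.
case: eqP => wx; first by rewrite mem_set.
by rewrite memNset.
Qed.

End Disintegration.

(** * Removal of the truncation and conclusion *)

Lemma inv_succ_eventually_le (R : realType) (x : R) : 0 < x ->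
  exists N, forall n, (N <= n)%N -> n.+1%:R^-1 <= x.
Proof.
move=> x0; exists (Num.truncn x^-1) => n Nn.
rewrite -[leRHS]invrK lef_pV2 ?posrE ?invr_gt0//.
by apply: ltW; apply: lt_le_trans (truncnS_gt _) _; rewrite ler_nat.
Qed.

Theorem theorem3p1
  (V E : countType) (ends : E -> V * V) (R : realType) (J : E -> R)
  (HJpos : forall e, 0 < J e)
  (HJsum : forall v : V, (\esum_(e in incident ends v) (J e)%:E < +oo)%E)
  (Hconn : connected_graph ends)
  (HGtrans : forall x y : V, exists g, is_aut ends J g /\ g.1 x = y)
  (Gam : set ((V -> V) * (E -> E)))
  (HGsub : is_subgroup_Aut ends J Gam)
  (HGclosed : is_closed_subgroup ends J Gam)
  (HGtr : is_transitive Gam)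
  (HGunimod : is_unimodular Gam)
  (o : V) (h : R) (Hh : 0 < h)
  (d : measure_display) (Omega : measurableType d) (P : probability Omega R)
  (* the random environment p, the uniforms U (percolation) and W (ghost field),
     and the random oriented edge eta *)
  (p U W : Omega -> E -> R) (eta : Omega -> E * bool)
  (Hp_meas : forall e, measurable_fun setT (fun w => p w e))
  (HU_meas : forall e, measurable_fun setT (fun w => U w e))
  (HW_meas : forall e, measurable_fun setT (fun w => W w e))
  (Heta_meas : forall x, measurable (eta @^-1` [set x]))
  (Hp01 : forall w e, 0 <= p w e <= 1)
  (* Gamma-invariance of the law mu of p *)
  (Hinv : forall g, Gam g -> forall A, prod_measurable A ->
      P [set w | A (p w)] = P [set w | A (fun e => p w (g.2 e))])
  (* joint law: mu (x) Unif[0,1]^E (x) Unif[0,1]^E (x) law of eta,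
     where eta is an oriented edge emanating from o with probability
     proportional to J *)
  (Hlaw : forall A (s t : seq E) (B C : E -> set R) (x0 : E * bool),
      prod_measurable A -> uniq s -> uniq t ->
      (forall e, measurable (B e)) -> (forall e, measurable (C e)) ->
      P [set w | A (p w) /\ (forall e, e \in s -> B e (U w e)) /\
                 (forall e, e \in t -> C e (W w e)) /\ eta w = x0]
      = (P [set w | A (p w)] *
         \prod_(e <- s) lebesgue_measure (B e `&` `[0%R, 1%R]) *
         \prod_(e <- t) lebesgue_measure (C e `&` `[0%R, 1%R]) *
         (if tail ends x0 == o
          then (J x0.1)%:E /
               (\esum_(y in [set y | tail ends y = o]) (J y.1)%:E)
          else 0))%E) :
  let omega := fun w e => U w e <= p w e in
  let green := fun w e => W w e <= 1 - expR (- (h * J e)) in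
  (\int[P]_w
     ((\1_(Tevent ends (omega w) (green w)) (eta w).1 *
       (if p w (eta w).1 == 1 then 0
        else Num.sqrt (p w (eta w).1 / ((1 - p w (eta w).1) * J (eta w).1))))%:E)
   <= (21 * Num.sqrt h)%:E)%E.
Proof.
cbv zeta.
pose gthr e : R := 1 - expR (- (h * J e)).
have gthr01 e : 0 <= gthr e <= 1.
  have hJ : 0 <= h * J e by rewrite mulr_ge0// ltW.
  by rewrite /gthr subr_ge0 -expR0 ler_expR oppr_le0 hJ expR0 lerBlDr lerDl expR_ge0.
pose D x := (\esum_(e in [set: E]) (endcount ends e x * J e)%:E)%E.
pose Jst := fine (D o).
have Dfin : D o \is a fin_num.
  rewrite ge0_fin_numE; first exact: endcount_mass_lty.
  by apply: esum_ge0 => e _; rewrite lee_fin mulr_ge0 ?endcount_ge0// ltW.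
(* Transitivity gives every vertex the same total weight, as the bounds on cluster masses
   require. *)
have JstE x : D x = Jst%:E.
  rewrite fineK//; have [g [Gg <-]] := HGtr o x; exact: endcount_mass_aut Gg.
have Jdeg : (\esum_(y in [set y | tail ends y = o]) (J y.1)%:E)%E = Jst%:E.
  rewrite -(JstE o) /D.
  transitivity (\esum_(e in [set: E]) ((endcount ends e o)%:E * (J e)%:E))%E; last first.
    by apply: eq_esum => e _; rewrite -EFinM.
  rewrite -sum_oriented; last by move=> e; rewrite lee_fin ltW.
  rewrite esum_mkcond; apply: eq_esum => y _.
  by case: eqP => yo; [rewrite mem_set|rewrite memNset].
pose q (y : E * bool) : \bar R :=
  (if tail ends y == o then (J y.1)%:E / Jst%:E else 0)%E.
have law := Hlaw; rewrite Jdeg in law.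
pose cf := config p U W gthr.
have mcf : measurable_fun setT cf := measurable_config Hp_meas HU_meas HW_meas gthr.
have law_eta := config_eta Hp_meas HU_meas HW_meas Heta_meas (q := q) law gthr.
have resample := config_resample Hp_meas HU_meas HW_meas Heta_meas (q := q) law gthr Hp01.
have green_law := config_green Hp_meas HU_meas HW_meas Heta_meas (q := q) law gthr01.
pose eps (n : nat) : R := n.+1%:R^-1.
have eps0 n : 0 < eps n by rewrite invr_gt0 ltr0n.
pose ghost n := @ghost_weight R V E ends (fun e x => closed_amplitude (eps n) (J e) x).
have Jinv g e : Gam g -> J (g.2 e) = J e by move=> /(HGsub.1 _)[_ [_ [_ ->]]].
have bound n : (\esum_(e in [set: E]) ((endcount ends e o)%:E *
    \int[P]_w (ghost n e (cf w))%:E) <= (4 * Jst * Num.sqrt h)%:E)%E.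
  apply: (@truncated_two_ghost R V E ends J Gam d Omega P cf HJpos HGsub HGtr HGunimod
    h Jst o Hh JstE mcf _ _ _ _ (fun e x => closed_amplitude (eps n) (J e) x)
    (fun e x => open_amplitude (eps n) (J e) x) (eps n)^-1 (eps n)).
  - by move=> w e; exact: Hp01.
  - by move=> Phi e mPhi Phi0; exact: resample.
  - by move=> Psi e mPsi Psi0; exact: green_law.
  - move=> g Phi Gg mPhi Phi0; have [k Gk [_ _ gK kK]] := Gam_inv HGsub Gg.
    apply: (@config_reindex R E (E * bool)%type d Omega P p U W eta q
      Hp_meas HU_meas HW_meas Heta_meas law gthr g.2 k.2 Phi) => //.
    + by move=> e; rewrite /gthr Jinv.
    + by move=> A mA; exact: Hinv.
  - by rewrite invr_ge0 ltW.
  - exact: eps0.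
  - by move=> e x; exact: closed_amplitude_ge0.
  - by move=> e x; exact: open_amplitude_ge0.
  - by move=> e; exact: measurable_closed_amplitude.
  - by move=> e; exact: measurable_open_amplitude.
  - by move=> e x; exact: closed_amplitude_le.
  - by move=> e x; rewrite open_amplitudeE; exact: closed_amplitude_le.
  - by move=> e x; rewrite /closed_amplitude /truncation leNgt => ->.
  - by move=> e x; rewrite /open_amplitude /truncation leNgt => ->.
  - by move=> e x _; exact: amplitude_balance.
  - by move=> e x _; exact: amplitude_variance.
  - by move=> g e x Gg; rewrite Jinv.
  - by move=> g e x Gg; rewrite Jinv.
have ghost0 n e z : 0 <= ghost n e z.
  by rewrite /ghost /ghost_weight; case: ifP => // _; exact: closed_amplitude_ge0.
have mghost n e : measurable_fun setT (ghost n e).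
  apply: measurable_if_pred; [exact: measurable_Tevent| |exact: measurable_cst].
  exact: (measurableT_comp (@measurable_closed_amplitude R (eps n) (J e)) (measurable_env e)).
pose target (y : E * bool) (z : fspace E R * (fspace E bool * fspace E bool)) : R :=
  if `[< Tevent ends z.2.1 z.2.2 y.1 >] then
    (if z.1 y.1 == 1 then 0 else Num.sqrt (z.1 y.1 / ((1 - z.1 y.1) * J y.1))) else 0.
(* Dividing by [J] turns [sqrt (J p / (1 - p))] into the integrand; the probability [J / Jst] of the
   edge then cancels this division. *)
pose approx n (y : E * bool) z : R := ghost n y.1 z * (J y.1)^-1.
have target0 y z : 0 <= target y z by rewrite /target; do 2?case: ifP.
have approx0 n y z : 0 <= approx n y z by rewrite mulr_ge0// invr_ge0 ltW.
have mtarget y : measurable_fun setT (target y).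
  apply: measurable_if_pred; [exact: measurable_Tevent| |exact: measurable_cst].
  apply: measurable_fun_ifT; [|exact: measurable_cst|].
    by apply: measurable_fun_eqr; [exact: measurable_env|exact: measurable_cst].
  apply: (measurableT_comp measurable_sqrtr); apply: measurable_funM.
    exact: measurable_env.
  apply: (measurableT_comp measurable_invr); apply: measurable_funM => //.
  by apply: measurable_funB => //; exact: measurable_env.
have mapprox n y : measurable_fun setT (approx n y).
  by apply: measurable_funM; [exact: mghost|exact: measurable_cst].
rewrite (_ : (fun w => _) = fun w => (target (eta w) (cf w))%:E); last first.
  apply/funext => w; rewrite /target indicE; congr EFin.
  case: asboolP => T; first by rewrite mem_set// mul1r.
  by rewrite memNset// mul0r.
apply: (@integral_le_eventually _ _ _ P _ (fun n w => (approx n (eta w) (cf w))%:E)).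
- exact: measurable_at_random_index.
- by move=> n; exact: measurable_at_random_index.
- by move=> w; rewrite lee_fin.
- by move=> n w; rewrite lee_fin.
- move=> w; rewrite /target /approx; set e := (eta w).1.
  case: asboolP => [T|_]; last first.
    by exists 0%N => n _; rewrite lee_fin; exact: (approx0 n (eta w)).
  set x := (cf w).1 e; have /andP[x0 x1] : 0 <= x <= 1 by exact: Hp01.
  case: eqP => [_|/eqP xn1].
    by exists 0%N => n _; rewrite lee_fin; exact: (approx0 n (eta w)).
  (* At [p = 0] every truncated weight vanishes, but so does the integrand. *)
  have [x00|xn0] := eqVneq x 0.
    exists 0%N => n _; rewrite x00 mul0r sqrtr0 lee_fin; exact: (approx0 n (eta w)).
  have {}x0 : 0 < x by rewrite lt0r xn0.
  have {}x1 : 0 < 1 - x by rewrite subr_gt0 lt_neqAle xn1.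
  have J0 := HJpos e.
  have [N1 N1P] := inv_succ_eventually_le J0.
  have [N2 N2P] := inv_succ_eventually_le x0.
  have [N3 N3P] := inv_succ_eventually_le x1.
  (* Beyond this index none of the three cut-offs is active, and the truncated integrand equals the
     full one. *)
  exists (maxn N1 (maxn N2 N3)) => n; rewrite !geq_max => /and3P[n1 n2 n3].
  rewrite lee_fin /ghost /ghost_weight asboolT// /closed_amplitude -/x.
  have -> : truncation (eps n) (J e) x.
    by rewrite /truncation N1P// N2P//= lerBrDr -lerBrDl N3P.
  rewrite le_eqVlt; apply/orP; left; apply/eqP.
  have Ji0 : 0 <= (J e)^-1 by rewrite invr_ge0 ltW.
  have -> : (J e)^-1 = Num.sqrt ((J e)^-1 ^+ 2) by rewrite sqrtr_sqr ger0_norm.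
  rewrite -sqrtrM; last first.
    by apply: divr_ge0; [apply: mulr_ge0|]; exact: ltW.
  congr Num.sqrt; field.
  by rewrite !lt0r_neq0.
move=> n; rewrite (integral_at_random_index mcf Heta_meas law_eta (approx0 n) (mapprox n)).
pose f e : \bar R := ((Jst^-1)%:E * \int[P]_w (ghost n e (cf w))%:E)%E.
have I0 e : (0 <= \int[P]_w (ghost n e (cf w))%:E)%E.
  by apply: integral_ge0 => w _; rewrite lee_fin.
have Jst0 : 0 <= Jst.
  rewrite -lee_fin -(JstE o); apply: esum_ge0 => e _.
  by rewrite lee_fin mulr_ge0 ?endcount_ge0// ltW.
have f0 e : (0 <= f e)%E by apply: mule_ge0 => //; rewrite lee_fin invr_ge0.
rewrite (@eq_esum _ _ _ _ (fun y => if tail ends y == o then f y.1 else 0)%E); last first.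
  move=> y _; rewrite /q; case: eqP => [yo|_]; last by rewrite mul0e.
  (* An oriented edge leaving [o] exists in this branch, which makes the normalization positive. *)
  have Jst_gt0 := endcount_mass_gt0 HJpos (JstE o) yo.
  rewrite inver gt_eqF// -EFinM.
  under eq_integral do rewrite /approx EFinM muleC.
  rewrite ge0_integralZl//; last 3 first.
  - by apply/measurable_EFinP; exact: (measurableT_comp (mghost n y.1) mcf).
  - by move=> w _; rewrite lee_fin.
  - by rewrite lee_fin invr_ge0 ltW.
  rewrite muleA -EFinM /f; congr (_%:E * _)%E.
  by rewrite mulrAC divff ?mul1r// gt_eqF.
rewrite sum_oriented//.
rewrite (@eq_esum _ _ _ _ (fun e => (Jst^-1)%:E *
  ((endcount ends e o)%:E * \int[P]_w (ghost n e (cf w))%:E))%E); last first.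
  by move=> e _; rewrite /f muleCA.
rewrite esumZl ?invr_ge0//; last first.
  by move=> e; apply: mule_ge0 => //; rewrite lee_fin endcount_ge0.
apply: (@le_trans _ _ ((Jst^-1)%:E * (4 * Jst * Num.sqrt h)%:E)%E).
  by apply: lee_wpmul2l; [rewrite lee_fin invr_ge0|exact: bound].
rewrite -EFinM lee_fin; have s0 : 0 <= Num.sqrt h by exact: sqrtr_ge0.
(* For [Jst = 0] the left side is [0]; otherwise [Jst] cancels and [4 <= 21] remains. *)
have [->|Jn0] := eqVneq Jst 0; first by rewrite mulr0 mul0r mulr0 mulr_ge0.
rewrite (mulrC 4) -mulrA mulKf//.
by rewrite ler_wpM2r// ler_nat.
Qed.
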